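(* Let $(M,\omega,I)$ be a (pseudo-)Kähler manifold equipped with an action of a Lie group $G$ with Lie algebra $\mathfrak g$, or with an action of a finite dimensional real or complex Lie algebra $\mathfrak g$ by vector fields, and denote by $X_\xi$, $\xi\in\mathfrak g$, the corresponding vector fields. An invariant star product $\star$ of Wick type on $(M,\omega,I)$ with Karabegov's characterizing form $K(\star)$ admits a quantum Hamiltonian if and only if there is an element $J\in C^1(\mathfrak g,C^\infty(M))[[\nu]]$ such that $$dJ(\xi)=i_{X_\xi}K(\star)\qquad\forall\,\xi\in\mathfrak g,$$ i.e. if and only if the (de Rham) cohomology class of $i_{X_\xi}K(\star)$ vanishes for all $\xi\in\mathfrak g$. Moreover, from this equation $J$ is determined (in case it exists) up to elements in $C^1(\mathfrak g,\mathbb C)[[\nu]]$.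
   Context: Conventions. Kähler manifolds $(M,\omega,I)$ (symplectic form $\omega$, complex structure $I$) include pseudo-Kähler manifolds: no positivity of $\omega(\cdot,I\cdot)$ is assumed. $C^\infty(M)$ denotes complex-valued smooth functions; vector fields and forms are complex-valued as well. $\nu$ is a formal parameter; operations on functions, forms etc. are extended $\nu$-linearly to formal power series. Summation convention is used. Hamiltonian vector fields and Poisson bracket: $i_{X^\omega_f}\omega=df$ and $\{f,g\}=-X^\omega_f(g)$. A star product on $(M,\omega)$ is an associative $\mathbb C[[\nu]]$-bilinear product $a\star b=\sum_{r\ge 0}\nu^rC_r(a,b)$ on $C^\infty(M)[[\nu]]$ with bidifferential operators $C_r$, $C_0(a,b)=ab$, $C_1(a,b)-C_1(b,a)=\{a,b\}$ and $1\star a=a\star 1=a$. Being given by bidifferential operators, $\star$ restricts to open subsets of $M$. We write $\mathrm{ad}_\star(a)b=a\star b-b\star a$. A star product is of Wick type on $(M,\omega,I)$ if in local holomorphic coordinates, for $r\ge1$, $C_r(a,b)=\sum_{K,\bar L}C_r^{K;\bar L}\frac{\partial^{|K|}a}{\partial z^K}\frac{\partial^{|\bar L|}b}{\partial \bar z^L}$ with local coefficient functions $C_r^{K;\bar L}$ (only holomorphic derivatives of the first argument and only anti-holomorphic derivatives of the second). Karabegov's characterizing form: write $Z_k=\partial_{z^k}$, $\bar Z_l=\partial_{\bar z^l}$. On every contractible domain $U$ of a holomorphic chart $(z,U)$ there exist $u_k,\bar v_l\in C^\infty(U)[[\nu]]$ such that $a\star u_k=au_k+\nu Z_k(a)$ and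 $\bar v_l\star a=\bar v_l a+\nu\bar Z_l(a)$ for all $a\in C^\infty(U)[[\nu]]$. The form $K(\star)$ is defined by $K(\star)|_U=\bar\partial(-u_k\,dz^k)=\partial(\bar v_l\,d\bar z^l)$; by Karabegov this is a globally well-defined formal series of closed two-forms of type $(1,1)$ on $M$ with $K(\star)=\omega+O(\nu)$. Actions and invariance. A Lie algebra action is given by a Lie algebra anti-homomorphism $\mathfrak g\ni\xi\mapsto X_\xi$ into the smooth complex-valued vector fields on $M$, and $\varrho(\xi)a=-X_\xi(a)$ is the induced action on $C^\infty(M)[[\nu]]$; $\star$ is $\mathfrak g$-invariant if each $\varrho(\xi)$ is a derivation of $\star$. For a left action $\Phi:G\times M\to M$ of a Lie group $G$ with Lie algebra $\mathfrak g$, $\star$ is $G$-invariant if each pull-back $\Phi(g^{-1},\cdot)^*$, $g\in G$, is an automorphism of $\star$; one then uses the induced Lie algebra action given by $X_\xi(m)=\frac{d}{dt}\big|_{t=0}\Phi(\exp(t\xi),m)$ (and $G$-invariance implies $\mathfrak g$-invariance). ''Invariant'' means $G$-invariant resp. $\mathfrak g$-invariant. $C^k(\mathfrak g,V)$ denotes the space of $V$-valued $k$-multilinear alternating forms on $\mathfrak g$. A quantum Hamiltonian for the action is an element $J\in C^1(\mathfrak g,C^\infty(M))[[\nu]]$ with $\varrho(\xi)=\frac1\nu\mathrm{ad}_\star(J(\xi))$ for all $\xi\in\mathfrak g$.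
   Formalization: The final clause, that J is determined up to elements of C^1(g,C)[[ν]], is stated for connected M only; on a disconnected M, J is determined only up to locally constant functions. *)

(* Defs.v *)
(* MathComp-Analysis, over an arbitrary R : realType, with C := R[i].

   Conventions.
   - A manifold is a Hausdorff second countable space with a maximal atlas and
     a preferred chart [chart_at p] around each point p.  The tangent space at
     p is identified with R^d (its complexification with C^d) through the
     coordinate basis of [chart_at p].  A complex vector field is hence a map
     M -> 'rV[C]_d and a two-form a map M -> 'M[C]_d (row i, column j being the
     value on (d_i, d_j)); the components in any other chart are obtained with
     the Jacobian of the change of charts.
   - C^n is R^(n+n): z^k = x_k + i y_k, with x_k and y_k the coordinates
     lshift n k and rshift n k.
   - A function defined on an open set U is a total function of which only the
     values on U matter.  Formal power series in nu are families indexed by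
     nat. *)
From HB Require Import structures.
From mathcomp Require Import all_boot all_order all_algebra.
From mathcomp Require Import complex.
From mathcomp Require Import all_classical all_reals all_analysis.
Set Implicit Arguments.
Unset Strict Implicit.
Unset Printing Implicit Defensive.
Import Order.TTheory GRing.Theory Num.Theory numFieldNormedType.Exports.
Local Open Scope classical_set_scope.
Local Open Scope complex_scope.
Local Open Scope ring_scope.

Section Smooth.
Context {R : realType} {V W : normedModType R}.

(* For finite dimensional V this is the usual class C^r. *)
Fixpoint Cr_on (r : nat) (U : set V) (f : V -> W) : Prop :=
  if r is r'.+1 then
    (forall x, U x -> differentiable f x) /\
    (forall v, Cr_on r' U (fun x => 'D_v f x))
  else forall x, U x -> {for x, continuous f}.

Definition smooth_on (U : set V) (f : V -> W) : Prop := forall r, Cr_on r U f.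

End Smooth.

Section Manifolds.
Context {R : realType}.

Record chart (T : topologicalType) (d : nat) := Chart {
  cdom : set T;
  cmap : T -> 'rV[R]_d;
  cinv : 'rV[R]_d -> T;
  cdom_open : open cdom;
  cimg_open : open (cmap @` cdom);
  cmapK : forall p, cdom p -> cinv (cmap p) = p;
  cmap_continuous : forall p, cdom p -> {for p, continuous cmap};
  cinv_continuous : forall p, cdom p -> {for cmap p, continuous cinv} }.

Definition transition (T : topologicalType) (d : nat) (c c' : chart T d) :
  'rV[R]_d -> 'rV[R]_d := cmap c' \o cinv c.

(* [good] is the class of admissible changes of charts. *)
Definition compatible (T : topologicalType) (d : nat)
    (good : set 'rV[R]_d -> ('rV[R]_d -> 'rV[R]_d) -> Prop)
    (c c' : chart T d) : Prop :=
  good (cmap c @` (cdom c `&` cdom c')) (transition c c') /\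
  good (cmap c' @` (cdom c `&` cdom c')) (transition c' c).

Record manifold (d : nat)
    (good : set 'rV[R]_d -> ('rV[R]_d -> 'rV[R]_d) -> Prop) := Manifold {
  msort :> topologicalType;
  m_hausdorff : hausdorff_space msort;
  m_second_countable : @second_countable msort;
  atlas : set (chart msort d);
  chart_at : msort -> chart msort d;
  atlas_chart_at : forall p, atlas (chart_at p);
  mem_chart_at : forall p, cdom (chart_at p) p;
  atlas_compatible : forall c c', atlas c -> atlas c' -> compatible good c c';
  atlas_maximal : forall c,
    (forall c', atlas c' -> compatible good c c') -> atlas c }.

(* Matrix of multiplication by i on row vectors (x, y): (x, y) |-> (-y, x). *)
Definition Imx (n : nat) : 'M[R]_(n + n) := block_mx 0 1%:M (- 1%:M) 0.

Definition holomorphic_on (n : nat) (U : set 'rV[R]_(n + n))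
    (f : 'rV[R]_(n + n) -> 'rV[R]_(n + n)) : Prop :=
  smooth_on U f /\
  forall x v, U x -> 'D_(v *m Imx n) f x = 'D_v f x *m Imx n.

Definition smooth_curve (d : nat) good (N : @manifold d good) (f : R -> N) :
  Prop :=
  continuous f /\
  forall c, atlas c ->
    smooth_on (f @^-1` cdom c : set R^o) (cmap c \o f : R^o -> 'rV[R]_d).

Definition smooth_map (d1 d2 : nat) good1 good2
    (N1 : @manifold d1 good1) (N2 : @manifold d2 good2) (f : N1 -> N2) : Prop :=
  continuous f /\
  forall c1 c2, atlas c1 -> atlas c2 ->
    smooth_on (cmap c1 @` (cdom c1 `&` f @^-1` cdom c2))
      (cmap c2 \o f \o cinv c1).

Definition smooth_map2 (d1 d2 d3 : nat) good1 good2 good3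
    (N1 : @manifold d1 good1) (N2 : @manifold d2 good2)
    (N3 : @manifold d3 good3) (f : N1 -> N2 -> N3) : Prop :=
  continuous (fun x : N1 * N2 => f x.1 x.2) /\
  forall c1 c2 c3, atlas c1 -> atlas c2 -> atlas c3 ->
    smooth_on
      [set x : 'rV[R]_d1 * 'rV[R]_d2 |
        [/\ (cmap c1 @` cdom c1) x.1, (cmap c2 @` cdom c2) x.2
          & cdom c3 (f (cinv c1 x.1) (cinv c2 x.2))]]
      (fun x => cmap c3 (f (cinv c1 x.1) (cinv c2 x.2))).

Definition contractible (T : topologicalType) (U : set T) : Prop :=
  exists (p0 : T) (H : T * R -> T),
  [/\ U p0, {within U `*` `[0, 1]%classic, continuous H},
      forall p t, U p -> 0 <= t <= 1 -> U (H (p, t))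
    & forall p, U p -> H (p, 0) = p /\ H (p, 1) = p0].

End Manifolds.

Section LieGroups.
Context {R : realType}.

Record lieGroup (d : nat) := LieGroup {
  lg_manifold :> @manifold R d smooth_on;
  lg_one : lg_manifold;
  lg_mul : lg_manifold -> lg_manifold -> lg_manifold;
  lg_inv : lg_manifold -> lg_manifold;
  lg_mulA : associative lg_mul;
  lg_mul1 : left_id lg_one lg_mul;
  lg_mulV : left_inverse lg_one lg_inv lg_mul;
  lg_mul_smooth : smooth_map2 lg_mul;
  lg_inv_smooth : smooth_map lg_inv }.

(* [exp : g -> G] exhibits g as the Lie algebra of G (up to linear isomorphism,
   the tangent space at the identity): the curves exp (t xi) are the smooth
   one-parameter subgroups and taking their velocities at t = 0 is a linear
   isomorphism of g with the tangent space.  The bracket is then determined by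
   G, and plays no role in what follows. *)
Definition is_exponential (d : nat) (G : lieGroup d) (g : vectType R)
    (exp : g -> G) : Prop :=
  let velocity (xi : g) : 'rV[R]_d :=
    derive1 (fun t : R => cmap (chart_at (lg_one G)) (exp (t *: xi))) 0 in
  [/\ forall xi, smooth_curve (fun t => exp (t *: xi)),
      forall xi s t, exp ((s + t) *: xi) = lg_mul (exp (s *: xi)) (exp (t *: xi)),
      forall a xi eta, velocity (a *: xi + eta) = a *: velocity xi + velocity eta
    & bijective velocity].

Definition smooth_left_action (d : nat) (G : lieGroup d) (d' : nat) good
    (M : @manifold R d' good) (Phi : G -> M -> M) : Prop :=
  [/\ smooth_map2 Phi, forall p, Phi (lg_one G) p = p
    & forall h h' p, Phi (lg_mul h h') p = Phi h (Phi h' p)].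

(* X_xi (p) = d/dt Phi (exp (t xi), p) at t = 0. *)
Definition fundamental_field (d : nat) (G : lieGroup d) (d' : nat) good
    (M : @manifold R d' good) (Phi : G -> M -> M) (g : vectType R)
    (exp : g -> G) (xi : g) (p : M) : 'rV[R[i]]_d' :=
  map_mx (real_complex R)
    (derive1 (fun t : R => cmap (chart_at p) (Phi (exp (t *: xi)) p)) 0).

End LieGroups.

Section Calculus.
Context {R : realType} {n : nat} (M : @manifold R (n + n) (@holomorphic_on R n)).
Local Notation C := R[i].
Local Notation d := (n + n)%N.
Implicit Types (c : @chart R M d) (a b : M -> C) (U : set M) (p q : M).
Implicit Types (X Y : M -> 'rV[C]_d) (w : M -> 'M[C]_d) (al : M -> 'rV[C]_d).

Definition csmooth_on U a : Prop :=
  forall c, atlas c ->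
    smooth_on (cmap c @` (cdom c `&` U))
      ((fun x => complex.Re (a (cinv c x))) : 'rV[R]_d -> R^o) /\
    smooth_on (cmap c @` (cdom c `&` U))
      ((fun x => complex.Im (a (cinv c x))) : 'rV[R]_d -> R^o).

Definition csmooth a : Prop := csmooth_on setT a.

Definition csmooth_near p a : Prop :=
  exists2 U, open U /\ U p & csmooth_on U a.

(* Partial derivative in the j-th real coordinate of the chart c. *)
Definition pd c (j : 'I_d) a : M -> C := fun p =>
  ('D_(delta_mx 0 j) ((fun x => complex.Re (a (cinv c x))) : 'rV[R]_d -> R^o) (cmap c p))
  +i*
  ('D_(delta_mx 0 j) ((fun x => complex.Im (a (cinv c x))) : 'rV[R]_d -> R^o) (cmap c p)).

Definition Zder c (k : 'I_n) a : M -> C := fun p =>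
  2^-1 * (pd c (lshift n k) a p - 'i%C * pd c (rshift n k) a p).

Definition Zbarder c (k : 'I_n) a : M -> C := fun p =>
  2^-1 * (pd c (lshift n k) a p + 'i%C * pd c (rshift n k) a p).

Definition multider (m N : nat) (D : 'I_m -> (M -> C) -> M -> C)
    (K : {ffun 'I_m -> 'I_N}) a : M -> C :=
  foldr (fun j f => iter (K j) (D j) f) a (enum 'I_m).

Definition cjacobian c c' p : 'M[C]_d :=
  map_mx (real_complex R) ('J (transition c c') (cmap c p)).

Definition vf_in c X p : 'rV[C]_d := X p *m cjacobian (chart_at p) c p.

Definition form1_in c al p : 'rV[C]_d :=
  al p *m (cjacobian c (chart_at p) p)^T.

Definition form2_in c w p : 'M[C]_d :=
  cjacobian c (chart_at p) p *m w p *m (cjacobian c (chart_at p) p)^T.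

Definition vector_field X : Prop :=
  forall c j, atlas c -> csmooth_on (cdom c) (fun p => vf_in c X p 0 j).

Definition two_form w : Prop :=
  (forall p, (w p)^T = - w p /\ forall j, w p j j = 0) /\
  forall c i j, atlas c -> csmooth_on (cdom c) (fun p => form2_in c w p i j).

Definition closed1 al : Prop :=
  forall c p i j, atlas c -> cdom c p ->
    pd c i (fun q => form1_in c al q 0 j) p
    - pd c j (fun q => form1_in c al q 0 i) p = 0.

Definition closed2 w : Prop :=
  forall c p i j k, atlas c -> cdom c p ->
    pd c i (fun q => form2_in c w q j k) p
    + pd c j (fun q => form2_in c w q k i) p
    + pd c k (fun q => form2_in c w q i j) p = 0.

Definition dfun a : M -> 'rV[C]_d := fun p => \row_j pd (chart_at p) j a p.

Definition vf_app X a : M -> C := fun p =>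
  \sum_j X p 0 j * pd (chart_at p) j a p.

Definition vf_bracket X Y : M -> 'rV[C]_d := fun p =>
  \row_j (vf_app X (fun q => vf_in (chart_at p) Y q 0 j) p
          - vf_app Y (fun q => vf_in (chart_at p) X q 0 j) p).

Definition iprod X w : M -> 'rV[C]_d := fun p => X p *m w p.

(* Constant covectors dz^k, dzbar^k in a holomorphic chart, and the wedge
   product (al /\ be)(v, w) = al(v) be(w) - be(v) al(w). *)
Definition dz (k : 'I_n) : 'rV[C]_d :=
  delta_mx 0 (lshift n k) + 'i%C *: delta_mx 0 (rshift n k).

Definition dzbar (k : 'I_n) : 'rV[C]_d :=
  delta_mx 0 (lshift n k) - 'i%C *: delta_mx 0 (rshift n k).

Definition wedge (al be : 'rV[C]_d) : 'M[C]_d := al^T *m be - be^T *m al.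

(* dbar (f_k dz^k) and del (f_l dzbar^l), in the frame of the chart c. *)
Definition dbar_10 c (f : 'I_n -> M -> C) p : 'M[C]_d :=
  \sum_k \sum_l Zbarder c l (f k) p *: wedge (dzbar l) (dz k).

Definition del_01 c (f : 'I_n -> M -> C) p : 'M[C]_d :=
  \sum_l \sum_k Zder c k (f l) p *: wedge (dz k) (dzbar l).

End Calculus.

(* No positivity: pseudo-Kaehler manifolds are included. *)
Record kaehlerManifold (R : realType) (n : nat) := KaehlerManifold {
  k_manifold :> @manifold R (n + n) (@holomorphic_on R n);
  omega : k_manifold -> 'M[R]_(n + n);
  omegaC := fun p => map_mx (real_complex R) (omega p);
  omega_two_form : two_form omegaC;
  omega_closed : closed2 omegaC;
  omega_nondegenerate : forall p, omega p \in unitmx;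
  omega_I : forall p, Imx n *m omega p *m (Imx n)^T = omega p }.

Section StarProducts.
Context {R : realType} {n : nat} (M : kaehlerManifold R n).
Local Notation C := R[i].
Local Notation d := (n + n)%N.

(* The Hamiltonian vector field: i_(hamvf a) omega = da. *)
Definition hamvf (a : M -> C) : M -> 'rV[C]_d := fun p =>
  dfun a p *m invmx (omegaC p).

Definition poisson (a b : M -> C) : M -> C := fun p => - vf_app (hamvf a) b p.

Definition fsmooth_on (U : set M) (a : nat -> M -> C) : Prop :=
  forall r, csmooth_on U (a r).

Definition fsmooth (a : nat -> M -> C) : Prop := fsmooth_on setT a.

Definition fone : nat -> M -> C := fun r _ => (r == 0)%N%:R.

Definition fadd (a b : nat -> M -> C) : nat -> M -> C :=
  fun r p => a r p + b r p.

Definition fsub (a b : nat -> M -> C) : nat -> M -> C :=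
  fun r p => a r p - b r p.

Definition fmul (a b : nat -> M -> C) : nat -> M -> C := fun r p =>
  \sum_(i < r.+1) a i p * b (r - i)%N p.

(* Multiplication by nu. *)
Definition fnu (a : nat -> M -> C) : nat -> M -> C :=
  fun r p => if r is r'.+1 then a r' p else 0.

Definition fmap (D : (M -> C) -> M -> C) (a : nat -> M -> C) : nat -> M -> C :=
  fun r => D (a r).

Definition feq_on (U : set M) (a b : nat -> M -> C) : Prop :=
  forall r p, U p -> a r p = b r p.

(* A local operator: in a neighbourhood of each point of each chart it has an
   expression with smooth coefficients, valid at q for all arguments smooth
   near q.  In particular it acts on functions defined on open subsets. *)
Definition bidifferential_in (m : nat)
    (D D' : @chart R M d -> 'I_m -> (M -> C) -> M -> C)
    (B : (M -> C) -> (M -> C) -> M -> C) : Prop :=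
  forall c p, atlas c -> cdom c p ->
  exists (U : set M) (N : nat)
         (coef : {ffun 'I_m -> 'I_N} -> {ffun 'I_m -> 'I_N} -> M -> C),
  [/\ open U, U p, U `<=` cdom c, forall K L, csmooth_on U (coef K L)
    & forall q a b, U q -> csmooth_near q a -> csmooth_near q b ->
        B a b q = \sum_K \sum_L
          coef K L q * multider (D c) K a q * multider (D' c) L b q].

Definition bidifferential (B : (M -> C) -> (M -> C) -> M -> C) : Prop :=
  bidifferential_in (@pd _ _ M) (@pd _ _ M) B.

Definition wick_bidifferential (B : (M -> C) -> (M -> C) -> M -> C) : Prop :=
  bidifferential_in (@Zder _ _ M) (@Zbarder _ _ M) B.

Implicit Type star : nat -> (M -> C) -> (M -> C) -> M -> C.

(* A star product is given by its coefficients C_r = [star r]. *)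
Definition fstar star (a b : nat -> M -> C) : nat -> M -> C := fun r p =>
  \sum_(i < r.+1) \sum_(j < (r - i).+1) star (r - i - j)%N (a i) (b j) p.

Definition ad_star star (a b : nat -> M -> C) : nat -> M -> C :=
  fsub (fstar star a b) (fstar star b a).

Definition star_product star : Prop :=
  [/\ forall r, bidifferential (star r),
      forall a b, csmooth a -> csmooth b -> forall p,
        star 0%N a b p = a p * b p,
      forall a b, csmooth a -> csmooth b -> forall p,
        star 1%N a b p - star 1%N b a p = poisson a b p,
      forall a, fsmooth a ->
        feq_on setT (fstar star fone a) a /\ feq_on setT (fstar star a fone) a
    & forall a b c, fsmooth a -> fsmooth b -> fsmooth c ->
        feq_on setT (fstar star (fstar star a b) c)
                    (fstar star a (fstar star b c))].

Definition wick_type star : Prop :=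
  forall r, (0 < r)%N -> wick_bidifferential (star r).

Definition is_karabegov_form star (K : nat -> M -> 'M[C]_d) : Prop :=
  (forall r, two_form (K r)) /\
  forall z : @chart R M d, atlas z -> @contractible R M (cdom z) ->
  exists u v : 'I_n -> nat -> M -> C,
  [/\ forall k, fsmooth_on (cdom z) (u k) /\ fsmooth_on (cdom z) (v k),
      forall k a, fsmooth_on (cdom z) a ->
        feq_on (cdom z) (fstar star a (u k))
          (fadd (fmul a (u k)) (fnu (fmap (Zder z k) a))),
      forall l a, fsmooth_on (cdom z) a ->
        feq_on (cdom z) (fstar star (v l) a)
          (fadd (fmul (v l) a) (fnu (fmap (Zbarder z l) a))),
      forall r p, cdom z p ->
        form2_in z (K r) p = dbar_10 z (fun k q => - u k r q) p
    & forall r p, cdom z p ->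
        form2_in z (K r) p = del_01 z (fun l => v l r) p].

(* rho = - X, the action on formal functions. *)
Definition rho_of (X : M -> 'rV[C]_d) : (nat -> M -> C) -> nat -> M -> C :=
  fmap (fun a p => - vf_app X a p).

Definition derivation_of star (D : (nat -> M -> C) -> nat -> M -> C) : Prop :=
  forall a b, fsmooth a -> fsmooth b ->
    feq_on setT (D (fstar star a b))
      (fadd (fstar star (D a) b) (fstar star a (D b))).

Definition fpullback (phi : M -> M) (a : nat -> M -> C) : nat -> M -> C :=
  fun r p => a r (phi p).

Definition is_lie_bracket (k : fieldType) (g : vectType k) (br : g -> g -> g) :
  Prop :=
  [/\ forall x, linear (br x), forall y, linear (br^~ y), forall x, br x x = 0
    & forall x y t, br x (br y t) + br y (br t x) + br t (br x y) = 0].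

Definition linear_along (k : fieldType) (iota : k -> C) (g : vectType k)
    (V : lmodType C) (f : g -> V) : Prop :=
  forall s x y, f (s *: x + y) = iota s *: f x + f y.

(* Lie algebra action: an anti-homomorphism into the vector fields. *)
Definition lie_algebra_action (k : fieldType) (iota : k -> C) (g : vectType k)
    (br : g -> g -> g) (X : g -> M -> 'rV[C]_d) : Prop :=
  [/\ is_lie_bracket br, forall xi, vector_field (X xi),
      forall p, linear_along iota (X^~ p)
    & forall xi eta p, X (br xi eta) p = - vf_bracket (X xi) (X eta) p].

Definition lie_algebra_invariant (k : fieldType) (g : vectType k) star
    (X : g -> M -> 'rV[C]_d) : Prop :=
  forall xi, derivation_of star (rho_of (X xi)).

Definition lie_group_invariant (d' : nat) (G : @lieGroup R d') star
    (Phi : G -> M -> M) : Prop :=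
  forall (h : G) a b, fsmooth a -> fsmooth b ->
    feq_on setT (fpullback (Phi (lg_inv h)) (fstar star a b))
      (fstar star (fpullback (Phi (lg_inv h)) a)
                  (fpullback (Phi (lg_inv h)) b)).

(* [invariant_action star iota X]: the vector fields X come from an action
   leaving star invariant, of a real Lie algebra, of a complex Lie algebra or
   of a Lie group; iota embeds the ground field of g into C. *)
Inductive invariant_action star :
  forall (k : fieldType) (iota : k -> C) (g : vectType k),
    (g -> M -> 'rV[C]_d) -> Prop :=
| RealLieAlgebra (g : vectType R) (br : g -> g -> g) (X : g -> M -> 'rV[C]_d) :
    lie_algebra_action (real_complex R) br X -> lie_algebra_invariant star X ->
    invariant_action star (real_complex R) X
| ComplexLieAlgebra (g : vectType C) (br : g -> g -> g)
    (X : g -> M -> 'rV[C]_d) :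
    lie_algebra_action id br X -> lie_algebra_invariant star X ->
    invariant_action star id X
| LieGroupAction (d' : nat) (G : @lieGroup R d') (g : vectType R)
    (exp : g -> G) (Phi : G -> M -> M) :
    is_exponential exp -> smooth_left_action Phi ->
    lie_group_invariant star Phi ->
    invariant_action star (real_complex R) (fundamental_field Phi exp).

(* C^1(g, C^oo(M))[[nu]] and C^1(g, C)[[nu]]. *)
Definition cochain1_fun (k : fieldType) (iota : k -> C) (g : vectType k)
    (J : g -> nat -> M -> C) : Prop :=
  (forall xi, fsmooth (J xi)) /\
  forall r p, linear_along iota (fun xi => J xi r p : C^o).

Definition cochain1_scalar (k : fieldType) (iota : k -> C) (g : vectType k)
    (s : g -> nat -> C) : Prop :=
  forall r, linear_along iota (fun xi => s xi r : C^o).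

(* rho(xi) = (1/nu) ad_star(J(xi)), multiplied by nu. *)
Definition quantum_hamiltonian (k : fieldType) (iota : k -> C) (g : vectType k)
    star (X : g -> M -> 'rV[C]_d) (J : g -> nat -> M -> C) : Prop :=
  cochain1_fun iota J /\
  forall xi a, fsmooth a ->
    feq_on setT (fnu (rho_of (X xi) a)) (ad_star star (J xi) a).

(* The de Rham class of each coefficient is defined and zero. *)
Definition deRham_class_vanishes (al : nat -> M -> 'rV[C]_d) : Prop :=
  (forall r, closed1 (al r)) /\
  exists2 f, fsmooth f & forall r p, dfun (f r) p = al r p.

End StarProducts.

(* Main.v *)
(* For a product of Wick type, a * b = a b whenever b is holomorphic.  Conversely
   z^k * b = z^k b for all k forces b to be holomorphic: order by order in nu
   the equation reads {z^k, b_r} = 0, and omega is nondegenerate of type (1,1).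
   Applied to b = D z^k, with D an invariant derivation, or b = Phi_h^* z^k, this
   shows that the fields X_xi are holomorphic.  With X^k the components of X_xi
   on the Z_k, the local series T = sum_k X^k * u_k satisfies
   a * T = a T + nu sum_k X^k Z_k a, hence so does J if and only if J - T is
   holomorphic, that is, if and only if the (0,1) part of dJ is that of
   i_X K.  The opposite product is of Wick type for the conjugate structure, and
   the same argument with the v_l gives the (1,0) part; the two together say
   that J is a quantum Hamiltonian if and only if dJ = i_X K. *)

Require Import Defs.
From HB Require Import structures.
From mathcomp Require Import all_boot all_order all_algebra.
From mathcomp Require Import complex.
From mathcomp Require Import all_classical all_reals all_analysis.
From mathcomp Require Import ring.
Set Implicit Arguments.
Unset Strict Implicit.
Unset Printing Implicit Defensive.
Import Order.TTheory GRing.Theory Num.Theory numFieldNormedType.Exports.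
Local Open Scope classical_set_scope.
Local Open Scope complex_scope.
Local Open Scope ring_scope.

(** * Functions of class C^r and symmetry of second derivatives *)

Section Calculus.
Context {R : realType}.
Implicit Types V W : normedModType R.

(** The axioms of a star product, the derivation property and the group invariance are stated for
    functions smooth on all of M, whereas z^k, u_k and v_l live on a chart. The bridge is that the
    C_r are local: near a given point a local function may be replaced by a cutoff of it, so that
    each identity passes to open sets. The components x_k of X must be holomorphic in order that a *
    x_k = a x_k: then associativity gives a * (x_k * u_k) = (a x_k) * u_k, and the equation defining
    u_k applies to the series a x_k. For a group, the product only tells that each Phi_h is
    holomorphic. Holomorphy of X_xi follows by differentiating the Cauchy-Riemann equations of Phi_h
    with respect to h at the identity, which exchanges a derivative along G with one along M. This
    is one of the three uses of the symmetry of second derivatives; the others are the commutation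
    of the Z_k with the Zbar_l and the closedness of exact forms. *)

Lemma near_eq_differentiable V W (f g : V -> W) x :
  (\near x, f x = g x) -> differentiable f x -> differentiable g x.
Proof.
move=> fg df.
have fgx : f x = g x by apply: (nbhs_singleton fg).
have h0 : (g - f) \o shift x = cst ((g - f) x) + \0 +o_ 0 id.
  apply/eqaddoP => e e0 /=; near=> y.
  have -> : ((g - f) \o shift x - (cst ((g - f) x) + \0)) y
     = g (y + x) - f (y + x) - (g x - f x + 0) by [].
  have -> : f (y + x) = g (y + x).
    near: y; have /nbhs0P := fg; apply: filterS => y /=; by rewrite addrC.
  by rewrite fgx !subrr addr0 subrr normr0 mulr_ge0 // ltW.
have dgf : differentiable (g - f) x.
  have E : 'd (g - f) x = (\0 : V -> W) :> (V -> W).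
    apply: (@diff_unique _ _ _ _ (\0 : {linear V -> W})) => //.
    exact: cst_continuous.
  apply/diff_locallyP; rewrite E; split => //; exact: cst_continuous.
have -> : g = (g - f) + f by apply/funext => y /=; rewrite !fctE subrK.
exact: differentiableD.
Unshelve. all: by end_near. Qed.

Lemma near_eq_open V W (f g : V -> W) (U : set V) x :
  open U -> U x -> (forall y, U y -> f y = g y) -> \near x, f x = g x.
Proof. by move=> oU Ux fg; apply: filterS (open_nbhs_nbhs (conj oU Ux)). Qed.

Lemma Cr_onW r V W (U : set V) (f : V -> W) : Cr_on r.+1 U f -> Cr_on r U f.
Proof.
elim: r f => [|r IH] f [df Df]; first by move=> x Ux; exact: differentiable_continuous (df x Ux).
by split => // v; exact: IH.
Qed.

Lemma Cr_on_sub r V W (U U' : set V) (f : V -> W) :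
  U' `<=` U -> Cr_on r U f -> Cr_on r U' f.
Proof.
move=> sU; elim: r f => [|r IH] f /=; first by move=> cf x /sU/cf.
by move=> [df Df]; split=> [x /sU/df//|v]; exact: IH.
Qed.

(** [Cr_on] imposes at each point of U a condition on the germ of f there, so the sets U' need not
    be open. *)
Lemma Cr_on_local r V W (U : set V) (f : V -> W) :
  (forall x, U x -> exists U', U' x /\ Cr_on r U' f) -> Cr_on r U f.
Proof.
elim: r f => [|r IH] f h /=.
  by move=> x /h [U' [U'x Cf]]; exact: Cf.
split=> [x /h [U' [U'x [df _]]]|v]; first exact: df.
by apply: IH => x /h [U' [U'x [_ Df]]]; exists U'; split => //; exact: Df.
Qed.

Lemma Cr_on_ext r V W (U : set V) (f g : V -> W) : open U ->
  (forall x, U x -> f x = g x) -> Cr_on r U f -> Cr_on r U g.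
Proof.
move=> oU; elim: r f g => [|r IH] f g fg /=.
  move=> cf x Ux; have fgx := near_eq_open oU Ux fg.
  have cfx : f @ x --> f x := cf x Ux.
  suff : g @ x --> g x by [].
  by rewrite -fg //; apply: cvg_trans cfx; exact: near_eq_cvg.
move=> [df Df]; split => [x Ux|v].
  exact: (near_eq_differentiable (near_eq_open oU Ux fg)) (df x Ux).
apply: IH (Df v) => x Ux; exact/near_eq_derive/(near_eq_open oU Ux).
Qed.

Lemma Cr_on_cst r V W (U : set V) (w : W) : Cr_on r U (cst w).
Proof.
elim: r w => [|r IH] w /=; first by move=> x _; exact: cst_continuous.
split=> [x _|v]; first exact: differentiable_cst.
have -> : (fun x => 'D_v (cst w) x) = cst 0 by apply/funext => x; rewrite derive_cst.
exact: IH.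
Qed.

Lemma Cr_onD r V W (U : set V) (f g : V -> W) : open U ->
  Cr_on r U f -> Cr_on r U g -> Cr_on r U (fun x => f x + g x).
Proof.
move=> oU; elim: r f g => [|r IH] f g /=.
  by move=> cf cg x Ux; apply: cvgD; [exact: cf|exact: cg].
move=> [df Df] [dg Dg]; split => [x Ux|v].
  by apply: differentiableD; [exact: df|exact: dg].
apply: Cr_on_ext (IH _ _ (Df v) (Dg v)) => // x Ux.
by rewrite -deriveD //; apply/diff_derivable; [exact: df|exact: dg].
Qed.

Lemma Cr_on_sum r V W (U : set V) I (s : seq I) (P : pred I) (f : I -> V -> W) : open U ->
  (forall i, P i -> Cr_on r U (f i)) -> Cr_on r U (fun x => \sum_(i <- s | P i) f i x).
Proof.
move=> oU h; elim: s => [|i s IH].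
  apply: Cr_on_ext (Cr_on_cst r U 0) => // x _; by rewrite big_nil.
case Pi : (P i).
  by apply: Cr_on_ext (Cr_onD oU (h i Pi) IH) => // x _; rewrite big_cons Pi.
by apply: Cr_on_ext IH => // x _; rewrite big_cons Pi.
Qed.

Lemma Cr_onM r V (U : set V) (f g : V -> R^o) : open U ->
  Cr_on r U f -> Cr_on r U g -> Cr_on r U (fun x => f x * g x : R^o).
Proof.
move=> oU; elim: r f g => [|r IH] f g.
  by move=> cf cg x Ux; apply: cvgM; [exact: cf|exact: cg].
move=> Cf Cg; have [[df Df] [dg Dg]] := (Cf, Cg); split => [x Ux|v].
  by apply: differentiableM; [exact: df|exact: dg].
have Cf' := Cr_onW Cf; have Cg' := Cr_onW Cg.
apply: Cr_on_ext (Cr_onD oU (IH _ _ Cf' (Dg v)) (IH _ _ Cg' (Df v))) => // x Ux.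
by rewrite -deriveM //; apply/diff_derivable; [exact: df|exact: dg].
Qed.

Lemma Cr_onN r V (U : set V) (f : V -> R^o) : open U ->
  Cr_on r U f -> Cr_on r U (fun x => - f x : R^o).
Proof.
move=> oU Cf; apply: Cr_on_ext (Cr_onM oU (Cr_on_cst r U (-1 : R^o)) Cf) => // x _.
by rewrite /cst mulN1r.
Qed.

Lemma derive_coord V m (f : V -> 'rV[R]_m) x v j : differentiable f x ->
  'D_v (fun y => f y 0 j : R^o) x = ('D_v f x) 0 j.
Proof. by move=> df; rewrite derive_mx ?mxE //; exact: diff_derivable. Qed.

Lemma rVE m (v : 'rV[R]_m) : v = \sum_j v 0 j *: (delta_mx 0 j : 'rV[R]_m).
Proof. exact: row_sum_delta. Qed.

Lemma Cr_on_coord r V m (U : set V) (f : V -> 'rV[R]_m) j : open U ->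
  Cr_on r U f -> Cr_on r U (fun x => f x 0 j : R^o).
Proof.
move=> oU; elim: r f => [|r IH] f.
  move=> cf x Ux; apply: (@continuous_comp _ _ _ f (fun M : 'rV[R]_m => M 0 j)).
    exact: cf.
  exact: coord_continuous.
move=> [df Df]; split => [x Ux|v].
  apply: (@differentiable_comp _ _ _ _ f (fun M : 'rV[R]_m => M 0 j : R^o)).
    exact: df.
  exact: differentiable_coord.
by apply: Cr_on_ext (IH _ (Df v)) => // x Ux; rewrite derive_coord //; exact: df.
Qed.

Lemma derive_compE V m W (f : V -> 'rV[R]_m) (g : 'rV[R]_m -> W) x v :
  differentiable f x -> differentiable g (f x) ->
  'D_v (g \o f) x = \sum_j ('D_v f x) 0 j *: 'D_(delta_mx 0 j) g (f x).
Proof.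
move=> df dg; rewrite deriveE; last exact: differentiable_comp.
rewrite diff_comp //= (_ : 'd f x v = 'D_v f x); last by rewrite deriveE.
rewrite [in LHS](rVE ('D_v f x)) linear_sum.
by apply: eq_bigr => j _; rewrite linearZ /= -deriveE.
Qed.

Lemma Cr_on_comp r V m (U : set V) (U' : set 'rV[R]_m) (f : V -> 'rV[R]_m)
    (g : 'rV[R]_m -> R^o) : open U -> (forall x, U x -> U' (f x)) ->
  Cr_on r U f -> Cr_on r U' g -> Cr_on r U (g \o f).
Proof.
move=> oU fU; elim: r f g fU => [|r IH] f g fU.
  by move=> cf cg x Ux; apply: continuous_comp; [exact: cf|exact/cg/fU].
move=> Cf Cg; have [[df Df] [dg Dg]] := (Cf, Cg); split => [x Ux|v].
  by apply: differentiable_comp; [exact: df|exact/dg/fU].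
have C : Cr_on r U (fun x => \sum_j ('D_v f x) 0 j * 'D_(delta_mx 0 j) g (f x) : R^o).
  apply: Cr_on_sum => // j _; apply: Cr_onM => //.
    exact: (Cr_on_coord j oU (Df v)).
  exact: (IH f _ fU (Cr_onW Cf) (Dg _)).
by apply: Cr_on_ext C => // x Ux; rewrite derive_compE //; [exact: df|exact/dg/fU].
Qed.

Lemma Cr_on_id r V (U : set V) : Cr_on r U (id : V -> V).
Proof.
case: r => [|r]; first by move=> x _; exact: cvg_id.
split=> [x _|v]; first exact: (@ex_diff _ _ _ _ _ _ _ (is_diff_id x)).
have -> : (fun x => 'D_v (id : V -> V) x) = cst v by apply/funext => x; rewrite derive_id.
exact: Cr_on_cst.
Qed.

Lemma derive_affine V V' W (L : V' -> V) (c : V) (f : V -> W) x v :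
  linear L -> 'D_v (fun y => f (L y + c)) x = 'D_(L v) f (L x + c).
Proof.
move=> linL; rewrite /derive; set d := (fun _ : R => _); set d' := (fun _ : R => _).
suff -> : d = d' by []; apply/funext => h; rewrite /d /d' /=.
by rewrite linL addrA.
Qed.

Lemma differentiable_affine V V' (L : V' -> V) (c : V) x :
  linear L -> continuous L -> differentiable (fun y => L y + c) x.
Proof.
move=> linL cL; pose LM := GRing.isLinear.Build _ _ _ _ _ linL.
pose L' : {linear V' -> V} := HB.pack L LM.
exact: (differentiableD (@linear_differentiable _ _ _ L' x cL) (differentiable_cst c x)).
Qed.

(** With L the inclusion of a factor into a product and c in the other factor, this freezes one
    variable of a function of two variables. *)
Lemma Cr_on_affine r V V' W (L : V' -> V) (c : V) (U : set V) (f : V -> W) :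
  linear L -> continuous L -> Cr_on r U f ->
  Cr_on r [set x | U (L x + c)] (fun x => f (L x + c)).
Proof.
move=> linL cL; elim: r f => [|r IH] f /=.
  move=> cf x /= Ux; apply: (@continuous_comp _ _ _ (fun y => L y + c) f).
    exact/differentiable_continuous/differentiable_affine.
  exact: cf.
move=> [df Df]; split => [x /= Ux|v].
  apply: (@differentiable_comp _ _ _ _ (fun y => L y + c) f).
    exact/differentiable_affine.
  exact: df.
have -> : (fun x => 'D_v (fun x => f (L x + c)) x) = (fun x => 'D_(L v) f (L x + c)).
  by apply/funext => x; exact: derive_affine.
exact: (IH (fun x => 'D_(L v) f x) (Df _)).
Qed.

Lemma is_derive_line V (f : V -> R^o) x v t : differentiable f (t *: v + x) ->
  is_derive t 1 (fun s : R => f (s *: v + x)) ('D_v f (t *: v + x)).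
Proof.
move=> df.
have dg : differentiable (fun s : R^o => s *: v + x) t.
  by exact: (differentiableD (@differentiableZl _ _ _ (id : R^o -> R^o) v t _) (differentiable_cst x t)).
have dfg : differentiable (fun s : R^o => f (s *: v + x)) t.
  by apply: (@differentiable_comp _ _ _ _ (fun s : R^o => s *: v + x) f).
apply: DeriveDef; first exact: diff_derivable.
have linv : linear ( *:%R^~ v : R^o -> V) by move=> a b c; rewrite scalerDl scalerA.
by have := derive_affine x f t 1 linv; rewrite scale1r.
Qed.

Lemma nbhs_plane V (U : set V) (x : V) : nbhs x U -> forall v w : V,
  exists2 e : R, 0 < e & forall s t : R, `|s| < e -> `|t| < e -> U (s *: v + (t *: w + x)).
Proof.
move=> /nbhs_ballP [r r0 rU] v w.
have N0 : 0 < `|v| + `|w| + 1 :> R by rewrite ltr_wpDl // addr_ge0.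
have [e [e0 rE]] : exists e : R, 0 < e /\ r = e * (`|v| + `|w| + 1).
  by exists (r / (`|v| + `|w| + 1)); rewrite divr_gt0 // divfK // gt_eqF.
exists e => // s t hs ht; apply: rU; rewrite -ball_normE /ball_ /=.
have -> : x - (s *: v + (t *: w + x)) = - (s *: v + t *: w).
  by rewrite addrA opprD addrCA subrr addr0.
rewrite normrN; apply: (le_lt_trans (ler_normD _ _)); rewrite !normrZ rE !mulrDr mulr1.
by apply: ltr_pwDr => //; apply: lerD; rewrite ler_wpM2r // ltW.
Qed.

Lemma MVT0 (g dg : R -> R) (s : R) : 0 < s ->
  (forall r, 0 <= r <= s -> is_derive r 1 (g : R -> R^o) (dg r)) ->
  exists2 c, 0 < c < s & g s - g 0 = dg c * s.
Proof.
move=> s0 dgP; have [| |c + E] := @MVT R g dg 0 s s0.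
- by move=> r; rewrite in_itv /= => /andP[r0 rs]; apply: dgP; rewrite !ltW.
- apply: derivable_within_continuous => r; rewrite in_itv /= => /dgP D.
  exact: ex_derive.
- by rewrite in_itv /= => cs; exists c => //; rewrite E subr0.
Qed.

(** Mean value theorem twice: along u for r -> f (r u + s v + x) - f (r u + x), then along v for the
    derivative in the direction u at the intermediate point a. *)
Lemma second_difference V (f : V -> R^o) (U : set V) u v x (s : R) :
  0 < s -> Cr_on 2 U f ->
  (forall a b : R, 0 <= a <= s -> 0 <= b <= s -> U (a *: u + (b *: v + x))) ->
  exists a b : R, [/\ 0 < a < s, 0 < b < s &
    f (s *: u + (s *: v + x)) - f (s *: u + x) - (f (s *: v + x) - f x)
    = 'D_v (fun y => 'D_u f y : R^o) (b *: v + (a *: u + x)) * s * s].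
Proof.
move=> s0 [df Df] inU.
have xC p q : p *: u + (q *: v + x) = q *: v + (p *: u + x) by rewrite addrCA.
have s00 : 0 <= (0 : R) <= s by apply/andP; split; [exact: lexx|exact: ltW].
have sss : 0 <= s <= s by apply/andP; split; [exact: ltW|exact: lexx].
have [|a a0 E] := @MVT0 (fun r => f (r *: u + (s *: v + x)) - f (r *: u + x))
   (fun r => 'D_u f (r *: u + (s *: v + x)) - 'D_u f (r *: u + x)) s s0.
  move=> r rs; apply: is_deriveB; apply: is_derive_line; apply: df.
    exact: inU.
  by have := inU r 0 rs s00; rewrite scale0r add0r.
have a0' : 0 <= a <= s by case/andP: a0 => a0 a1; rewrite !ltW.
have [|b b0 E'] := @MVT0 (fun r => 'D_u f (r *: v + (a *: u + x)))
   (fun r => 'D_v (fun y => 'D_u f y : R^o) (r *: v + (a *: u + x))) s s0.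
  move=> r rs; apply: is_derive_line; have [+ _] := Df u; apply.
  by rewrite addrCA; exact: inU.
exists a, b; split => //; move: E; rewrite !scale0r !add0r opprB => ->.
rewrite -E' scale0r add0r (xC a s).
by [].
Qed.

(** The second difference over the parallelogram spanned by s u and s v is symmetric in u and v.
    Divided by s^2 it is the value of one iterated derivative at some point of the parallelogram,
    and of the other at another point. Both are continuous at x, and s is so small that each varies
    by less than e / 2. *)
Lemma derive_comm V (f : V -> R^o) (U : set V) u v x : open U -> U x ->
  Cr_on 2 U f ->
  'D_v (fun y => 'D_u f y : R^o) x = 'D_u (fun y => 'D_v f y : R^o) x.
Proof.
move=> oU Ux Cf; have [df Df] := Cf.
have xC p q : p *: u + (q *: v + x) = q *: v + (p *: u + x) by rewrite addrCA.
pose A : V -> R^o := fun y => 'D_v (fun y => 'D_u f y : R^o) y.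
pose B : V -> R^o := fun y => 'D_u (fun y => 'D_v f y : R^o) y.
have cA : {for x, continuous A} by have [_ /(_ v)] := Df u; apply.
have cB : {for x, continuous B} by have [_ /(_ u)] := Df v; apply.
have AE y : A y = 'D_v (fun y => 'D_u f y : R^o) y := erefl.
have BE y : B y = 'D_u (fun y => 'D_v f y : R^o) y := erefl.
rewrite -AE -BE; clearbody A B.
apply/eqP; rewrite -subr_eq0 -normr_le0; apply/ler_addgt0Pr => e e0; rewrite add0r.
have e2 : 0 < e / 2 by rewrite divr_gt0.
have nA : \forall y \near x, `|A x - A y| < e / 2 by have /cvgrPdist_lt := (cA : A @ x --> A x); apply.
have nB : \forall y \near x, `|B x - B y| < e / 2 by have /cvgrPdist_lt := (cB : B @ x --> B x); apply.
have nU : nbhs x U by exact: open_nbhs_nbhs.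
have [r r0 rP] := nbhs_plane (filterI nU (filterI nA nB)) u v.
pose s := r / 2; have s0 : 0 < s by rewrite divr_gt0.
have sr a : 0 <= a <= s -> `|a| < r.
  by case/andP => a0 a1; rewrite ger0_norm // (le_lt_trans a1) // /s ltr_pdivrMr // ltr_pMr // ltr1n.
have P a b : 0 <= a <= s -> 0 <= b <= s -> 
    [/\ U (a *: u + (b *: v + x)), `|A x - A (a *: u + (b *: v + x))| < e / 2 &
        `|B x - B (a *: u + (b *: v + x))| < e / 2].
  by move=> /sr ha /sr hb; have [hU [hA hB]] := rP a b ha hb; split; [exact: hU|exact: hA|exact: hB].
have W a : 0 < a < s -> 0 <= a <= s by case/andP => ? ?; rewrite !ltW.
have [|a [b [/W a0 /W b0 E]]] := @second_difference V f U u v x s s0 Cf.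
  by move=> a b ha hb; have [] := P a b ha hb.
have [|b' [a' [/W b'0 /W a'0 E']]] := @second_difference V f U v u x s s0 Cf.
  by move=> b' a' ha hb; rewrite addrCA; have [] := P a' b' hb ha.
have [_ hA _] := P a b a0 b0; have [_ _ hB] := P a' b' a'0 b'0.
(* Both sides times s^2 are the same second difference. *)
have EE : A (a *: u + (b *: v + x)) = B (a' *: u + (b' *: v + x)).
  apply: (@mulIf _ s); first by rewrite gt_eqF.
  apply: (@mulIf _ s); first by rewrite gt_eqF.
  rewrite AE BE (xC a b); refine (etrans (esym E) (etrans _ E')).
  rewrite (xC s s) -!addrA; congr (_ + _).
  by rewrite !opprB addrCA [RHS]addrCA; congr (_ + _); rewrite addrC.
have -> : A x - B x = (A x - A (a *: u + (b *: v + x))) - (B x - B (a' *: u + (b' *: v + x))).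
  by rewrite -EE opprB addrA subrK.
by rewrite (le_trans (ler_normB _ _)) // (splitr e) lerD // ltW.
Qed.
End Calculus.

(** * Cutoff functions *)

Section Bump.
Context {R : realType}.

Lemma cst_of_derive_eq0 m (f : 'rV[R]_m -> R^o) (x : 'rV[R]_m) e y :
  0 < e -> ball x e y -> (forall z, ball x e z -> differentiable f z) ->
  (forall z j, ball x e z -> 'D_(delta_mx 0 j) f z = 0) -> f y = f x.
Proof.
move=> e0 xy df D0.
have inb (t : R) : 0 <= t <= 1 -> ball x e (t *: (y - x) + x).
  move=> /andP[t0 t1]; move: xy; rewrite -ball_normE /ball_ /=.
  rewrite opprD addrCA subrr addr0 normrN normrZ -normrN opprB => h.
  by apply: le_lt_trans h; rewrite ger0_norm // ler_piMl.
have [|c /andP[c0 c1]] := @MVT0 R (fun t => f (t *: (y - x) + x))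
    (fun t => 'D_(y - x) f (t *: (y - x) + x)) 1 ltr01.
  by move=> r rs; apply: is_derive_line; apply: df; exact: inb.
rewrite scale1r scale0r add0r subrK mulr1 => E.
apply/eqP; rewrite -subr_eq0 E; apply/eqP.
have cb : ball x e (c *: (y - x) + x) by apply: inb; rewrite !ltW.
rewrite deriveE; last exact: df.
rewrite (rVE (y - x)) linear_sum big1 // => j _; rewrite -rVE.
by rewrite linearZ /= -deriveE ?D0 ?scaler0 //; exact: df.
Qed.

(* Derivatives of flat k are combinations of flat k.+1 and flat k.+2. *)
Definition flat (k : nat) (x : R) : R := if 0 < x then x^-1 ^+ k * expR (- x^-1) else 0.

Lemma flat_ge0 k x : 0 <= flat k x.
Proof.
rewrite /flat; case: ifP => // x0.
by rewrite mulr_ge0 ?expR_ge0 ?exprn_ge0 ?invr_ge0 ?ltW.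
Qed.

Lemma flat_gt0 x : 0 < x -> 0 < flat 0 x.
Proof. by move=> x0; rewrite /flat x0 mul1r expR_gt0. Qed.

Lemma flat_le0 k x : x <= 0 -> flat k x = 0.
Proof. by move=> x0; rewrite /flat ltNge x0. Qed.

(** The term of degree k + 1 of the exponential series at 1/x bounds 1/x^(k+1) by (k+1)! exp (1/x),
    hence the factorial; the spare factor x makes [flat k] small near 0. *)
Lemma flat_bound k (x : R) : flat k x <= k.+1`!%:R * `|x|.
Proof.
have [x0|x0] := leP x 0; first by rewrite flat_le0 // mulr_ge0.
rewrite gtr0_norm // /flat x0 expRN.
have f0 : 0 < (k.+1`!%:R : R) by rewrite ltr0n fact_gt0.
have h : x^-1 ^+ k.+1 <= k.+1`!%:R * expR x^-1.
  rewrite -ler_pdivrMl // mulrC; apply: le_trans (expR_ge1Dxn k _).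
    by rewrite lerDr.
  by rewrite invr_ge0 ltW.
rewrite ler_pdivrMr ?expR_gt0 // mulrAC.
have -> : x^-1 ^+ k = x^-1 ^+ k.+1 * x by rewrite exprSr mulfVK // gt_eqF.
by rewrite ler_wpM2r // ltW.
Qed.

Lemma flatS k x : 0 < x -> flat k x = x * flat k.+1 x.
Proof. by move=> x0; rewrite /flat x0 exprS !mulrA mulfV ?mul1r // gt_eqF. Qed.

Lemma is_derive_flat k (x : R) :
  is_derive x (1 : R) (flat k) (flat k.+2 x - k%:R * flat k.+1 x).
Proof.
have [x0|x0|x0] := ltgtP x 0.
- rewrite !flat_le0 ?ltW // mulr0 subr0.
  apply: (@near_eq_is_derive R R^o R^o (cst 0)).
  by near=> y; rewrite flat_le0 //; apply: ltW; near: y; exact: lt_nbhsl.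
- have x0' : x != 0 by rewrite gt_eqF.
  have dV : is_derive x (1 : R) (fun y : R => y^-1) (- x^-1 ^+ 2).
    apply: DeriveDef; first exact: (derivableV x0' (@derivable_id R R^o x 1)).
    by rewrite (deriveV x0' (@derivable_id R R^o x 1)) derive_id exprVn /= [_ *: 1]mulr1.
  have dE : is_derive x (1 : R) (fun y : R => expR (- y^-1)) (x^-1 ^+ 2 * expR (- x^-1)).
    have := @is_derive1_comp R expR (fun y => - y^-1) x _ _ (is_derive_expR _) (is_deriveN dV).
    by rewrite opprK mulrC.
  have dP := is_deriveX k dV.
  have dM := is_deriveM dP dE.
  apply: (@near_eq_is_derive R R^o R^o _ (flat k) _ _ _ _ (is_derive_eq dM _)).
    by near=> y; rewrite /flat ifT ?exprfctE //; near: y; exact: lt_nbhsr.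
  have scE (a b : R) : a *: (b : R^o) = a * b by [].
  have kE : k%:R * x^-1 ^+ k = k%:R * x^-1 ^+ k.-1 * x^-1.
    by case: (k) => [|j]; rewrite ?mul0r // -mulrA -exprSr.
  rewrite exprfctE /flat x0 /= !scE.
  have -> : k%:R * (x^-1 ^+ k.+1 * expR (- x^-1)) = (k%:R * x^-1 ^+ k) * x^-1 * expR (- x^-1).
    by rewrite exprS; ring.
  by rewrite kE !exprS; ring.
- have -> : x = 0 by [].
  rewrite !flat_le0 // mulr0 subr0.
  have f0 : 0 < (k.+2`!%:R : R) by rewrite ltr0n fact_gt0.
  (* By [flatS] the difference quotient at 0 is [flat k.+1 h] for h > 0, which [flat_bound] keeps
     below (k+2)! |h|. *)
  have C : (h^-1 *: ((flat k : R^o -> R^o) (h *: 1 + 0) - flat k 0) : R^o) @[h --> 0^'] --> (0 : R^o).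
    apply/cvgrPdist_lt => e e0; near=> h.
    have -> : h^-1 *: ((flat k : R^o -> R^o) (h *: 1 + 0) - flat k 0) = flat k h * h^-1.
      by rewrite [flat k 0]flat_le0 // subr0 addr0 [h *: 1]mulr1 [_ *: _]mulrC.
    rewrite sub0r normrN.
    apply: (@le_lt_trans _ _ (k.+2`!%:R * `|h|)).
      have [h0|h0] := leP h 0; first by rewrite flat_le0 // mul0r normr0 mulr_ge0.
      rewrite flatS // [h * _]mulrC mulfK ?gt_eqF // ger0_norm ?flat_ge0 //.
      exact: flat_bound.
    rewrite -ltr_pdivlMl // mulrC; near: h; apply: dnbhs0_lt; exact: divr_gt0.
  apply: DeriveDef; first by apply/cvg_ex; exists 0.
  exact: cvg_lim C.
Unshelve. all: by end_near. Qed.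

(** The index k varies in the induction on r, since one derivative of [flat k] brings in the indices
    k + 1 and k + 2. *)
Lemma Cr_on_flat r k (V : normedModType R) (U : set V) (g : V -> R^o) : open U ->
  Cr_on r U g -> Cr_on r U (fun x => flat k (g x) : R^o).
Proof.
move=> oU; have dflat i x : differentiable (flat i : R^o -> R^o) x.
  by apply/derivable1_diffP; exact: (@ex_derive _ _ _ _ _ _ _ (is_derive_flat i x)).
elim: r k => [|r IH] k.
  move=> Cg x Ux; apply: (@continuous_comp _ _ _ g (flat k : R^o -> R^o)); first exact: Cg.
  exact/differentiable_continuous/dflat.
move=> Cg; have [dg Dg] := Cg; have Cg' := Cr_onW Cg; split => [x Ux|v].
  by apply: (@differentiable_comp _ _ _ _ g (flat k : R^o -> R^o)) => //; exact: dg.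
have C : Cr_on r U (fun x => 'D_v g x *
    (flat k.+2 (g x) + - (cst (k%:R : R^o) x * flat k.+1 (g x))) : R^o).
  apply: (Cr_onM oU (Dg v)); apply: (Cr_onD oU (IH _ Cg')).
  by apply: (Cr_onN oU); apply: (Cr_onM oU (Cr_on_cst _ _ _) (IH _ Cg')).
apply: (Cr_on_ext oU _ C) => x Ux /=.
have dgx := dg x Ux.
rewrite [RHS]deriveE; last exact: (@differentiable_comp _ _ _ _ g (flat k : R^o -> R^o)).
rewrite (@diff_comp _ _ _ _ g (flat k : R^o -> R^o)) //= (_ : 'd g x v = 'D_v g x); last by rewrite deriveE.
have -> : 'd (flat k : R^o -> R^o) (g x) ('D_v g x) = 'D_v g x *: 'd (flat k : R^o -> R^o) (g x) (1 : R^o).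
  by rewrite -linearZ /= [_ *: 1]mulr1.
rewrite -deriveE //; have [_ E] := is_derive_flat k (g x); congr (_ * _); exact: esym E.
Qed.

(** A radial bump built from [flat 0] alone. The inner [flat 0] vanishes up to Euclidean distance r1
    from x0 and is at least c from distance r2 on; so the outer one equals [flat 0 c] near x0 and
    vanishes far away, and the division normalises the plateau to 1. *)
Definition plateau m (x0 : 'rV[R]_m) (r1 r2 : R) (x : 'rV[R]_m) : R^o :=
  let c := flat 0 (r2 ^+ 2 - r1 ^+ 2) in
  flat 0 (c - flat 0 (\sum_j (x 0 j - x0 0 j) * (x 0 j - x0 0 j) - r1 ^+ 2)) / flat 0 c.

Section BumpProperties.
Variables (m : nat) (x0 : 'rV[R]_m) (r1 r2 : R).
Hypotheses (r10 : 0 < r1) (r12 : r1 < r2).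

Lemma flat0_homo x y : x <= y -> flat 0 x <= flat 0 y.
Proof.
move=> xy; have [h|h] := leP x 0; first by rewrite flat_le0 // flat_ge0.
have h' := lt_le_trans h xy.
by rewrite /flat h h' !mul1r ler_expR lerN2 lef_pV2.
Qed.

Let c0 : 0 < flat 0 (r2 ^+ 2 - r1 ^+ 2).
Proof. by apply: flat_gt0; rewrite subr_gt0 ltrXn2r ?nnegrE // ltW //; apply: lt_trans r12. Qed.

Lemma plateau_eq1 : \forall x \near x0, plateau x0 r1 r2 x = 1.
Proof.
pose f (x : 'rV[R]_m) : R^o := \sum_j (x 0 j - x0 0 j) * (x 0 j - x0 0 j).
have C : Cr_on 0 setT f.
  have C j : Cr_on 0 setT (fun x : 'rV[R]_m => x 0 j - x0 0 j : R^o).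
    by apply: (Cr_onD openT _ (Cr_on_cst _ _ _)) => x _; exact: coord_continuous.
  by apply: (@Cr_on_sum R _ _ R^o _ _ _ _ (fun j (x : 'rV[R]_m) => (x 0 j - x0 0 j) * (x 0 j - x0 0 j)) openT) => j _; exact: (Cr_onM openT (C j) (C j)).
have fx : f x0 < r1 ^+ 2.
  by rewrite /f big1 ?exprn_gt0 // => j _; rewrite subrr mulr0.
have /cvgrPdist_lt/(_ (r1 ^+ 2 - f x0)) := (C x0 I : f @ x0 --> f x0).
rewrite subr_gt0 => /(_ fx); apply: filterS => x /=; rewrite distrC => /ltr_normlW.
rewrite ltrD2r => h; rewrite /plateau (@flat_le0 0 (f x - r1 ^+ 2)); last first.
  by rewrite subr_le0; exact: ltW h.
by rewrite subr0 divff // gt_eqF // flat_gt0.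
Qed.

(** One coordinate is enough: the square of its difference is a single term of the squared Euclidean
    distance. This form matches the maximum norm, which defines the balls of row vectors. *)
Lemma plateau_eq0 (x : 'rV[R]_m) j : r2 <= `|x 0 j - x0 0 j| -> plateau x0 r1 r2 x = 0.
Proof.
move=> h; rewrite /plateau flat_le0 ?mul0r // subr_le0; apply: flat0_homo.
rewrite lerD2r (bigD1 j) //= -expr2 -(real_normK (num_real (x 0 j - x0 0 j))); apply: (@le_trans _ _ (`|x 0 j - x0 0 j| ^+ 2)).
  have r20 := ltW (lt_trans r10 r12).
  by rewrite lerXn2r.
rewrite lerDl sumr_ge0 // => i _; by rewrite -expr2 sqr_ge0.
Qed.

Lemma smooth_on_plateau : smooth_on setT (plateau x0 r1 r2).
Proof.
move=> r; pose f (x : 'rV[R]_m) : R^o := \sum_j (x 0 j - x0 0 j) * (x 0 j - x0 0 j) - r1 ^+ 2.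
have Cf : Cr_on r setT f.
  apply: (Cr_onD openT _ (Cr_on_cst _ _ _)); apply: (@Cr_on_sum R _ _ R^o _ _ _ _ (fun j (x : 'rV[R]_m) => (x 0 j - x0 0 j) * (x 0 j - x0 0 j)) openT) => j _.
  have C : Cr_on r setT (fun x : 'rV[R]_m => x 0 j - x0 0 j : R^o).
    apply: (Cr_onD openT _ (Cr_on_cst _ _ _)); apply: (@Cr_on_coord R r _ m setT id j openT).
    exact: Cr_on_id.
  exact: (Cr_onM openT C C).
pose c := flat 0 (r2 ^+ 2 - r1 ^+ 2).
have C1 : Cr_on r setT (fun x => cst (c : R^o) x + - (flat 0 (f x)) : R^o).
  by apply: (Cr_onD openT (Cr_on_cst _ _ _)); apply: (Cr_onN openT); exact: (Cr_on_flat 0 openT Cf).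
exact: (Cr_onM openT (Cr_on_flat 0 openT C1) (Cr_on_cst _ _ ((flat 0 c)^-1 : R^o))).
Qed.
End BumpProperties.
End Bump.

(** * Differential calculus on complex manifolds *)

Section Charts.
Context {R : realType} {T : topologicalType} {d : nat}.
Implicit Types (c : @chart R T d) (U : set T).

Lemma cimg_in c x : (cmap c @` cdom c) x -> cdom c (cinv c x) /\ cmap c (cinv c x) = x.
Proof. by move=> [p cp <-]; rewrite cmapK. Qed.

Lemma cimgP c U x : (cmap c @` (cdom c `&` U)) x <->
  [/\ (cmap c @` cdom c) x, cdom c (cinv c x), U (cinv c x) & cmap c (cinv c x) = x].
Proof.
split=> [[p [cp Up] <-]|[_ cx Ux <-]]; last by exists (cinv c x).
by rewrite cmapK //; split => //; exists p.
Qed.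

Lemma cimg_sub_open c U : open U -> open (cmap c @` (cdom c `&` U)).
Proof.
move=> oU; rewrite openE => _ [p [cp Up] <-]; rewrite /interior.
have n1 : nbhs (cmap c p) (cmap c @` cdom c).
  by apply: open_nbhs_nbhs; split; [exact: cimg_open|exists p].
have n2 : nbhs (cmap c p) [set x | U (cinv c x)].
  apply: (cinv_continuous cp); rewrite cmapK //; exact: open_nbhs_nbhs.
apply: filterS (filterI n1 n2) => x [cx Ux]; apply/cimgP.
by have [? ?] := cimg_in cx; split.
Qed.

Lemma preimg_chart_open c (B : set 'rV[R]_d) : open B -> open (cdom c `&` cmap c @^-1` B).
Proof.
move=> oB; rewrite openE => p [cp Bp]; apply: filterI.
  by apply: open_nbhs_nbhs; split => //; exact: cdom_open.
by apply: (cmap_continuous cp); exact: open_nbhs_nbhs.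
Qed.

End Charts.
Arguments cimg_sub_open {R T d} c {U}.

Section Functions.
Context {R : realType} {n : nat} (M : @manifold R (n + n) (@holomorphic_on R n)).
Local Notation C := R[i].
Local Notation d := (n + n)%N.
Implicit Types (c : @chart R M d) (a b : M -> C) (f g : M -> R) (U : set M) (p q : M).

Definition rsmooth_on U f : Prop := forall c, atlas c ->
  smooth_on (cmap c @` (cdom c `&` U)) ((fun x => f (cinv c x)) : 'rV[R]_d -> R^o).

Definition rpd c (j : 'I_d) f : M -> R := fun p =>
  'D_(delta_mx 0 j) ((fun x => f (cinv c x)) : 'rV[R]_d -> R^o) (cmap c p).

Lemma csmoothE U a : csmooth_on U a <->
  rsmooth_on U (fun p => complex.Re (a p)) /\ rsmooth_on U (fun p => complex.Im (a p)).
Proof.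
split=> [h|[h1 h2] c ac]; last by split; [exact: h1|exact: h2].
by split=> c ac; have [] := h c ac.
Qed.

Lemma transition_smooth c c' : atlas c -> atlas c' ->
  smooth_on (cmap c @` (cdom c `&` cdom c')) (transition c c').
Proof. by move=> ac ac'; have [[]] := atlas_compatible ac ac'. Qed.

(** [rsmooth_on] tests all charts of the atlas; over the domain of one chart the other tests follow
    by composition with the transition maps. *)
Lemma rsmooth_chart c U f : atlas c -> open U -> U `<=` cdom c ->
  smooth_on (cmap c @` U) ((fun x => f (cinv c x)) : 'rV[R]_d -> R^o) ->
  rsmooth_on U f.
Proof.
move=> ac oU Uc sf c' ac' r.
have oU' := cimg_sub_open c' oU.
have T := transition_smooth ac' ac r.
have T' : Cr_on r (cmap c' @` (cdom c' `&` U)) (transition c' c).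
  by apply: Cr_on_sub T => x [p [cp Up] <-]; exists p => //; split => //; exact: Uc.
apply: (Cr_on_ext oU' _ (Cr_on_comp oU' _ T' (sf r))) => x [p [cp Up] <-].
  by rewrite /= /transition /= !cmapK //; exact: Uc.
by rewrite /transition /= cmapK //; exists p.
Qed.

Lemma rsmooth_sub U U' f : U' `<=` U -> rsmooth_on U f -> rsmooth_on U' f.
Proof.
move=> sU sf c ac r; apply: Cr_on_sub (sf c ac r) => _ [p [cp Up] <-].
by exists p => //; split => //; exact: sU.
Qed.

Lemma rsmooth_local U f :
  (forall p, U p -> exists V, V p /\ rsmooth_on V f) -> rsmooth_on U f.
Proof.
move=> h c ac r; apply: Cr_on_local => _ [p [cp Up] <-].
have [V [Vp sV]] := h p Up; exists (cmap c @` (cdom c `&` V)).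
by split; [exists p|exact: sV].
Qed.

Lemma rsmooth_ext U f g : open U -> (forall p, U p -> f p = g p) ->
  rsmooth_on U f -> rsmooth_on U g.
Proof.
move=> oU fg sf c ac r; apply: (Cr_on_ext (cimg_sub_open c oU) _ (sf c ac r)).
by move=> x /cimgP [_ _ + _] => /fg.
Qed.

Lemma rsmoothD U f g : open U -> rsmooth_on U f -> rsmooth_on U g ->
  rsmooth_on U (fun p => f p + g p).
Proof.
by move=> oU sf sg c ac r; exact: (Cr_onD (cimg_sub_open c oU) (sf c ac r) (sg c ac r)).
Qed.

Lemma rsmoothM U f g : open U -> rsmooth_on U f -> rsmooth_on U g ->
  rsmooth_on U (fun p => f p * g p).
Proof.
by move=> oU sf sg c ac r; exact: (Cr_onM (cimg_sub_open c oU) (sf c ac r) (sg c ac r)).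
Qed.

Lemma rsmoothN U f : open U -> rsmooth_on U f -> rsmooth_on U (fun p => - f p).
Proof.
by move=> oU sf c ac r; exact: (Cr_onN (cimg_sub_open c oU) (sf c ac r)).
Qed.

Lemma rsmooth_cst U (x : R) : rsmooth_on U (fun=> x).
Proof. by move=> c ac r; exact: Cr_on_cst. Qed.

Lemma rsmooth_differentiable U f c p : rsmooth_on U f -> atlas c -> cdom c p -> U p ->
  differentiable ((fun x => f (cinv c x)) : 'rV[R]_d -> R^o) (cmap c p).
Proof. by move=> sf ac cp Up; have [+ _] := sf c ac 1%N; apply; exists p. Qed.

Lemma rpd_ext U f g c j p : open U -> U p -> cdom c p ->
  (forall q, U q -> f q = g q) -> rpd c j f p = rpd c j g p.
Proof.
move=> oU Up cp fg; apply: near_eq_derive.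
apply: (near_eq_open (cimg_sub_open c oU)); first by exists p.
by move=> x /cimgP [_ _ + _] => /fg.
Qed.

Lemma rsmooth_pd U f c j : open U -> U `<=` cdom c -> atlas c ->
  rsmooth_on U f -> rsmooth_on U (rpd c j f).
Proof.
move=> oU Uc ac sf; apply: (rsmooth_chart ac oU Uc) => r.
have UE : cmap c @` U = cmap c @` (cdom c `&` U).
  by congr (_ @` _); apply/seteqP; split=> q; [move=> Uq; split => //; exact: Uc|case].
have oU' := cimg_sub_open c oU.
rewrite UE; have [_ Df] := sf c ac r.+1.
apply: (Cr_on_ext oU' _ (Df (delta_mx 0 j))) => x /cimgP [_ _ _ xE].
by rewrite /rpd xE.
Qed.

Lemma rpdD U f g c j p : U p -> cdom c p -> atlas c ->
  rsmooth_on U f -> rsmooth_on U g ->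
  rpd c j (fun q => f q + g q) p = rpd c j f p + rpd c j g p.
Proof.
move=> Up cp ac sf sg; rewrite /rpd.
by rewrite -deriveD //; apply/diff_derivable; [exact: (rsmooth_differentiable sf)|exact: (rsmooth_differentiable sg)].
Qed.

Lemma rpdM U f g c j p : U p -> cdom c p -> atlas c ->
  rsmooth_on U f -> rsmooth_on U g ->
  rpd c j (fun q => f q * g q) p = f p * rpd c j g p + g p * rpd c j f p.
Proof.
move=> Up cp ac sf sg; rewrite /rpd.
have /diff_derivable df := rsmooth_differentiable sf ac cp Up.
have /diff_derivable dg := rsmooth_differentiable sg ac cp Up.
by have := deriveM (df (delta_mx 0 j)) (dg (delta_mx 0 j)); rewrite cmapK.
Qed.

Lemma rpd_cst c j p (x : R) : rpd c j (fun=> x) p = 0.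
Proof. exact: derive_cst. Qed.

Lemma rpd_comm U f c i j p : open U -> U p -> cdom c p -> atlas c ->
  rsmooth_on U f -> rpd c i (rpd c j f) p = rpd c j (rpd c i f) p.
Proof.
move=> oU Up cp ac sf.
have oU' := cimg_sub_open c oU.
have Up' : (cmap c @` (cdom c `&` U)) (cmap c p) by exists p.
have E u v : rpd c u (rpd c v f) p = 'D_(delta_mx 0 u) (fun x => 'D_(delta_mx 0 v) ((fun x => f (cinv c x)) : 'rV[R]_d -> R^o) x : R^o) (cmap c p).
  apply: near_eq_derive; apply: (near_eq_open oU') => // x /cimgP [_ _ _ xE].
  by rewrite /rpd xE.
rewrite !E.
exact: (@derive_comm _ _ ((fun x => f (cinv c x)) : 'rV[R]_d -> R^o) _ _ _ _ oU' Up' (sf c ac 2%N)).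
Qed.

Lemma rpd_chain U f c c' j p : open U -> U p -> cdom c p -> cdom c' p -> atlas c -> atlas c' ->
  rsmooth_on U f ->
  rpd c j f p = \sum_i ('J (transition c c') (cmap c p)) j i * rpd c' i f p.
Proof.
move=> oU Up cp c'p ac ac' sf.
pose V := cdom c `&` cdom c'.
have oV : open V by apply: openI; exact: cdom_open.
have oV' := cimg_sub_open c oV.
have dT : differentiable (transition c c') (cmap c p).
  by have [+ _] := transition_smooth ac ac' 1%N; apply; exists p.
have dF : differentiable ((fun x => f (cinv c' x)) : 'rV[R]_d -> R^o) (transition c c' (cmap c p)).
  by rewrite /transition /= cmapK //; exact: (rsmooth_differentiable sf).
transitivity ('D_(delta_mx 0 j) (((fun x => f (cinv c' x)) : 'rV[R]_d -> R^o) \o transition c c') (cmap c p)).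
  apply: near_eq_derive; apply: (near_eq_open oV'); first by exists p.
  by move=> x /cimgP [_ cx [_ c'x] _]; rewrite /= /transition /= cmapK.
rewrite derive_compE //; apply: eq_bigr => i _.
by rewrite deriveEjacobian // -rowE mxE /rpd {2}/transition /= cmapK.
Qed.

End Functions.

Section ComplexFunctions.
Context {R : realType} {n : nat} (M : @manifold R (n + n) (@holomorphic_on R n)).
Local Notation C := R[i].
Local Notation d := (n + n)%N.
Implicit Types (c : @chart R M d) (a b : M -> C) (f g : M -> R) (U : set M) (p q : M).

Lemma csmooth_sub U U' a : U' `<=` U -> csmooth_on U a -> csmooth_on U' a.
Proof.
move=> sU /csmoothE [h1 h2]; apply/csmoothE.
by split; [exact: (rsmooth_sub sU h1)|exact: (rsmooth_sub sU h2)].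
Qed.

Lemma csmooth_local U a :
  (forall p, U p -> exists V, V p /\ csmooth_on V a) -> csmooth_on U a.
Proof.
move=> h; apply/csmoothE; split; apply: rsmooth_local => p /h [V [Vp /csmoothE []]];
by exists V.
Qed.

Lemma csmooth_ext U a b : open U -> (forall p, U p -> a p = b p) ->
  csmooth_on U a -> csmooth_on U b.
Proof.
move=> oU ab /csmoothE [h1 h2]; apply/csmoothE.
by split; [apply: (rsmooth_ext oU _ h1)|apply: (rsmooth_ext oU _ h2)] => p /ab ->.
Qed.

Lemma csmoothD U a b : open U -> csmooth_on U a -> csmooth_on U b ->
  csmooth_on U (fun p => a p + b p).
Proof.
move=> oU /csmoothE [h1 h2] /csmoothE [k1 k2]; apply/csmoothE; split.
  by apply: (rsmooth_ext oU _ (rsmoothD oU h1 k1)) => p _; case: (a p) (b p) => [? ?] [].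
by apply: (rsmooth_ext oU _ (rsmoothD oU h2 k2)) => p _; case: (a p) (b p) => [? ?] [].
Qed.

Lemma csmoothM U a b : open U -> csmooth_on U a -> csmooth_on U b ->
  csmooth_on U (fun p => a p * b p).
Proof.
move=> oU /csmoothE [h1 h2] /csmoothE [k1 k2]; apply/csmoothE; split.
  apply: (rsmooth_ext oU _ (rsmoothD oU (rsmoothM oU h1 k1) (rsmoothN oU (rsmoothM oU h2 k2)))) => p _.
  by case: (a p) (b p) => [? ?] [].
apply: (rsmooth_ext oU _ (rsmoothD oU (rsmoothM oU h1 k2) (rsmoothM oU h2 k1))) => p _.
by case: (a p) (b p) => [? ?] [].
Qed.

Lemma csmooth_cst U (x : C) : csmooth_on U (fun=> x).
Proof. by apply/csmoothE; split; exact: rsmooth_cst. Qed.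

Lemma csmoothN U a : open U -> csmooth_on U a -> csmooth_on U (fun p => - a p).
Proof.
move=> oU sa; apply: (csmooth_ext oU _ (csmoothM oU (csmooth_cst U (-1)) sa)) => p _.
by rewrite mulN1r.
Qed.

Lemma csmooth_sum U (I : Type) (s : seq I) (P : pred I) (a : I -> M -> C) : open U ->
  (forall i, P i -> csmooth_on U (a i)) ->
  csmooth_on U (fun p => \sum_(i <- s | P i) a i p).
Proof.
move=> oU h; elim: s => [|i s IH].
  by apply: (csmooth_ext oU _ (csmooth_cst U 0)) => p _; rewrite big_nil.
case Pi : (P i).
  by apply: (csmooth_ext oU _ (csmoothD oU (h i Pi) IH)) => p _; rewrite big_cons Pi.
by apply: (csmooth_ext oU _ IH) => p _; rewrite big_cons Pi.
Qed.

Lemma pdE c j a p : pd c j a p =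
  (rpd c j (fun q => complex.Re (a q)) p) +i* (rpd c j (fun q => complex.Im (a q)) p).
Proof. exact: erefl. Qed.

Lemma rpd_eq c j f g p : f =1 g -> rpd c j f p = rpd c j g p.
Proof. by move=> /funext ->. Qed.

Lemma pd_ext U a b c j p : open U -> U p -> cdom c p ->
  (forall q, U q -> a q = b q) -> pd c j a p = pd c j b p.
Proof.
move=> oU Up cp ab; rewrite !pdE; congr (_ +i* _).
  exact: (rpd_ext j oU Up cp (fun q Uq => congr1 (@complex.Re R) (ab q Uq))).
exact: (rpd_ext j oU Up cp (fun q Uq => congr1 (@complex.Im R) (ab q Uq))).
Qed.

Lemma csmooth_pd U a c j : open U -> U `<=` cdom c -> atlas c ->
  csmooth_on U a -> csmooth_on U (pd c j a).
Proof.
move=> oU Uc ac /csmoothE [h1 h2]; apply/csmoothE; split.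
  exact: (rsmooth_pd j oU Uc ac h1).
exact: (rsmooth_pd j oU Uc ac h2).
Qed.

Lemma pdD U a b c j p : U p -> cdom c p -> atlas c ->
  csmooth_on U a -> csmooth_on U b ->
  pd c j (fun q => a q + b q) p = pd c j a p + pd c j b p.
Proof.
move=> Up cp ac /csmoothE [h1 h2] /csmoothE [k1 k2].
have E1 := rpdD j Up cp ac h1 k1; have E2 := rpdD j Up cp ac h2 k2.
rewrite !pdE -[RHS]/((_ + _) +i* (_ + _)) -E1 -E2; congr (_ +i* _); apply: rpd_eq => q.
  by case: (a q) (b q) => [? ?] [].
by case: (a q) (b q) => [? ?] [].
Qed.

(** The shape of the real and of the imaginary part of a product of complex functions. *)
Lemma rpdMD U f g f' g' c j p : U p -> open U -> cdom c p -> atlas c ->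
  rsmooth_on U f -> rsmooth_on U g -> rsmooth_on U f' -> rsmooth_on U g' ->
  rpd c j (fun q => f q * g q + f' q * g' q) p =
  (f p * rpd c j g p + g p * rpd c j f p) + (f' p * rpd c j g' p + g' p * rpd c j f' p).
Proof.
move=> Up oU cp ac sf sg sf' sg'.
rewrite (rpdD j Up cp ac (rsmoothM oU sf sg) (rsmoothM oU sf' sg')).
by rewrite (rpdM j Up cp ac sf sg) (rpdM j Up cp ac sf' sg').
Qed.

Lemma rpd_cstM U f c j p (x : R) : U p -> cdom c p -> atlas c -> rsmooth_on U f ->
  rpd c j (fun q => x * f q) p = x * rpd c j f p.
Proof.
move=> Up cp ac sf; rewrite (rpdM j Up cp ac (rsmooth_cst U x) sf).
by rewrite rpd_cst mulr0 addr0.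
Qed.

Lemma ReM (x y : C) : complex.Re (x * y) =
  complex.Re x * complex.Re y + - complex.Im x * complex.Im y.
Proof. by case: x y => [? ?] [? ?] /=; rewrite mulNr. Qed.

Lemma ImM (x y : C) : complex.Im (x * y) =
  complex.Re x * complex.Im y + complex.Im x * complex.Re y.
Proof. by case: x y => [? ?] [? ?]. Qed.

Lemma pdM U a b c j p : open U -> U p -> cdom c p -> atlas c ->
  csmooth_on U a -> csmooth_on U b ->
  pd c j (fun q => a q * b q) p = a p * pd c j b p + pd c j a p * b p.
Proof.
move=> oU Up cp ac /csmoothE [h1 h2] /csmoothE [k1 k2].
have E1 := rpdMD j Up oU cp ac h1 k1 (rsmoothN oU h2) k2.
have E2 := rpdMD j Up oU cp ac h1 k2 h2 k1.
have N : rpd c j (fun q => - complex.Im (a q)) p = - rpd c j (fun q => complex.Im (a q)) p.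
  rewrite -mulN1r -(rpd_cstM j _ Up cp ac h2).
  by apply: rpd_eq => x; rewrite mulN1r.
rewrite N in E1; rewrite !pdE.
rewrite (@rpd_eq c j (fun q => complex.Re (a q * b q)) _ p (fun q => ReM _ _)).
rewrite (@rpd_eq c j (fun q => complex.Im (a q * b q)) _ p (fun q => ImM _ _)).
rewrite E1 E2; case: (a p) (b p) => [a1 a2] [b1 b2] /=.
move: (rpd _ _ _ _) (rpd _ _ _ _) (rpd _ _ _ _) (rpd _ _ _ _) => x1 x2 x3 x4.
by apply/eqP; rewrite eq_complex /=; apply/andP; split; apply/eqP; ring.
Qed.

Lemma pd_cst c j p (x : C) : pd c j (fun=> x) p = 0.
Proof. by rewrite /pd !derive_cst. Qed.

Lemma pd_cstM U a c j p (x : C) : open U -> U p -> cdom c p -> atlas c -> csmooth_on U a ->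
  pd c j (fun q => x * a q) p = x * pd c j a p.
Proof.
move=> oU Up cp ac sa; rewrite (pdM j oU Up cp ac (csmooth_cst U x) sa).
by rewrite pd_cst mul0r addr0.
Qed.

Lemma pd_comm U a c i j p : open U -> U p -> cdom c p -> atlas c ->
  csmooth_on U a -> pd c i (pd c j a) p = pd c j (pd c i a) p.
Proof.
move=> oU Up cp ac /csmoothE [h1 h2].
have E u v : pd c u (pd c v a) p = (rpd c u (rpd c v (fun q => complex.Re (a q))) p) +i*
    (rpd c u (rpd c v (fun q => complex.Im (a q))) p).
  by rewrite pdE; congr (_ +i* _); apply: rpd_eq => q; rewrite pdE.
by rewrite !E (rpd_comm i j oU Up cp ac h1) (rpd_comm i j oU Up cp ac h2).
Qed.

Lemma complex_sum (I : Type) (s : seq I) (P : pred I) (x y : I -> R) :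
  \sum_(i <- s | P i) (x i +i* y i) = (\sum_(i <- s | P i) x i) +i* (\sum_(i <- s | P i) y i).
Proof.
elim: s => [|i s IH]; first by rewrite !big_nil.
by rewrite !big_cons; case: (P i); rewrite IH.
Qed.

Lemma real_complexM (x u v : R) : real_complex R x * (u +i* v) = (x * u) +i* (x * v).
Proof. by rewrite /=; simpc. Qed.

Lemma pd_chain U a c c' j p : open U -> U p -> cdom c p -> cdom c' p -> atlas c -> atlas c' ->
  csmooth_on U a ->
  pd c j a p = \sum_i cjacobian c c' p j i * pd c' i a p.
Proof.
move=> oU Up cp c'p ac ac' /csmoothE [h1 h2].
have E1 := rpd_chain j oU Up cp c'p ac ac' h1; have E2 := rpd_chain j oU Up cp c'p ac ac' h2.
rewrite pdE E1 E2 -complex_sum; apply: eq_bigr => i _.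
have -> : cjacobian c c' p j i = real_complex R ('J (transition c c') (cmap c p) j i) by rewrite /cjacobian mxE.
by rewrite pdE real_complexM.
Qed.

End ComplexFunctions.

(** * Holomorphic and antiholomorphic coordinates and derivatives *)

Section Coordinates.
Context {R : realType} {n : nat} {M : @manifold R (n + n) (@holomorphic_on R n)}.
Local Notation C := R[i].
Local Notation d := (n + n)%N.
Implicit Types (c : @chart R M d) (a : M -> C) (U : set M) (p q : M) (b : bool).

Lemma rpd_coord c i j p : cdom c p -> rpd c j (fun q => cmap c q 0 i) p = (j == i)%:R.
Proof.
move=> cp; transitivity ('D_(delta_mx 0 j) (fun x : 'rV[R]_d => (id x) 0 i : R^o) (cmap c p)).
  have oc := cimg_sub_open c (@cdom_open _ _ _ c).
  apply: near_eq_derive; apply: (near_eq_open oc); first by exists p.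
  by move=> x /cimgP [_ _ _ xE]; rewrite xE.
rewrite derive_coord; last exact: (@ex_diff _ _ _ _ _ _ _ (is_diff_id _)).
by rewrite derive_id mxE eqxx /= eq_sym.
Qed.

Lemma rsmooth_coord c i : atlas c -> rsmooth_on (cdom c) (fun q => cmap c q 0 i).
Proof.
move=> ac c' ac' r.
exact: (@Cr_on_coord R r _ d _ (transition c' c) i (cimg_sub_open c' (@cdom_open _ _ _ c))
  (transition_smooth ac' ac r)).
Qed.

(* [b = false] stands for the holomorphic and [b = true] for the antiholomorphic
   coordinates and derivatives: a statement and its conjugate are proved at once. *)
Definition sgi b : C := if b then 'i%C else - 'i%C.

Definition dzb b (k : 'I_n) : 'rV[C]_d :=
  delta_mx 0 (lshift n k) - sgi b *: delta_mx 0 (rshift n k).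

Definition Zd b c (k : 'I_n) a : M -> C := fun p =>
  2^-1 * (pd c (lshift n k) a p + sgi b * pd c (rshift n k) a p).

Definition zc b c (k : 'I_n) : M -> C := fun p =>
  (cmap c p 0 (lshift n k)) +i* (- complex.Im (sgi b) * cmap c p 0 (rshift n k)).

Lemma dzb_dz : dzb false = @dz R n.
Proof. by apply/funext => k; rewrite /dzb /dz /sgi scaleNr opprK. Qed.

Lemma dzb_dzbar : dzb true = @dzbar R n.
Proof. by []. Qed.

Lemma Zd_Zder : Zd false = @Zder R n M.
Proof.
by apply/funext => c; apply/funext => k; apply/funext => a; apply/funext => p; rewrite /Zd /sgi mulNr.
Qed.

Lemma Zd_Zbarder : Zd true = @Zbarder R n M.
Proof. by []. Qed.

Lemma sgi2 b : sgi b * sgi b = -1.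
Proof. by case: b; rewrite /sgi ?mulrNN -expr2 sqr_i. Qed.

Lemma sgiN b : sgi (~~ b) = - sgi b.
Proof. by case: b => //=; rewrite opprK. Qed.

Lemma csmooth_zc b c k : atlas c -> csmooth_on (cdom c) (zc b c k).
Proof.
move=> ac; apply/csmoothE; split; first exact: rsmooth_coord.
exact: (rsmoothM (@cdom_open _ _ _ c) (rsmooth_cst _ _) (rsmooth_coord _ ac)).
Qed.

Lemma dzb_lshift b k j : dzb b k 0 (lshift n j) = (j == k)%:R.
Proof.
by rewrite /dzb !mxE eqxx /= eq_lshift eq_sym eq_lrshift mulr0 subr0 eq_sym.
Qed.

Lemma dzb_rshift b k j : dzb b k 0 (rshift n j) = - (sgi b * (j == k)%:R).
Proof. by rewrite /dzb !mxE eqxx /= eq_rshift eq_rlshift sub0r. Qed.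

Lemma pd_zc b c k j p : atlas c -> cdom c p -> pd c j (zc b c k) p = dzb b k 0 j.
Proof.
move=> ac cp; rewrite pdE /= rpd_coord //.
rewrite (rpd_cstM j _ cp cp ac (rsmooth_coord _ ac)) rpd_coord //.
rewrite -(splitK j); case: (fintype.split j) => i /=.
  rewrite dzb_lshift eq_lshift eq_lrshift mulr0.
  by apply/eqP; rewrite eq_complex; case: (i == k) => /=; rewrite !eqxx.
rewrite dzb_rshift eq_rlshift eq_rshift.
by apply/eqP; rewrite eq_complex; case: b; case: (i == k);
  rewrite /sgi /= ?(mulr0, mul0r, mulr1, mul1r, mulN1r, oppr0, opprK, subr0, addr0, add0r) !eqxx.
Qed.

Lemma half2 : (2 : C)^-1 + 2^-1 = 1.
Proof. by rewrite -mulr2n -[_ *+ 2]mulr_natr mulVf // pnatr_eq0. Qed.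

Lemma half_sum (x y : C) : 2^-1 * (x + sgi false * y) + 2^-1 * (x + sgi true * y) = x.
Proof. by rewrite /sgi -mulrDr mulNr addrACA addNr addr0 mulrDr -mulrDl half2 mul1r. Qed.

Lemma half_diff (x y : C) :
  2^-1 * (x + sgi false * y) * - sgi false + 2^-1 * (x + sgi true * y) * - sgi true = y.
Proof.
have -> : sgi true = - sgi false by rewrite -(sgiN false).
move: (sgi false) (sgi2 false) (2^-1 : C) half2 => s s2 h h2.
have -> : h * (x + s * y) * - s + h * (x + - s * y) * - - s = (h + h) * - (s * s) * y by ring.
by rewrite h2 s2 opprK !mul1r.
Qed.

Lemma zcE b c k p : zc b c k p =
  (cmap c p 0 (lshift n k)) +i* (- complex.Im (sgi b) * cmap c p 0 (rshift n k)).
Proof. by []. Qed.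

Lemma sgiE b : sgi b = 0 +i* complex.Im (sgi b).
Proof. by case: b; rewrite /sgi //=; apply/eqP; rewrite eq_complex /= oppr0 !eqxx. Qed.

Lemma ZdE b c k a p :
  Zd b c k a p = 2^-1 * (pd c (lshift n k) a p + sgi b * pd c (rshift n k) a p).
Proof. by []. Qed.

Definition dzc b k j : C := dzb b k 0 j.

Lemma dzcE b k j : dzc b k j = dzb b k 0 j.
Proof. by []. Qed.

Lemma dzcl b k j : dzc b k (lshift n j) = (j == k)%:R.
Proof. exact: dzb_lshift. Qed.

Lemma dzcr b k j : dzc b k (rshift n j) = (j == k)%:R * - sgi b.
Proof. by rewrite mulrN mulrC; exact: dzb_rshift. Qed.

Opaque pd Zd sgi dzb dzc.

Lemma Zd_zc b b' c k l p : atlas c -> cdom c p ->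
  Zd b c k (zc b' c l) p = ((k == l) && (b == b'))%:R.
Proof.
move=> ac cp; rewrite !ZdE !pd_zc // dzb_lshift dzb_rshift mulrN mulrA.
have [->|nb] := eqVneq b b'.
  rewrite sgi2 mulN1r opprK mulrDr -mulrDl half2 mul1r andbT //.
have -> : b' = ~~ b by case: (b) (b') nb => [] [].
by rewrite sgiN mulrN sgi2 opprK mul1r subrr mulr0 andbF.
Qed.

Lemma sum_dz_lshift (z w : 'I_n -> C) i :
  \sum_k (z k * dzc false k (lshift n i) + w k * dzc true k (lshift n i)) = z i + w i.
Proof.
transitivity (\sum_k (z k + w k) * (i == k)%:R).
  by apply: eq_bigr => k _; rewrite !dzcl mulrDl.
rewrite (bigD1 i) //= eqxx mulr1 big1 ?addr0 // => k ki.
by rewrite eq_sym (negbTE ki) mulr0.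
Qed.

Lemma sum_dz_rshift (z w : 'I_n -> C) i :
  \sum_k (z k * dzc false k (rshift n i) + w k * dzc true k (rshift n i))
  = z i * - sgi false + w i * - sgi true.
Proof.
transitivity (\sum_k (z k * - sgi false + w k * - sgi true) * (i == k)%:R).
  apply: eq_bigr => k _; rewrite !dzcr mulrDl.
  by rewrite ![(_ == _)%:R * _]mulrC !mulrA.
rewrite (bigD1 i) //= eqxx mulr1 big1 ?addr0 // => k ki.
by rewrite eq_sym (negbTE ki) mulr0.
Qed.

Lemma pd_Zd c j a p : pd c j a p =
  \sum_k (Zd false c k a p * dzc false k j + Zd true c k a p * dzc true k j).
Proof.
rewrite -(splitK j); case: (fintype.split j) => i.
  by apply: etrans (esym (sum_dz_lshift _ _ i)); rewrite !ZdE half_sum.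
by apply: etrans (esym (sum_dz_rshift _ _ i)); rewrite !ZdE half_diff.
Qed.

(** The value of dz^k or dzbar^k on the vector x, that is, its component along [Zd b c k]. *)
Definition dotz b (x : 'I_d -> C) k : C := \sum_j x j * dzc b k j.

Lemma sum_dotz (x : 'I_d -> C) (z w : 'I_n -> C) :
  \sum_j x j * (\sum_k (z k * dzc false k j + w k * dzc true k j)) =
  \sum_k (dotz false x k * z k + dotz true x k * w k).
Proof.
under eq_bigr do rewrite mulr_sumr.
rewrite exchange_big /=; apply: eq_bigr => k _.
have E (y : 'I_d -> C) (v : C) : (\sum_j y j) * v = \sum_j y j * v by rewrite mulr_suml.
apply/esym; apply: (etrans (congr2 +%R (E (fun j => x j * dzc false k j) (z k))
  (E (fun j => x j * dzc true k j) (w k)))).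
rewrite -big_split; apply: eq_bigr => j _; apply/esym.
by rewrite mulrDr; congr (_ + _); rewrite [_ * dzc _ _ _]mulrC mulrA.
Qed.

Lemma sum_pd_Zd c (x : 'I_d -> C) a p : \sum_j x j * pd c j a p =
  \sum_k (dotz false x k * Zd false c k a p + dotz true x k * Zd true c k a p).
Proof. by rewrite -sum_dotz; apply: eq_bigr => j _; rewrite pd_Zd. Qed.

Lemma Zd_ext b U a a' c k p : open U -> U p -> cdom c p ->
  (forall q, U q -> a q = a' q) -> Zd b c k a p = Zd b c k a' p.
Proof. by move=> oU Up cp aa'; rewrite !ZdE !(pd_ext _ oU Up cp aa'). Qed.

Lemma csmooth_Zd b U a c k : open U -> U `<=` cdom c -> atlas c ->
  csmooth_on U a -> csmooth_on U (Zd b c k a).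
Proof.
move=> oU Uc ac sa; apply: (csmoothM oU (csmooth_cst _ _)).
apply: (csmoothD oU (csmooth_pd _ oU Uc ac sa)).
exact: (csmoothM oU (csmooth_cst _ _) (csmooth_pd _ oU Uc ac sa)).
Qed.

Lemma ZdD b U a a' c k p : U p -> cdom c p -> atlas c ->
  csmooth_on U a -> csmooth_on U a' ->
  Zd b c k (fun q => a q + a' q) p = Zd b c k a p + Zd b c k a' p.
Proof.
by move=> Up cp ac sa sa'; rewrite !ZdE !(pdD _ Up cp ac sa sa') [sgi b * _]mulrDr addrACA mulrDr.
Qed.

Lemma ZdM b U a a' c k p : open U -> U p -> cdom c p -> atlas c ->
  csmooth_on U a -> csmooth_on U a' ->
  Zd b c k (fun q => a q * a' q) p = a p * Zd b c k a' p + Zd b c k a p * a' p.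
Proof. move=> oU Up cp ac sa sa'; rewrite !ZdE !(pdM _ oU Up cp ac sa sa').
move: (pd c (lshift n k) a p) (pd c (rshift n k) a p) (pd c (lshift n k) a' p) => x y x'.
move: (pd c (rshift n k) a' p) (a p) (a' p) (sgi b) (2^-1 : C) => y' u u' s h; ring. Qed.

Lemma Zd_cst b c k p (x : C) : Zd b c k (fun=> x) p = 0.
Proof. by rewrite !ZdE !pd_cst mulr0 addr0 mulr0. Qed.

Lemma Zd_cstM b U a c k p (x : C) : open U -> U p -> cdom c p -> atlas c ->
  csmooth_on U a -> Zd b c k (fun q => x * a q) p = x * Zd b c k a p.
Proof.
move=> oU Up cp ac sa; rewrite (ZdM b k oU Up cp ac (csmooth_cst U x) sa).
by rewrite Zd_cst mul0r addr0.
Qed.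

Lemma Zd_sum b U (I : Type) (s : seq I) (P : pred I) (a : I -> M -> C) c k p : open U ->
  U p -> cdom c p -> atlas c -> (forall i, P i -> csmooth_on U (a i)) ->
  Zd b c k (fun q => \sum_(i <- s | P i) a i q) p = \sum_(i <- s | P i) Zd b c k (a i) p.
Proof.
move=> oU Up cp ac sa; elim: s => [|i s IH].
  rewrite big_nil -[RHS](Zd_cst b c k p 0); apply: (Zd_ext b k oU Up cp) => q _.
  by rewrite big_nil.
rewrite big_cons; case Pi : (P i).
  rewrite -IH -(ZdD b k Up cp ac (sa i Pi) (csmooth_sum s oU sa)).
  by apply: (Zd_ext b k oU Up cp) => q _; rewrite big_cons Pi.
by rewrite -IH; apply: (Zd_ext b k oU Up cp) => q _; rewrite big_cons Pi.
Qed.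

Lemma pd_comb U a a' c j p (x y : C) : open U -> U p -> cdom c p -> atlas c ->
  csmooth_on U a -> csmooth_on U a' ->
  pd c j (fun q => x * (a q + y * a' q)) p = x * (pd c j a p + y * pd c j a' p).
Proof.
move=> oU Up cp ac sa sa'.
have sya := csmoothM oU (csmooth_cst U y) sa'.
rewrite (pd_cstM j x oU Up cp ac (csmoothD oU sa sya)).
by rewrite (pdD j Up cp ac sa sya) (pd_cstM j y oU Up cp ac sa').
Qed.

Lemma Zd_comm b b' U a c k l p : open U -> U `<=` cdom c -> U p -> atlas c ->
  csmooth_on U a -> Zd b c k (Zd b' c l a) p = Zd b' c l (Zd b c k a) p.
Proof.
move=> oU Uc Up ac sa; have cp := Uc p Up.
have sp j := csmooth_pd j oU Uc ac sa.
have E b1 k1 j : pd c j (Zd b1 c k1 a) p = 2^-1 * (pd c j (pd c (lshift n k1) a) p + sgi b1 * pd c j (pd c (rshift n k1) a) p).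
  rewrite -(pd_comb j _ _ oU Up cp ac (sp _) (sp _)).
  by apply: (pd_ext j oU Up cp) => q _; rewrite ZdE.
rewrite [LHS]ZdE !E [RHS]ZdE !E.
rewrite (pd_comm (lshift n k) (lshift n l) oU Up cp ac sa) (pd_comm (lshift n k) (rshift n l) oU Up cp ac sa).
rewrite (pd_comm (rshift n k) (lshift n l) oU Up cp ac sa) (pd_comm (rshift n k) (rshift n l) oU Up cp ac sa).
move: (pd c (lshift n l) _ p) (pd c (rshift n l) _ p) (pd c (lshift n l) _ p) (pd c (rshift n l) _ p) => x y x' y'.
move: (sgi b) (sgi b') (2^-1 : C) => s s' h; ring.
Qed.

Lemma cjacobian_mulV c c' p : atlas c -> atlas c' -> cdom c p -> cdom c' p ->
  cjacobian c c' p *m cjacobian c' c p = 1%:M.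
Proof.
move=> ac ac' cp c'p; apply/matrixP => j i.
(* The chain rule from c to c' and back is applied to the i-th real coordinate of c: the entry (j,
   i) of the product is its derivative along the j-th coordinate. *)
pose x : M -> C := fun q => (cmap c q 0 i) +i* 0.
have sx : csmooth_on (cdom c) x.
  by apply/csmoothE; split; [exact: rsmooth_coord|exact: rsmooth_cst].
have oc := @cdom_open _ _ _ c.
have dx l : pd c l x p = (l == i)%:R.
  by rewrite pdE /= rpd_coord // rpd_cst; case: (_ == _).
rewrite [RHS]mxE -dx (pd_chain j oc cp cp c'p ac ac' sx) mxE; apply: eq_bigr => l _.
rewrite (pd_chain l oc cp c'p cp ac' ac sx) (bigD1 i) //= big1 => [|m mi].
  by rewrite dx eqxx mulr1 addr0.
by rewrite dx (negbTE mi) mulr0.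
Qed.

Definition Icx : 'M[C]_d := map_mx (real_complex R) (Imx n).

Lemma cjacobian_I c c' p : atlas c -> atlas c' -> cdom c p -> cdom c' p ->
  Icx *m cjacobian c c' p = cjacobian c c' p *m Icx.
Proof.
move=> ac ac' cp c'p; rewrite /cjacobian /Icx -!map_mxM; congr (map_mx _ _).
have [[_ hol] _] := atlas_compatible ac ac'.
have dT : differentiable (transition c c') (cmap c p).
  by have [+ _] := transition_smooth ac ac' 1%N; apply; exists p.
apply/row_matrixP => i; rewrite !rowE.
have := hol (cmap c p) (delta_mx 0 i); rewrite !deriveEjacobian // !mulmxA => -> //.
by exists p.
Qed.

End Coordinates.

(** * Global cutoffs and contractible charts *)

Section Cutoff.
Context {R : realType} {n : nat} {M : @manifold R (n + n) (@holomorphic_on R n)}.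
Local Notation C := R[i].
Local Notation d := (n + n)%N.
Implicit Types (c : @chart R M d) (a : M -> C) (U : set M) (p q : M).

(** The closed ball of the maximum norm, written as a product of segments to make it compact. *)
Definition cube (x0 : 'rV[R]_d) (r : R) : set 'rV[R]_d :=
  [set x | forall j, `[x0 0 j - r, x0 0 j + r]%classic (x 0 j)].

Lemma cube_compact x0 r : compact (cube x0 r).
Proof. by apply: (@rV_compact R d (fun j => `[x0 0 j - r, x0 0 j + r]%classic)) => j; exact: segment_compact. Qed.

Lemma cubeE (x0 x : 'rV[R]_d) r : cube x0 r x <-> forall j, `|x 0 j - x0 0 j| <= r.
Proof.
split=> h j; have := h j; rewrite /= in_itv /= ler_distl //.
Qed.

Lemma cube_ball (x0 x : 'rV[R]_d) r e : 0 < e -> r < e -> cube x0 r x -> ball x0 e x.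
Proof.
move=> e0 re /cubeE h; split => // i j; rewrite ord1 -ball_normE /ball_ /= distrC.
exact: le_lt_trans (h j) re.
Qed.

(** chi is a plateau function in a chart, extended by 0. It vanishes off the image S of a compact
    cube, contained in the chart domain and in U; S is closed since M is Hausdorff. So M is covered
    by two open sets, one on which both chi and a are smooth and one on which chi a is 0. *)
Lemma csmooth_cutoff U p : open U -> U p ->
  exists (chi : M -> C) (V : set M),
    [/\ open V, V p, V `<=` U, forall q, V q -> chi q = 1 &
      forall a, csmooth_on U a -> csmooth (fun q => chi q * a q)].
Proof.
move=> oU Up; set c := chart_at p.
have cp : cdom c p := mem_chart_at p.
have ac : atlas c := atlas_chart_at p.
set x0 := cmap c p.
have [e e0 eB] : exists2 e : R, 0 < e & ball x0 e `<=` cmap c @` (cdom c `&` U).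
  have : nbhs x0 (cmap c @` (cdom c `&` U)).
    by apply: open_nbhs_nbhs; split; [exact: cimg_sub_open|exists p].
  by move=> /nbhs_ballP [e e0 eB]; exists e.
pose r2 := e / 2; pose r1 := r2 / 2.
have r20 : 0 < r2 by rewrite divr_gt0.
have r10 : 0 < r1 by rewrite divr_gt0.
have half x : 0 < x -> x / 2 < x :> R by move=> x0'; rewrite ltr_pdivrMr // ltr_pMr // ltr1n.
have r12 : r1 < r2 by exact: half.
have Kimg : cube x0 r2 `<=` cmap c @` (cdom c `&` U).
  by move=> x /(cube_ball e0 (half e e0)) /eB.
pose S := cinv c @` cube x0 r2.
have cS : closed S.
  apply: compact_closed; first exact: m_hausdorff.
  apply: continuous_compact; last exact: cube_compact.
  apply: continuous_in_subspaceT => x; rewrite inE => /Kimg [q [cq Uq] <-].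
  exact: cinv_continuous.
have SU q : S q -> cdom c q /\ U q.
  by move=> [x /Kimg [q' [cq Uq] <-] <-]; rewrite cmapK.
pose f q : R := if `[< cdom c q >] then plateau x0 r1 r2 (cmap c q) else 0.
have fS q : ~ S q -> f q = 0.
  move=> nS; rewrite /f; case: asboolP => // cq.
  have [[j]|h] := pselect (exists j, r2 <= `|cmap c q 0 j - x0 0 j|); first exact: plateau_eq0.
  exfalso; apply: nS; exists (cmap c q); last by rewrite cmapK.
  apply/cubeE => j; rewrite leNgt; apply/negP => hj; apply: h; exists j; exact: ltW.
have fsm : rsmooth_on (cdom c `&` U) f.
  have oV : open (cdom c `&` U) by apply: openI => //; exact: cdom_open.
  apply: (rsmooth_chart ac oV (@subIsetl _ _ _)) => r.
  have oV' := cimg_sub_open c oU.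
  have C := Cr_on_sub (@subsetT _ (cmap c @` (cdom c `&` U))) (smooth_on_plateau x0 r1 r2 r).
  apply: (Cr_on_ext oV' _ C).
  by move=> x /cimgP [_ cx _ xE]; rewrite /f (asboolT cx) xE.
have [V [oV Vp Vf]] : exists V, [/\ open V, V p & forall q, V q -> [/\ cdom c q, U q & f q = 1]].
  have := plateau_eq1 x0 r10 r12; rewrite /prop_near1 nbhsE => -[B [oB Bx] B1].
  exists ((cdom c `&` cmap c @^-1` B) `&` U); split.
  - apply: openI => //; exact: preimg_chart_open.
  - by [].
  - by move=> q [[cq Bq] Uq]; split => //; rewrite /f asboolT //; exact: B1.
exists (fun q => (f q) +i* 0), V; split => //.
- by move=> q /Vf [].
- by move=> q /Vf [_ _ ->].
move=> a sa; apply: csmooth_local => q _.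
have [Sq|nSq] := pselect (S q).
  exists (cdom c `&` U); split; first exact: SU.
  have oW : open (cdom c `&` U) by apply: openI => //; exact: cdom_open.
  apply: (csmoothM oW); last exact: (csmooth_sub (@subIsetr _ _ _) sa).
  by apply/csmoothE; split; [exact: fsm|exact: rsmooth_cst].
exists (~` S); split => //.
have oS : open (~` S) by exact: closed_openC.
apply: (csmooth_ext oS _ (csmooth_cst _ 0)) => q' nS'.
by rewrite fS // mul0r.
Qed.

Section RestrictedChart.
Variables (c : @chart R M d) (p : M) (e : R).
Hypotheses (ac : atlas c) (cp : cdom c p) (e0 : 0 < e).
Hypothesis eB : ball (cmap c p) e `<=` cmap c @` cdom c.

Let rdom : set M := cdom c `&` cmap c @^-1` ball (cmap c p) e.

Let rimgE : cmap c @` rdom = ball (cmap c p) e.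
Proof.
apply/seteqP; split=> [_ [q [_ ?] <-] //|x Bx].
have [q cq qx] := eB Bx; exists q => //; split => //=; by rewrite qx.
Qed.

Let rdom_open : open rdom.
Proof. apply: preimg_chart_open; exact: ball_open. Qed.

Let rimg_open : open (cmap c @` rdom).
Proof. rewrite rimgE; exact: ball_open. Qed.

Definition restricted_chart : @chart R M d :=
  @Chart R M d rdom (cmap c) (cinv c) rdom_open rimg_open
    (fun q cq => cmapK cq.1) (fun q cq => cmap_continuous cq.1)
    (fun q cq => cinv_continuous cq.1).

(** Transition maps of the restriction are restrictions of those of c, so maximality of the atlas
    applies. *)
Lemma restricted_chart_atlas : atlas restricted_chart.
Proof.
apply: atlas_maximal => c' ac'; have [[sm1 hol1] [sm2 hol2]] := atlas_compatible ac ac'.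
have sub (m : M -> 'rV[R]_d) : m @` (cdom restricted_chart `&` cdom c') `<=` m @` (cdom c `&` cdom c').
  by move=> _ [q [[cq _] c'q] <-]; exists q.
split; split.
- by move=> r; exact: Cr_on_sub (sub _) (sm1 r).
- by move=> x v /sub; exact: hol1.
- by move=> r; exact: Cr_on_sub (sub _) (sm2 r).
- by move=> x v /sub; exact: hol2.
Qed.

(** A ball is convex: the contraction follows straight segments to the centre in the chart. *)
Lemma restricted_chart_contractible : @contractible R M (cdom restricted_chart).
Proof.
set x0 := cmap c p.
have inB x t : ball x0 e x -> 0 <= t <= 1 -> ball x0 e ((1 - t) *: x + t *: x0).
  move=> + /andP[t0 t1]; rewrite -ball_normE /ball_ /= => h.
  have -> : x0 - ((1 - t) *: x + t *: x0) = (1 - t) *: (x0 - x).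
    by rewrite scalerBr opprD addrCA [in RHS]addrC; congr (_ + _); rewrite scalerBl scale1r.
  rewrite normrZ ger0_norm ?subr_ge0 //; apply: le_lt_trans h.
  by rewrite ler_piMl // gerBl.
exists p, (fun z => cinv c ((1 - z.2) *: cmap c z.1 + z.2 *: x0)); split.
- by split => //=; exact: ballxx.
- apply: continuous_in_subspaceT => -[q t]; rewrite inE => -[[cq Bq] /=].
  rewrite in_itv /= => t01.
  have /eB [q' cq' q'E] := inB _ _ Bq t01.
  apply: (@continuous_comp _ _ _ (fun z : M * R => (1 - z.2) *: cmap c z.1 + z.2 *: x0) (cinv c)).
    apply: cvgD.
      apply: cvgZ.
        by apply: cvgB; [exact: cvg_cst|exact: cvg_snd].
      apply: (@continuous_comp _ _ _ fst (cmap c)); first exact: cvg_fst.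
      exact: cmap_continuous.
    by apply: cvgZr_tmp; exact: cvg_snd.
  by rewrite /= -q'E; exact: cinv_continuous.
- move=> q t [cq Bq] t01; have Bx := inB _ _ Bq t01.
  by have [? xE] := cimg_in (eB Bx); split => //=; rewrite xE.
- move=> q [cq _] /=; rewrite subr0 scale1r scale0r addr0 subrr scale0r scale1r add0r.
  by rewrite !cmapK.
Qed.

End RestrictedChart.

(** [is_karabegov_form] provides u and v only over charts with contractible domain, so each point
    needs such a chart around it. *)
Lemma contractible_chart p : exists z : @chart R M d,
  [/\ atlas z, cdom z p & @contractible R M (cdom z)].
Proof.
set c := chart_at p.
have cp : cdom c p := mem_chart_at p.
have : nbhs (cmap c p) (cmap c @` cdom c).
  by apply: open_nbhs_nbhs; split; [exact: cimg_open|exists p].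
move=> /nbhs_ballP [e e0 eB].
exists (restricted_chart eB); split.
- exact: (restricted_chart_atlas (atlas_chart_at p) eB).
- by split => //=; exact: ballxx.
- exact: (restricted_chart_contractible cp e0 eB).
Qed.

End Cutoff.

(** * Star products on open sets *)

Section Star.
Context {R : realType} {n : nat} {M : kaehlerManifold R n}.
Local Notation C := R[i].
Local Notation d := (n + n)%N.
Implicit Types (c : @chart R M d) (f g : M -> C) (a b : nat -> M -> C) (U : set M) (p q : M).
Implicit Type star : nat -> (M -> C) -> (M -> C) -> M -> C.

Section Multider.
Variables (m : nat) (U : set M) (D : 'I_m -> (M -> C) -> M -> C).

(** Whatever the single derivatives preserve, the iterated ones preserve. The binary version
    transports equality on an open set, the ternary one additivity. *)
Lemma multider_ind (N : nat) (P : (M -> C) -> Prop) (K : {ffun 'I_m -> 'I_N}) f :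
  (forall j h, P h -> P (D j h)) -> P f -> P (multider D K f).
Proof.
move=> PD Pf; rewrite /multider; elim: (enum _) => [|j s IH] //=.
by elim: (K j : nat) => [|i IHi] //=; exact: PD.
Qed.

Lemma multider_ind2 (N : nat) (P : (M -> C) -> (M -> C) -> Prop) (K : {ffun 'I_m -> 'I_N}) f g :
  (forall j h h', P h h' -> P (D j h) (D j h')) -> P f g -> P (multider D K f) (multider D K g).
Proof.
move=> PD Pf; rewrite /multider; elim: (enum _) => [|j s IH] //=.
by elim: (K j : nat) => [|i IHi] //=; exact: PD.
Qed.

Lemma multider_ind3 (N : nat) (P : (M -> C) -> (M -> C) -> (M -> C) -> Prop)
    (K : {ffun 'I_m -> 'I_N}) f g h :
  (forall j f' g' h', P f' g' h' -> P (D j f') (D j g') (D j h')) -> P f g h ->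
  P (multider D K f) (multider D K g) (multider D K h).
Proof.
move=> PD Pf; rewrite /multider; elim: (enum _) => [|j s IH] //=.
by elim: (K j : nat) => [|i IHi] //=; exact: PD.
Qed.

End Multider.

Definition star_bidiff star := forall r, bidifferential (star r).

Section BidiffOne.
Variable (B : (M -> C) -> (M -> C) -> M -> C).
Hypothesis bB : bidifferential B.

Lemma bidiff_ext U f f' g g' p : open U -> U p -> csmooth_on U f -> csmooth_on U g ->
  (forall q, U q -> f q = f' q) -> (forall q, U q -> g q = g' q) ->
  B f g p = B f' g' p.
Proof.
move=> oU Up sf sg ff gg.
have sf' := csmooth_ext oU ff sf; have sg' := csmooth_ext oU gg sg.
have cp := mem_chart_at p; have ac := atlas_chart_at p.
have [V [N [coef [oV Vp Vc _ E]]]] := bB ac cp.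
rewrite !E //; try by exists U.
have oW : open (U `&` V) by exact: openI.
have ext N' (K : {ffun 'I_d -> 'I_N'}) h h' : (forall q, U q -> h q = h' q) ->
    multider (pd (chart_at p)) K h p = multider (pd (chart_at p)) K h' p.
  move=> hh; pose P (h1 h2 : M -> C) := forall q, (U `&` V) q -> h1 q = h2 q.
  apply: (@multider_ind2 _ _ N' P K h h') => [j h1 h2 Ph q [Uq Vq]||//].
    by apply: (pd_ext j oW) => //; exact: Vc.
  by move=> q [Uq _]; exact: hh.
by apply: eq_bigr => K _; apply: eq_bigr => L _; rewrite (ext _ K f f') // (ext _ L g g').
Qed.

Lemma bidiff_smooth U f g : open U -> csmooth_on U f -> csmooth_on U g ->
  csmooth_on U (B f g).
Proof.
move=> oU sf sg; apply: csmooth_local => p Up.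
have cp := mem_chart_at p; have ac := atlas_chart_at p.
have [V [N [coef [oV Vp Vc sc E]]]] := bB ac cp.
have oW : open (U `&` V) by exact: openI.
have Wc : U `&` V `<=` cdom (chart_at p) by move=> q [_ /Vc].
exists (U `&` V); split => //.
have sm N' (K : {ffun 'I_d -> 'I_N'}) h : csmooth_on U h ->
    csmooth_on (U `&` V) (multider (pd (chart_at p)) K h).
  move=> sh; apply: (@multider_ind _ _ N' (csmooth_on (U `&` V)) K h) => [j h'|].
    exact: (csmooth_pd j oW Wc ac).
  exact: csmooth_sub sh.
have S : csmooth_on (U `&` V) (fun q => \sum_K \sum_L coef K L q *
    multider (pd (chart_at p)) K f q * multider (pd (chart_at p)) L g q).
  apply: (csmooth_sum _ oW) => K _; apply: (csmooth_sum _ oW) => L _.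
  apply: (csmoothM oW); last exact: sm.
  apply: (csmoothM oW); last exact: sm.
  exact: csmooth_sub (sc K L).
by apply: (csmooth_ext oW _ S) => q [Uq Vq]; rewrite E //; exists U.
Qed.

Lemma bidiff_addr U f g g' p : open U -> U p -> csmooth_on U f -> csmooth_on U g ->
  csmooth_on U g' -> B f (fun q => g q + g' q) p = B f g p + B f g' p.
Proof.
move=> oU Up sf sg sg'.
have cp := mem_chart_at p; have ac := atlas_chart_at p.
have [V [N [coef [oV Vp Vc _ E]]]] := bB ac cp.
have sgg := csmoothD oU sg sg'.
rewrite !E //; try by exists U.
have oW : open (U `&` V) by exact: openI.
have Wc : U `&` V `<=` cdom (chart_at p) by move=> q [_ /Vc].
have add N' (K : {ffun 'I_d -> 'I_N'}) :
    multider (pd (chart_at p)) K (fun q => g q + g' q) p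
    = multider (pd (chart_at p)) K g p + multider (pd (chart_at p)) K g' p.
  pose P (h1 h2 h3 : M -> C) := [/\ csmooth_on (U `&` V) h1, csmooth_on (U `&` V) h2 &
    forall q, (U `&` V) q -> h3 q = h1 q + h2 q].
  have [_ _ PE] : P (multider (pd (chart_at p)) K g) (multider (pd (chart_at p)) K g') 
     (multider (pd (chart_at p)) K (fun q => g q + g' q)).
    apply: (@multider_ind3 _ _ N' P).
      move=> j h1 h2 h3 [s1 s2 h]; split; [exact: (csmooth_pd j oW Wc ac)|exact: (csmooth_pd j oW Wc ac)|].
      move=> q Wq; rewrite -(pdD j Wq (Wc _ Wq) ac s1 s2).
      exact: (pd_ext j oW Wq (Wc _ Wq)).
    by split; [exact: csmooth_sub sg|exact: csmooth_sub sg'|].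
  by apply: PE; split.
rewrite -big_split; apply: eq_bigr => K _ /=; rewrite -big_split; apply: eq_bigr => L _ /=.
by rewrite add mulrDr.
Qed.

Lemma bidiff_op : bidifferential (fun f g => B g f).
Proof.
move=> c p ac cp; have [V [N [coef [oV Vp Vc sc E]]]] := bB ac cp.
exists V, N, (fun K L => coef L K); split => // q f g Vq sf sg.
rewrite E // exchange_big; apply: eq_bigr => K _; apply: eq_bigr => L _.
by rewrite mulrAC.
Qed.

Lemma bidiff_sumr U I (s : seq I) f (g : I -> M -> C) p : open U -> U p -> csmooth_on U f ->
  (forall i, csmooth_on U (g i)) ->
  B f (fun q => \sum_(i <- s) g i q) p = \sum_(i <- s) B f (g i) p.
Proof.
move=> oU Up sf sg; have s0 := csmooth_cst U (0 : C).
have B0 : B f (fun=> 0) p = 0.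
  apply: (@addrI _ (B f (fun=> 0) p)); rewrite addr0 -(bidiff_addr oU Up sf s0 s0).
  by apply/esym; apply: (@bidiff_ext U) => // q _; rewrite addr0.
elim: s => [|i s IH].
  rewrite big_nil -[RHS]B0; apply: (@bidiff_ext U) => //; last by move=> q _; rewrite big_nil.
  by apply: (csmooth_ext oU _ s0) => q _; rewrite big_nil.
have ss : csmooth_on U (fun q => \sum_(i <- s) g i q) by exact: csmooth_sum.
rewrite big_cons -IH -(bidiff_addr oU Up sf (sg i) ss); apply: (@bidiff_ext U) => //; last by move=> q _; rewrite big_cons.
by apply: (csmooth_ext oU _ (csmoothD oU (sg i) ss)) => q _; rewrite big_cons.
Qed.

Lemma bidiff_0r U f p : open U -> U p -> csmooth_on U f -> B f (fun=> 0) p = 0.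
Proof.
move=> oU Up sf; have := @bidiff_sumr U unit [::] f (fun _ _ => 0) p oU Up sf (fun _ => csmooth_cst U 0).
rewrite [RHS]big_nil => E; refine (etrans _ E).
apply: (bidiff_ext oU Up sf (csmooth_cst U 0)) => // q _.
by rewrite big_nil.
Qed.

End BidiffOne.

Definition opstar star : nat -> (M -> C) -> (M -> C) -> M -> C := fun r f g => star r g f.

Lemma fstar_op star a b r p : fstar (opstar star) a b r p = fstar star b a r p.
Proof.
(* The inner range depends on i. Over the square cut down by i + j <= r, the two sums can be
   exchanged. *)
have E (F : nat -> nat -> nat -> C) : \sum_(i < r.+1) \sum_(j < (r - i).+1) F (r - i - j)%N i j =
    \sum_(i < r.+1) \sum_(j < r.+1 | (i + j <= r)%N) F (r - i - j)%N i j.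
  apply: eq_bigr => i _; rewrite (big_ord_widen_cond r.+1 xpredT (fun j => F (r - i - j)%N i j)) ?ltnS ?leq_subr //.
  by apply: eq_bigl => j; rewrite ltnS leq_subRL // -ltnS.
rewrite /fstar (E (fun s i j => opstar star s (a i) (b j) p)) (E (fun s i j => star s (b i) (a j) p)).
rewrite (exchange_big_dep xpredT) //=; apply: eq_bigr => i _; apply: eq_big => j; first by rewrite addnC.
by rewrite -!subnDA addnC.
Qed.

Lemma fmulC a b r p : fmul a b r p = fmul b a r p.
Proof.
rewrite /fmul (reindex_inj rev_ord_inj) /=; apply: eq_bigr => i _.
by rewrite subSS mulrC subKn // -ltnS.
Qed.

Definition emb f : nat -> M -> C := fun r => if r is 0%N then f else fun=> 0.

Lemma emb_smooth U f : csmooth_on U f -> fsmooth_on U (emb f).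
Proof. by move=> sf [|r] //; exact: csmooth_cst. Qed.

Lemma fmul_emb f b r p : fmul (emb f) b r p = f p * b r p.
Proof.
rewrite /fmul big_ord_recl /= subn0 big1 ?addr0 // => i _.
by rewrite mul0r.
Qed.

Section Formal.
Variable star : nat -> (M -> C) -> (M -> C) -> M -> C.
Hypothesis bS : star_bidiff star.

Lemma fstar_smooth U a b : open U -> fsmooth_on U a -> fsmooth_on U b ->
  fsmooth_on U (fstar star a b).
Proof.
move=> oU sa sb r; apply: (csmooth_sum _ oU) => i _; apply: (csmooth_sum _ oU) => j _.
exact: bidiff_smooth.
Qed.

Lemma fstar_ext U a a' b b' r p : open U -> U p -> fsmooth_on U a -> fsmooth_on U b ->
  feq_on U a a' -> feq_on U b b' -> fstar star a b r p = fstar star a' b' r p.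
Proof.
move=> oU Up sa sb aa bb; apply: eq_bigr => i _; apply: eq_bigr => j _.
by apply: (@bidiff_ext _ _ U) => // q Uq; [exact: aa|exact: bb].
Qed.

Lemma fstar_addr U a b b' r p : open U -> U p -> fsmooth_on U a -> fsmooth_on U b ->
  fsmooth_on U b' ->
  fstar star a (fadd b b') r p = fstar star a b r p + fstar star a b' r p.
Proof.
move=> oU Up sa sb sb'; rewrite /fstar -big_split; apply: eq_bigr => i _ /=.
rewrite -big_split; apply: eq_bigr => j _ /=.
exact: (bidiff_addr _ oU).
Qed.

Lemma fstar_sumr U (I : Type) (s : seq I) a (b : I -> nat -> M -> C) r p : open U -> U p ->
  fsmooth_on U a -> (forall i, fsmooth_on U (b i)) ->
  fstar star a (fun r q => \sum_(i <- s) b i r q) r p = \sum_(i <- s) fstar star a (b i) r p.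
Proof.
move=> oU Up sa sb; rewrite /fstar exchange_big; apply: eq_bigr => i _ /=.
rewrite exchange_big; apply: eq_bigr => j _ /=.
by rewrite (bidiff_sumr _ _ oU) // => k; exact: sb.
Qed.

Lemma fstar_embl U f b r p : open U -> U p -> csmooth_on U f -> fsmooth_on U b ->
  fstar star (emb f) b r p = \sum_(j < r.+1) star (r - j)%N f (b j) p.
Proof.
move=> oU Up sf sb; rewrite /fstar big_ord_recl [X in _ + X]big1 => [|i _]; first by rewrite addr0 subn0.
(* The coefficients of [emb f] beyond the first are 0. Vanishing at 0 is known for the second
   argument, so the opposite product is taken to apply it to the first. *)
apply: big1 => j _; have -> : star = opstar (opstar star) by [].
exact: (bidiff_0r (bidiff_op (bS _)) oU Up (sb j)).
Qed.

End Formal.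

(* Stable under passing to the opposite product, unlike [star_product]. *)
Record formal_algebra star : Prop := FormalAlgebra {
  fa_bidiff : star_bidiff star;
  fa_star0 : forall f g, csmooth f -> csmooth g -> forall p, star 0%N f g p = f p * g p;
  fa_unit : forall a, fsmooth a -> feq_on setT (fstar star a (@fone R n M)) a;
  fa_assoc : forall a b e, fsmooth a -> fsmooth b -> fsmooth e ->
    feq_on setT (fstar star (fstar star a b) e) (fstar star a (fstar star b e)) }.

Lemma formal_algebra_star star : star_product star -> formal_algebra star.
Proof. by move=> [h1 h2 _ h4 h5]; split => // a sa; have [] := h4 a sa. Qed.

Lemma formal_algebra_op star : star_product star -> formal_algebra (opstar star).
Proof.
move=> [h1 h2 _ h4 h5]; split => [r|f g sf sg p|a sa r p _|a b e sa sb se r p _].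
- exact: bidiff_op.
- by rewrite /opstar h2 // mulrC.
- by rewrite fstar_op; have [h _] := h4 a sa; exact: h.
have eqr (x y : nat -> M -> C) : feq_on setT x y -> x = y.
  by move=> h; apply/funext => s; apply/funext => q; exact: h.
have E x y : fstar (opstar star) x y = fstar star y x.
  by apply: eqr => s q _; exact: fstar_op.
by rewrite !E; apply/esym; exact: h5.
Qed.

Section Algebra.
Variable star : nat -> (M -> C) -> (M -> C) -> M -> C.
Hypothesis fS : formal_algebra star.
Let bS := fa_bidiff fS.

(** V depends on U and p only, so that it serves all orders in nu and several series at once. *)
Lemma fcutoff U p : open U -> U p -> exists V, [/\ open V, V p, V `<=` U &
  forall a, fsmooth_on U a -> exists2 a', fsmooth a' & feq_on V a' a].
Proof.
move=> oU Up; have [chi [V [oV Vp VU chi1 sm]]] := csmooth_cutoff oU Up.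
exists V; split => // a sa; exists (fun r q => chi q * a r q); first by move=> r; exact: sm.
by move=> r q Vq; rewrite chi1 // mul1r.
Qed.

Lemma csmoothT U f : csmooth f -> csmooth_on U f.
Proof. by move=> sf; apply: csmooth_sub sf. Qed.

Lemma fsmoothT U a : fsmooth a -> fsmooth_on U a.
Proof. by move=> sa r; apply: csmoothT; exact: sa. Qed.

Lemma fsmooth_sub U V a : V `<=` U -> fsmooth_on U a -> fsmooth_on V a.
Proof. by move=> VU sa r; apply: (csmooth_sub VU); exact: sa. Qed.

Lemma star0_local U f g p : open U -> U p -> csmooth_on U f -> csmooth_on U g ->
  star 0%N f g p = f p * g p.
Proof.
move=> oU Up sf sg; have [chi [V [oV Vp VU chi1 sm]]] := csmooth_cutoff oU Up.
have Ef h q : V q -> h q = chi q * h q by move=> Vq; rewrite chi1 // mul1r.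
rewrite (@bidiff_ext _ (bS 0) V _ (fun q => chi q * f q) _ (fun q => chi q * g q) p) //.
- by rewrite (fa_star0 fS (sm _ sf) (sm _ sg)) chi1 // !mul1r.
- exact: csmooth_sub sf.
- exact: csmooth_sub sg.
- exact: Ef.
- exact: Ef.
Qed.

Lemma fassoc_local U a b e r p : open U -> U p -> fsmooth_on U a -> fsmooth_on U b ->
  fsmooth_on U e -> fstar star (fstar star a b) e r p = fstar star a (fstar star b e) r p.
Proof.
move=> oU Up sa sb se; have [V [oV Vp VU cut]] := fcutoff oU Up.
have [a' sa' aa] := cut a sa; have [b' sb' bb] := cut b sb; have [e' se' ee] := cut e se.
have sV x : fsmooth x -> fsmooth_on V x by exact: fsmoothT.
have E1 x y x' y' : fsmooth_on V x -> fsmooth_on V y -> feq_on V x x' -> feq_on V y y' ->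
    feq_on V (fstar star x y) (fstar star x' y').
  by move=> sx sy xx yy s q Vq; exact: (fstar_ext bS s oV).
have A : feq_on setT _ _ := fa_assoc fS sa' sb' se'; have := A r p I.
rewrite (fstar_ext bS r oV Vp (fstar_smooth bS oV (sV _ sa') (sV _ sb')) (sV _ se')
  (E1 _ _ _ _ (sV _ sa') (sV _ sb') aa bb) ee) => ->.
exact: (fstar_ext bS r oV Vp (sV _ sa') (fstar_smooth bS oV (sV _ sb') (sV _ se')) aa
  (E1 _ _ _ _ (sV _ sb') (sV _ se') bb ee)).
Qed.

Lemma star_one U f r p : open U -> U p -> csmooth_on U f -> (0 < r)%N ->
  star r f (fun=> 1) p = 0.
Proof.
move=> oU Up sf; case: r => // r _; have [V [oV Vp VU cut]] := fcutoff oU Up.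
have [a sa aa] := cut (emb f) (emb_smooth sf).
have E : @fone R n M = emb (fun=> 1 : C).
  by apply/funext => -[|s]; apply/funext => q.
have A : feq_on setT _ _ := fa_unit fS sa; have := A r.+1 p I; rewrite (aa r.+1 p Vp) /=.
have sV := csmooth_sub VU sf.
have s1 : csmooth_on V (fun=> 1 : C) by exact: csmooth_cst.
rewrite (fstar_ext bS r.+1 oV Vp (fsmoothT V sa) _ aa (fun _ _ _ => erefl)); last first.
  by rewrite E; exact: emb_smooth.
rewrite (fstar_embl bS r.+1 oV Vp sV); last by rewrite E; exact: emb_smooth.
rewrite big_ord_recl /= big1 ?addr0 // => i _.
by rewrite E /=; exact: (bidiff_0r (bS _) oV Vp sV).
Qed.

(** Only derivatives of type [~~ bt] reach g, and they vanish; hence C_r (f, g) = g C_r (f, 1) at p.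
    The terms without derivatives of g are thus controlled by the unit axiom, which gives C_r (f, 1)
    = 0 for r > 0. *)
Lemma star_hol (bt : bool) U c f g r p : open U -> U p -> csmooth_on U f -> csmooth_on U g ->
  atlas c -> U `<=` cdom c -> (0 < r)%N ->
  bidifferential_in (@Zd _ _ M bt) (@Zd _ _ M (~~ bt)) (star r) ->
  (forall l q, U q -> Zd (~~ bt) c l g q = 0) -> star r f g p = 0.
Proof.
move=> oU Up sf sg ac Uc r0 wS hol.
have [V [N [coef [oV Vp Vc _ E]]]] := wS c p ac (Uc p Up).
have E1 := star_one oU Up sf r0.
rewrite E // in E1; try by exists U => //; exact: csmooth_cst.
rewrite E //; try by exists U.
have oW : open (U `&` V) by exact: openI.
have Wc : U `&` V `<=` cdom c by move=> q [_ /Vc].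
(* Each term of the expression of [star r f g] is [g p] times the same term for [g = 1]. *)
have mE (K : {ffun 'I_n -> 'I_N}) : multider (Zd (~~ bt) c) K g p = g p * multider (Zd (~~ bt) c) K (fun=> 1) p.
  pose P (h1 h2 : M -> C) := (forall q, (U `&` V) q -> h1 q = g q /\ h2 q = 1) \/
    (forall q, (U `&` V) q -> h1 q = 0 /\ h2 q = 0).
  have [h|h] : P (multider (Zd (~~ bt) c) K g) (multider (Zd (~~ bt) c) K (fun=> 1)).
  - apply: (@multider_ind2 _ _ N P) => [j h1 h2 [h|h]|]; last by left.
    + right => q Wq; split.
        rewrite (@Zd_ext _ _ M (~~ bt) _ h1 g c j q oW Wq (Wc _ Wq)); last by move=> ? /h [].
        by apply: hol; case: Wq.
      by rewrite (@Zd_ext _ _ M (~~ bt) _ h2 (fun=> 1) c j q oW Wq (Wc _ Wq)) ?Zd_cst // => ? /h [].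
    + right => q Wq; split.
        by rewrite (@Zd_ext _ _ M (~~ bt) _ h1 (fun=> 0) c j q oW Wq (Wc _ Wq)) ?Zd_cst // => ? /h [].
      by rewrite (@Zd_ext _ _ M (~~ bt) _ h2 (fun=> 0) c j q oW Wq (Wc _ Wq)) ?Zd_cst // => ? /h [].
  - by have [-> ->] := h p (conj Up Vp); rewrite mulr1.
  - by have [-> ->] := h p (conj Up Vp); rewrite mulr0.
refine (etrans _ (etrans (congr1 (GRing.mul (g p)) E1) (mulr0 _))).
apply/esym; rewrite mulr_sumr; apply: eq_bigr => K _.
by rewrite mulr_sumr; apply: eq_bigr => L _; rewrite (mE L) mulrCA.
Qed.

Lemma fstar_hol (bt : bool) U c a b r p : open U -> U p -> fsmooth_on U a -> fsmooth_on U b ->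
  atlas c -> U `<=` cdom c ->
  (forall s, (0 < s)%N -> bidifferential_in (@Zd _ _ M bt) (@Zd _ _ M (~~ bt)) (star s)) ->
  (forall s l q, U q -> Zd (~~ bt) c l (b s) q = 0) ->
  fstar star a b r p = fmul a b r p.
Proof.
move=> oU Up sa sb ac Uc wS hol; apply: eq_bigr => i _.
rewrite big_ord_recr /= subnn (star0_local oU Up (sa i) (sb _)) big1 ?add0r // => j _.
apply: (star_hol oU Up (sa i) (sb j) ac Uc _ (wS _ _)); rewrite ?subn_gt0 //.
exact: hol.
Qed.

(* Order by order in nu, [z_k * b = z_k b] says that [{z_k, b_r} = 0]. *)
Lemma hol_of_star_coord (bt : bool) U c b :
  open U -> fsmooth_on U b -> atlas c -> U `<=` cdom c ->
  (forall s, (0 < s)%N -> bidifferential_in (@Zd _ _ M bt) (@Zd _ _ M (~~ bt)) (star s)) ->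
  (forall g p, U p -> csmooth_on U g -> (forall k, star 1%N (zc bt c k) g p = 0) ->
     forall l, Zd (~~ bt) c l g p = 0) ->
  (forall k r p, U p -> fstar star (emb (zc bt c k)) b r p = zc bt c k p * b r p) ->
  forall r l p, U p -> Zd (~~ bt) c l (b r) p = 0.
Proof.
move=> oU sb ac Uc wS pois h r; elim/ltn_ind: r => r IH l p Up.
have sz k : csmooth_on U (zc bt c k) by exact: (csmooth_sub Uc (csmooth_zc bt k ac)).
(* In order r + 1 the terms with b_i, i < r, vanish by induction, and the one with b_(r+1) is the
   product z_k b_(r+1); only C_1 (z_k, b_r) is left. *)
apply: pois => // k; have := h k r.+1 p Up.
rewrite (fstar_embl bS r.+1 oU Up (sz k) sb) !big_ord_recr /=.
rewrite big1 => [|i _]; last first.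
  apply: (star_hol oU Up (sz k) (sb i) ac Uc _ (wS _ _)); rewrite ?subn_gt0 ?ltnS ?(ltnW (ltn_ord i)) //.
  by move=> l' q Uq; exact: IH.
rewrite subnn (star0_local oU Up (sz k) (sb r.+1)) add0r subSnn => /eqP.
by rewrite -subr_eq0 addrK => /eqP.
Qed.

End Algebra.
End Star.

Opaque pd Zd sgi dzb dzc.

(** * The symplectic form as a nondegenerate form of type (1,1) *)

Section TypeOneOne.
Context {R : realType} {n : nat}.
Local Notation C := R[i].
Local Notation d := (n + n)%N.

Lemma dzb_row b (k : 'I_n) :
  dzb b k = row_mx (delta_mx 0 k) (- sgi b *: delta_mx 0 k) :> 'rV[C]_d.
Proof.
apply/rowP => j; rewrite -(splitK j); case: (fintype.split j) => i.
  by rewrite dzb_lshift row_mxEl mxE eqxx.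
by rewrite dzb_rshift row_mxEr !mxE eqxx mulNr.
Qed.

Lemma Icx_block : (Icx : 'M[C]_d) = block_mx 0 1%:M (- 1%:M) 0.
Proof. by rewrite /Icx /Imx map_block_mx !map_mx0 map_mxN map_mx1. Qed.

Lemma dzbI b (k : 'I_n) : dzb b k *m (Icx : 'M[C]_d)^T = - sgi b *: dzb b k.
Proof.
rewrite dzb_row Icx_block tr_block_mx mul_row_block scale_row_mx !trmx0 trmx1 raddfN /= trmx1.
rewrite !mulmx0 add0r addr0 mulmx1 mulmxN mulmx1; congr (row_mx _ _).
by rewrite scalerA mulrNN sgi2 scaleN1r.
Qed.

Lemma Icx2 : (Icx : 'M[C]_d) *m Icx = - 1%:M.
Proof.
rewrite Icx_block mulmx_block !mulmx0 !mul0mx !mul1mx !mulmx1 !addr0 !add0r.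
by rewrite (scalar_mx_block n n 1) opp_block_mx !oppr0.
Qed.

(* Two eigenvectors of the complex structure for the same eigenvalue are orthogonal for an
   invariant bilinear form, as the eigenvalues are +-i. *)
Lemma eigen_orth (N : 'M[C]_d) b (x y : 'rV[C]_d) : Icx^T *m N *m Icx = N ->
  x *m Icx^T = - sgi b *: x -> y *m Icx^T = - sgi b *: y -> x *m N *m y^T = 0.
Proof.
move=> NI xI yI.
have yI' : Icx *m y^T = - sgi b *: y^T by rewrite -[Icx]trmxK -trmx_mul yI linearZ.
have E : x *m N *m y^T = - (x *m N *m y^T).
  rewrite -[in LHS]NI !mulmxA xI -!mulmxA yI' -!scalemxAl -!scalemxAr scalerA mulrNN sgi2.
  by rewrite scaleN1r !mulmxA.
have E2 : (2 : C) *: (x *m N *m y^T) = 0.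
  by rewrite scaler_nat mulr2n {2}E subrr.
by move/eqP: E2; rewrite scaler_eq0 pnatr_eq0 /= => /eqP.
Qed.

Lemma dzb_col b k (u v : 'cV[C]_n) :
  (dzb b k *m col_mx u v) 0 0 = u k 0 - sgi b * v k 0.
Proof. by rewrite dzb_row mul_row_col -scalemxAl -!rowE !mxE mulNr. Qed.

Lemma dzb_total (y : 'cV[C]_d) : (forall b k, dzb b k *m y = 0) -> y = 0.
Proof.
move=> h; rewrite -(vsubmxK y).
have E b k : usubmx y k 0 - sgi b * dsubmx y k 0 = 0.
  by rewrite -dzb_col vsubmxK h mxE.
have D k : dsubmx y k 0 = 0.
  have S : sgi true = - sgi false :> C by rewrite -(sgiN false).
  have E1 := E true k; have E2 := E false k; rewrite S mulNr opprK in E1.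
  have /eqP : 2 * (sgi false * dsubmx y k 0) = 0 :> C.
    have -> : 2 * (sgi false * dsubmx y k 0) = (usubmx y k 0 + sgi false * dsubmx y k 0)
       - (usubmx y k 0 - sgi false * dsubmx y k 0) by ring.
    by rewrite E1 E2 subr0.
  rewrite !mulf_eq0 pnatr_eq0 /= => /orP[/eqP s0|/eqP //].
  by have /eqP := sgi2 (R := R) false; rewrite s0 mul0r eq_sym oppr_eq0 oner_eq0.
have U k : usubmx y k 0 = 0 by have := E true k; rewrite D mulr0 subr0.
by apply/colP => j; rewrite -(splitK j); case: (fintype.split j) => i;
  rewrite [LHS]mxE ?(unsplitK (inl i)) ?(unsplitK (inr i)) [RHS]mxE.
Qed.

End TypeOneOne.

Section Poisson.
Context {R : realType} {n : nat} {M : kaehlerManifold R n}.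
Local Notation C := R[i].
Local Notation d := (n + n)%N.
Implicit Types (c : @chart R M d) (f g : M -> C) (U : set M) (p q : M).

Definition pdrow c f p : 'rV[C]_d := \row_j pd c j f p.

Lemma pdrow_chain U f c c' p : open U -> U p -> cdom c p -> cdom c' p -> atlas c -> atlas c' ->
  csmooth_on U f -> pdrow c f p = pdrow c' f p *m (cjacobian c c' p)^T.
Proof.
move=> oU Up cp c'p ac ac' sf; apply/rowP => j; rewrite mxE.
rewrite (pd_chain j oU Up cp c'p ac ac' sf) mxE; apply: eq_bigr => i _.
by rewrite [X in _ = X * _]mxE [X in _ = _ * X]mxE mulrC.
Qed.

Lemma pdrow_Zd c f p :
  pdrow c f p = \sum_k (Zd false c k f p *: dzb false k + Zd true c k f p *: dzb true k).
Proof.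
apply/rowP => j; rewrite mxE pd_Zd summxE; apply: eq_bigr => k _.
by rewrite !dzcE [RHS]mxE; congr (_ + _); rewrite [RHS]mxE.
Qed.

Lemma pdrow_zc bt c k p : atlas c -> cdom c p -> pdrow c (zc bt c k) p = dzb bt k.
Proof. by move=> ac cp; apply/rowP => j; rewrite mxE pd_zc. Qed.

(** As I^2 = -1, inverting I omega I^T = omega produces two signs that cancel; the Poisson tensor is
    again invariant under the complex structure. *)
Lemma omegaC_I p : Icx^T *m invmx (omegaC p) *m Icx = invmx (omegaC (k := M) p).
Proof.
have uw : omegaC (k := M) p \in unitmx by rewrite map_unitmx omega_nondegenerate.
have wI : Icx *m omegaC (k := M) p *m Icx^T = omegaC p.
  by rewrite /Icx /omegaC matrix.map_trmx -!map_mxM omega_I.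
have IT2 : (Icx^T *m Icx^T : 'M[C]_d) = - 1%:M by rewrite -trmx_mul Icx2 raddfN /= trmx1.
have E : omegaC p *m (Icx^T *m invmx (omegaC p) *m Icx) = 1%:M.
  rewrite -{1}wI !mulmxA -[_ *m Icx^T *m Icx^T]mulmxA IT2 mulmxN mulmx1 mulNmx mulNmx mulmxK //.
  by rewrite Icx2 opprK.
by rewrite -[LHS](mulKmx uw) E mulmx1.
Qed.

(** N is the Poisson tensor in the chart c, and y b is the part of dg of type b. By invariance N
    pairs only opposite types: [y (~~ bt)] is orthogonal to the covectors of its own type, and its
    pairing with the other ones is the bracket with the coordinates, which is 0. As N is invertible,
    [y (~~ bt)] vanishes. *)
Lemma hol_of_poisson bt c U g p : atlas c -> open U -> U p -> U `<=` cdom c ->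
  csmooth_on U g -> (forall k, poisson (zc bt c k) g p = 0) ->
  forall l, Zd (~~ bt) c l g p = 0.
Proof.
move=> ac oU Up Uc sg h l; have cp := Uc p Up.
set ch := chart_at p; have chp : cdom ch p := mem_chart_at p.
have ach : atlas ch := atlas_chart_at p.
pose J := cjacobian ch c p; pose N := J^T *m invmx (omegaC p) *m J.
have uw : omegaC p \in unitmx by rewrite map_unitmx omega_nondegenerate.
have JV := cjacobian_mulV ach ac chp cp.
have [uJ _] := mulmx1_unit JV; rewrite -/J in uJ.
have uN : N \in unitmx by rewrite !unitmx_mul unitmx_tr uJ unitmx_inv uw.
have JI : Icx *m J = J *m Icx := cjacobian_I ach ac chp cp.
have NI : Icx^T *m N *m Icx = N.
  have IJT : Icx^T *m J^T = J^T *m Icx^T by rewrite -!trmx_mul JI.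
  rewrite /N !mulmxA IJT -!mulmxA -JI !mulmxA.
  by rewrite -(mulmxA J^T Icx^T) -(mulmxA J^T (Icx^T *m _)) omegaC_I.
have P f : csmooth_on U f -> dfun f p = pdrow c f p *m J^T.
  by move=> sf; exact: (pdrow_chain oU Up chp cp ach ac sf).
have E k : dzb bt k *m N *m (pdrow c g p)^T = 0.
  have sz : csmooth_on U (zc bt c k) by exact: (csmooth_sub Uc (csmooth_zc bt k ac)).
  have := h k; rewrite /poisson /vf_app /hamvf (P _ sz) pdrow_zc //.
  move/eqP; rewrite oppr_eq0 => /eqP E0.
  apply/matrixP => i j; rewrite !ord1 [RHS]mxE -E0.
  have -> : dzb bt k *m N *m (pdrow c g p)^T = dzb bt k *m J^T *m invmx (omegaC p) *m (dfun g p)^T.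
    by rewrite (P _ sg) trmx_mul trmxK /N !mulmxA.
  by rewrite mxE; apply: eq_bigr => m _; rewrite !mxE.
pose y b := \sum_k Zd b c k g p *: (dzb b k : 'rV[C]_d).
have yI b : y b *m Icx^T = - sgi b *: y b.
  rewrite mulmx_suml scaler_sumr; apply: eq_bigr => k _.
  by rewrite -scalemxAl dzbI !scalerA mulrC.
have yE : pdrow c g p = y bt + y (~~ bt).
  have -> : pdrow c g p = y false + y true by rewrite pdrow_Zd big_split.
  by case: (bt); [exact: addrC|exact: erefl].
have D b k : dzb b k *m (N *m (y (~~ bt))^T) = 0.
  rewrite mulmxA; have [->|] := eqVneq b (~~ bt); first exact: (eigen_orth NI (dzbI _ _) (yI _)).
  move=> bb; have -> : b = bt by case: (b) (bt) bb => [] [].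
  by have := E k; rewrite yE linearD mulmxDr (eigen_orth NI (dzbI _ _) (yI _)) add0r.
have y0 : y (~~ bt) = 0.
  by apply: trmx_inj; rewrite trmx0 -[LHS](mulKmx uN) (dzb_total D) mulmx0.
have /(congr1 (fun A : 'rV[C]_d => A 0 (lshift n l))) := y0.
rewrite summxE mxE (bigD1 l) //= big1 => [|k kl].
  by rewrite addr0 mxE dzb_lshift eqxx mulr1.
by rewrite mxE dzb_lshift eq_sym (negbTE kl) mulr0.
Qed.

End Poisson.

(** * Local solutions for products of Wick type *)

Section Wick.
Context {R : realType} {n : nat} {M : kaehlerManifold R n}.
Local Notation C := R[i].
Local Notation d := (n + n)%N.
Implicit Types (c : @chart R M d) (f g : M -> C) (a b : nat -> M -> C) (U : set M) (p q : M).
Implicit Type star : nat -> (M -> C) -> (M -> C) -> M -> C.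

(* [bt = false] for a star product of Wick type, [bt = true] for the opposite of one. *)
Record wick_algebra (bt : bool) star : Prop := WickAlgebra {
  wa_formal : formal_algebra star;
  wa_wick : forall s, (0 < s)%N ->
    bidifferential_in (@Zd _ _ M bt) (@Zd _ _ M (~~ bt)) (star s);
  wa_poisson : exists2 e : C, e != 0 & forall U f g p, open U -> U p -> csmooth_on U f ->
    csmooth_on U g -> star 1%N f g p - star 1%N g f p = e * poisson f g p }.

Lemma poisson_ext U f f' g g' p : open U -> U p ->
  (forall q, U q -> f q = f' q) -> (forall q, U q -> g q = g' q) ->
  poisson f g p = poisson f' g' p.
Proof.
move=> oU Up ff gg; have chp := mem_chart_at p.
have E : dfun f p = dfun f' p.
  by apply/rowP => j; rewrite [LHS]mxE [RHS]mxE; exact: (pd_ext j oU Up chp).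
rewrite /poisson /vf_app /hamvf E; congr (- _); apply: eq_bigr => j _; congr (_ * _).
exact: (pd_ext j oU Up chp).
Qed.

Lemma star1_poisson star U f g p : star_product star -> open U -> U p -> csmooth_on U f ->
  csmooth_on U g -> star 1%N f g p - star 1%N g f p = poisson f g p.
Proof.
move=> sP oU Up sf sg; have bS := fa_bidiff (formal_algebra_star sP).
have [_ _ P _ _] := sP.
have [chi [V [oV Vp VU chi1 sm]]] := csmooth_cutoff oU Up.
have Ef h q : V q -> h q = chi q * h q by move=> Vq; rewrite chi1 // mul1r.
have sf' := csmooth_sub VU sf; have sg' := csmooth_sub VU sg.
rewrite (bidiff_ext (bS 1%N) oV Vp sf' sg' (Ef f) (Ef g)).
rewrite (bidiff_ext (bS 1%N) oV Vp sg' sf' (Ef g) (Ef f)).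
by rewrite (P _ _ (sm _ sf) (sm _ sg)); apply: (poisson_ext oV Vp) => q Vq; rewrite -Ef.
Qed.

Lemma wick_algebra_star star : star_product star -> wick_type star -> wick_algebra false star.
Proof.
move=> sP wS; split; first exact: formal_algebra_star.
  move=> s s0; have := wS s s0; rewrite /wick_bidifferential.
  by rewrite -Zd_Zder -Zd_Zbarder.
exists 1; first exact: oner_neq0.
by move=> U f g p oU Up sf sg; rewrite mul1r; exact: (star1_poisson sP oU Up).
Qed.

Lemma wick_algebra_op star : star_product star -> wick_type star ->
  wick_algebra true (opstar star).
Proof.
move=> sP wS; split; first exact: formal_algebra_op.
  move=> s s0 c p ac cp; have [_ wS' _] := wick_algebra_star sP wS.
  have [V [N [coef [oV Vp Vc sc E]]]] := wS' s s0 c p ac cp.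
  exists V, N, (fun K L => coef L K); split => // q f g Vq sf sg.
  rewrite /opstar E // exchange_big; apply: eq_bigr => K _; apply: eq_bigr => L _.
  by rewrite mulrAC.
exists (-1); first by rewrite oppr_eq0 oner_neq0.
move=> U f g p oU Up sf sg; rewrite mulN1r -(star1_poisson sP oU Up sf sg).
by rewrite opprB.
Qed.

Lemma wick_hol_on bt star c U b : wick_algebra bt star -> atlas c -> open U ->
  U `<=` cdom c -> fsmooth_on U b ->
  (forall k r p, U p -> fstar star (emb (zc bt c k)) b r p = zc bt c k p * b r p) ->
  forall r l p, U p -> Zd (~~ bt) c l (b r) p = 0.
Proof.
move=> wa ac oU Uc sb; have fS := wa_formal wa.
apply: (hol_of_star_coord fS oU sb ac Uc (wa_wick wa)) => g p Up sg h.
have [e e0 P] := wa_poisson wa.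
apply: (hol_of_poisson ac oU Up Uc sg) => k.
have sz : csmooth_on U (zc bt c k) := csmooth_sub Uc (csmooth_zc bt k ac).
have E : star 1%N g (zc bt c k) p = 0.
  apply: (star_hol fS oU Up sg sz ac Uc (ltn0Sn 0) (wa_wick wa (ltn0Sn 0))) => l q Uq.
  by rewrite (Zd_zc _ _ _ _ ac (Uc _ Uq)); case: (bt); rewrite andbF.
have /eqP := P U (zc bt c k) g p oU Up sz sg.
by rewrite h E subrr eq_sym mulf_eq0 (negbTE e0) => /eqP.
Qed.

Section Half.
Variables (bt : bool) (star : nat -> (M -> C) -> (M -> C) -> M -> C).
Hypothesis wa : wick_algebra bt star.
Let fS := wa_formal wa.
Let bS := fa_bidiff fS.
Variable c : @chart R M d.
Hypothesis ac : atlas c.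
Let U := cdom c.
Let oU : open U := @cdom_open _ _ _ c.
Let Uc : U `<=` cdom c := @subset_refl _ U.

Lemma wick_hol b : fsmooth_on U b ->
  (forall k r p, U p -> fstar star (emb (zc bt c k)) b r p = zc bt c k p * b r p) ->
  forall r l p, U p -> Zd (~~ bt) c l (b r) p = 0.
Proof. exact: (wick_hol_on wa ac oU Uc). Qed.

Lemma wick_fstar_hol a b r p : U p -> fsmooth_on U a -> fsmooth_on U b ->
  (forall s l q, U q -> Zd (~~ bt) c l (b s) q = 0) ->
  fstar star a b r p = fmul a b r p.
Proof.
by move=> Up sa sb h; exact: (@fstar_hol _ _ _ _ fS bt U c a b r p oU Up sa sb ac Uc (wa_wick wa) h).
Qed.

Lemma emb_hol f : (forall l q, U q -> Zd (~~ bt) c l f q = 0) ->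
  forall s l q, U q -> Zd (~~ bt) c l (emb f s) q = 0.
Proof. by move=> h [|s] l q Uq /=; [exact: h|rewrite Zd_cst]. Qed.

Variables (u : 'I_n -> nat -> M -> C) (x : 'I_n -> M -> C).
Hypothesis su : forall k, fsmooth_on U (u k).
Hypothesis uP : forall k a, fsmooth_on U a -> feq_on U (fstar star a (u k))
  (fadd (fmul a (u k)) (fnu (Defs.fmap (Zd bt c k) a))).
Hypothesis sx : forall k, csmooth_on U (x k).
Hypothesis xhol : forall k l q, U q -> Zd (~~ bt) c l (x k) q = 0.

(** For bt = false, u and x will be Karabegov's u_k and the components of X on the Z_k; for bt =
    true, the v_l and minus the components on the Zbar_l. The product of x k and u k is the star
    product, which associativity can handle, and not the pointwise one. *)
Let T : nat -> M -> C := fun r q => \sum_k fstar star (emb (x k)) (u k) r q.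

Let sex k : fsmooth_on U (emb (x k)).
Proof. exact: emb_smooth. Qed.

Let sTk k : fsmooth_on U (fstar star (emb (x k)) (u k)).
Proof. exact: fstar_smooth. Qed.

Let sT : fsmooth_on U T.
Proof. by move=> r; apply: (csmooth_sum _ oU) => k _; exact: sTk. Qed.

Let Tk k r q : U q -> fstar star (emb (x k)) (u k) r q =
  x k q * u k r q + fnu (Defs.fmap (Zd bt c k) (emb (x k))) r q.
Proof.
by move=> Uq; have -> := @uP k (emb (x k)) (sex k) r q Uq; rewrite /fadd fmul_emb.
Qed.

(** Since x_k is holomorphic, a * (x_k * u_k) = (a x_k) * u_k = a x_k u_k + nu Z_k (a x_k). The part
    nu a Z_k x_k belongs to a T, because x_k * u_k = x_k u_k + nu Z_k x_k; what remains is nu x_k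
    Z_k a. *)
Lemma fstar_momentum a r q : U q -> fsmooth_on U a ->
  fstar star a T r q = fmul a T r q + fnu (fun r q => \sum_k x k q * Zd bt c k (a r) q) r q.
Proof.
move=> Uq sa.
have -> : fmul a T r q = \sum_k fmul a (fstar star (emb (x k)) (u k)) r q.
  rewrite /fmul exchange_big /=; apply: eq_bigr => i _.
  by rewrite mulr_sumr.
have -> : fnu (fun r q => \sum_k x k q * Zd bt c k (a r) q) r q =
    \sum_k fnu (fun r q => x k q * Zd bt c k (a r) q) r q.
  by case: r => [|r] //=; rewrite big1.
rewrite (fstar_sumr bS _ r oU Uq sa sTk) -big_split; apply: eq_bigr => k _ /=.
rewrite -(fassoc_local fS r oU Uq sa (sex k) (su k)).
pose ax : nat -> M -> C := fun r q => x k q * a r q.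
have sax : fsmooth_on U ax by move=> s; exact: csmoothM.
have Eax : feq_on U (fstar star a (emb (x k))) ax.
  move=> s q' Uq'; rewrite (wick_fstar_hol s Uq' sa (sex k)); first exact: (etrans (fmulC _ _ _ _) (fmul_emb _ _ _ _)).
  by apply: emb_hol => l q'' Uq''; exact: xhol.
rewrite (fstar_ext bS r oU Uq (fstar_smooth bS oU sa (sex k)) (su k) Eax (fun _ _ _ => erefl)).
have -> := @uP k ax sax r q Uq; rewrite /fadd.
have -> : fmul ax (u k) r q = \sum_(i < r.+1) a i q * (x k q * u k (r - i)%N q).
  by apply: eq_bigr => i _; rewrite /ax mulrAC mulrC mulrA.
have -> : fmul a (fstar star (emb (x k)) (u k)) r q =
   \sum_(i < r.+1) a i q * (x k q * u k (r - i)%N q) +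
   \sum_(i < r.+1) a i q * fnu (Defs.fmap (Zd bt c k) (emb (x k))) (r - i)%N q.
  by rewrite -big_split; apply: eq_bigr => i _; rewrite Tk //= mulrDr.
rewrite -addrA; congr (_ + _).
case: r => [|r] /=; first by rewrite big_ord1 /= mulr0 addr0.
(* The series nu Z_k x_k lives in order 1 only, so that of the sum over i the term i = r alone
   survives. *)
rewrite !big_ord_recr /= subnn subSnn /= mulr0 addr0 big1 => [|i _]; last first.
  rewrite subSn ?(ltnW (ltn_ord i)) //= /Defs.fmap.
  by case E : (r - i)%N => [|s] /=; [move: (ltn_ord i); rewrite -subn_gt0 E|rewrite Zd_cst mulr0].
rewrite add0r /Defs.fmap /= (ZdM bt k oU Uq Uq ac (sx k) (sa r)).
by rewrite addrC; congr (_ + _); rewrite mulrC.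
Qed.

(** The factor x_k is constant for derivatives of type [~~ bt], and these kill the correction nu Z_k
    x_k since derivatives of the two types commute. *)
Lemma Zd_momentum r l q : U q ->
  Zd (~~ bt) c l (T r) q = \sum_k x k q * Zd (~~ bt) c l (u k r) q.
Proof.
move=> Uq; rewrite (Zd_sum (~~ bt) _ l oU Uq Uq ac); last by move=> k _; exact: sTk.
apply: eq_bigr => k _.
have sE : csmooth_on U (fnu (Defs.fmap (Zd bt c k) (emb (x k))) r).
  case: r => [|r] /=; first exact: csmooth_cst.
  by apply: (csmooth_Zd bt k oU Uc ac); exact: sex.
rewrite (@Zd_ext _ _ M (~~ bt) U _ (fun q => x k q * u k r q + fnu (Defs.fmap (Zd bt c k) (emb (x k))) r q) c l q oU Uq Uq) //;
  last by move=> q' Uq'; exact: Tk.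
rewrite (ZdD (~~ bt) l Uq Uq ac (csmoothM oU (sx k) (su k r)) sE).
rewrite (ZdM (~~ bt) l oU Uq Uq ac (sx k) (su k r)) xhol // mul0r addr0.
suff -> : Zd (~~ bt) c l (fnu (Defs.fmap (Zd bt c k) (emb (x k))) r) q = 0 by rewrite addr0.
case: r sE => [|r] _ /=; first by rewrite Zd_cst.
rewrite /Defs.fmap (Zd_comm (~~ bt) bt l k oU Uc Uq ac (sex k r)).
rewrite (@Zd_ext _ _ M bt U _ (fun=> 0) c k q oU Uq Uq) ?Zd_cst //.
by apply: emb_hol => l' q' Uq'; exact: xhol.
Qed.

Variable J : nat -> M -> C.
Hypothesis sJ : fsmooth_on U J.

Let JT : nat -> M -> C := fun r q => J r q - T r q.

Let sJT : fsmooth_on U JT.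
Proof. by move=> r; apply: (csmoothD oU (sJ r)); apply: (csmoothN oU); exact: sT. Qed.

Let J_split : feq_on U J (fadd JT T).
Proof. by move=> r q _; rewrite /fadd subrK. Qed.

Let fstarJ a r q : U q -> fsmooth_on U a ->
  fstar star a J r q = fstar star a JT r q + fstar star a T r q.
Proof.
move=> Uq sa; rewrite (fstar_ext bS r oU Uq sa sJ (fun _ _ _ => erefl) J_split).
exact: (fstar_addr bS r oU Uq sa sJT sT).
Qed.

Let ZdJ r l q : U q ->
  Zd (~~ bt) c l (J r) q = Zd (~~ bt) c l (JT r) q + \sum_k x k q * Zd (~~ bt) c l (u k r) q.
Proof.
move=> Uq; rewrite -Zd_momentum // -(ZdD (~~ bt) l Uq Uq ac (sJT r) (sT r)).
by apply: (Zd_ext (~~ bt) l oU Uq Uq) => q' Uq'; exact: J_split.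
Qed.

(** Coordinates are enough as test functions: subtracting the equation for T leaves z_k * (J - T) =
    z_k (J - T) for all k, which makes J - T holomorphic, and [Zd_momentum] gives the derivatives of
    T. *)
Lemma Zd_of_star_coord :
  (forall k r q, U q -> fstar star (emb (zc bt c k)) J r q =
     zc bt c k q * J r q + fnu (emb (x k)) r q) ->
  forall r l q, U q -> Zd (~~ bt) c l (J r) q = \sum_k x k q * Zd (~~ bt) c l (u k r) q.
Proof.
move=> h r l q Uq; rewrite ZdJ // [X in X + _]wick_hol ?add0r //.
move=> k s q' Uq'; have sz : fsmooth_on U (emb (zc bt c k)) by apply: emb_smooth; exact: csmooth_zc.
apply: (@addIr _ (fstar star (emb (zc bt c k)) T s q')).
rewrite -fstarJ // h // fstar_momentum // fmul_emb addrA -mulrDr; congr (_ + _).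
  by congr (_ * _); exact: J_split.
case: s => [|s] //=; rewrite (bigD1 k) //= big1 => [|k' kk].
  case: s => [|s] /=; first by rewrite Zd_zc // !eqxx /= mulr1 addr0.
  by rewrite Zd_cst mulr0 addr0.
case: s => [|s] /=; first by rewrite Zd_zc // (negbTE kk) /= mulr0.
by rewrite Zd_cst mulr0.
Qed.

(** The hypothesis says that J - T is holomorphic; then a * (J - T) is the pointwise product, and
    the correction of order nu comes from T alone. *)
Lemma fstar_of_Zd :
  (forall r l q, U q -> Zd (~~ bt) c l (J r) q = \sum_k x k q * Zd (~~ bt) c l (u k r) q) ->
  forall a r q, U q -> fsmooth_on U a -> fstar star a J r q =
    fmul a J r q + fnu (fun r q => \sum_k x k q * Zd bt c k (a r) q) r q.
Proof.
move=> h a r q Uq sa; rewrite fstarJ // fstar_momentum // addrA; congr (_ + _).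
rewrite wick_fstar_hol // => [|s l q' Uq']; last first.
  by apply: (@addIr _ (\sum_k x k q' * Zd (~~ bt) c l (u k s) q')); rewrite -ZdJ // h // add0r.
rewrite -big_split; apply: eq_bigr => i _ /=.
by rewrite -mulrDr; congr (_ * _); apply/esym; exact: J_split.
Qed.

End Half.
End Wick.

(** * Quantum Hamiltonians and the equation dJ = i_X K in a chart *)

Section Quantum.
Context {R : realType} {n : nat} {M : kaehlerManifold R n}.
Local Notation C := R[i].
Local Notation d := (n + n)%N.
Implicit Types (c z : @chart R M d) (f g : M -> C) (a : nat -> M -> C) (U : set M) (p q : M).
Implicit Types (X : M -> 'rV[C]_d).

Definition zcomp b z X k : M -> C := fun q => dotz b (vf_in z X q 0) k.

(** Complex-valued fields have independent parts of types (1,0) and (0,1), so both conditions are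
    imposed: the components on the Z_k are holomorphic, those on the Zbar_k antiholomorphic. *)
Definition holomorphic_field X := forall z, atlas z -> forall b k,
  csmooth_on (cdom z) (zcomp b z X k) /\
  forall l q, cdom z q -> Zd (~~ b) z l (zcomp b z X k) q = 0.

Lemma vf_app_pdrow X f p : vf_app X f p = (X p *m (pdrow (chart_at p) f p)^T) 0 0.
Proof.
rewrite mxE /vf_app; apply: eq_bigr => j _; congr (_ * _).
by rewrite [RHS]mxE [RHS]mxE.
Qed.

Lemma vf_app_pd X z U f p : atlas z -> open U -> U p -> cdom z p -> csmooth_on U f ->
  vf_app X f p = \sum_j vf_in z X p 0 j * pd z j f p.
Proof.
move=> az oU Up zp sf; have chp := mem_chart_at p; have ach := atlas_chart_at p.
rewrite vf_app_pdrow (pdrow_chain oU Up chp zp ach az sf) trmx_mul trmxK mulmxA mxE.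
by apply: eq_bigr => j _; congr (_ * _); rewrite [LHS]mxE [LHS]mxE.
Qed.

Lemma vf_app_chart X z U f p : atlas z -> open U -> U p -> cdom z p -> csmooth_on U f ->
  vf_app X f p = \sum_k (zcomp false z X k p * Zd false z k f p + zcomp true z X k p * Zd true z k f p).
Proof.
move=> az oU Up zp sf; rewrite (vf_app_pd X az oU Up zp sf).
exact: sum_pd_Zd.
Qed.

(** The coefficient of the covector y at [dzb b k] in the basis of the dz^k and dzbar^k. *)
Definition dzco b (k : 'I_n) (y : 'rV[C]_d) : C :=
  2^-1 * (y 0 (lshift n k) + sgi b * y 0 (rshift n k)).

Lemma dzco_pdrow b k z f p : dzco b k (pdrow z f p) = Zd b z k f p.
Proof. by rewrite /dzco ZdE [pdrow _ _ _ _ _]mxE [pdrow _ _ _ _ _]mxE. Qed.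

Lemma dzcoD b k x y : dzco b k (x + y) = dzco b k x + dzco b k y.
Proof. by rewrite /dzco mxE [(x + y) 0 (rshift n k)]mxE [sgi b * _]mulrDr addrACA mulrDr. Qed.

Lemma dzcoZ b k (s : C) x : dzco b k (s *: x) = s * dzco b k x.
Proof.
rewrite /dzco mxE [(s *: x) 0 (rshift n k)]mxE.
by rewrite [sgi b * (s * _)]mulrCA -mulrDr mulrCA.
Qed.

Lemma dzco0 b k : dzco b k 0 = 0.
Proof. by rewrite -(scale0r (0 : 'rV[C]_d)) dzcoZ mul0r. Qed.

Lemma dzco_sum b k (I : Type) (s : seq I) (P : pred I) (x : I -> 'rV[C]_d) :
  dzco b k (\sum_(i <- s | P i) x i) = \sum_(i <- s | P i) dzco b k (x i).
Proof.
elim: s => [|i s IH]; first by rewrite !big_nil dzco0.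
by rewrite !big_cons; case: (P i) => //; rewrite dzcoD IH.
Qed.

Lemma dzco_dzb b b' k l : dzco b k (dzb b' l) = ((k == l) && (b == b'))%:R.
Proof.
rewrite /dzco dzb_lshift dzb_rshift mulrN mulrA.
have [->|nb] := eqVneq b b'.
  by rewrite sgi2 mulN1r opprK mulrDr -mulrDl half2 mul1r andbT.
have -> : b' = ~~ b by case: (b) (b') nb => [] [].
by rewrite sgiN mulrN sgi2 opprK mul1r subrr mulr0 andbF.
Qed.

Lemma dzco_inj x y : (forall b k, dzco b k x = dzco b k y) -> x = y.
Proof.
have E (w : 'rV[C]_d) : (forall b k, dzco b k w = 0) -> w = 0.
  move=> h; apply/rowP => j; rewrite [RHS]mxE -(splitK j); case: (fintype.split j) => i.
    by rewrite -[LHS](half_sum _ (w 0 (rshift n i))) -!/(dzco _ i w) !h addr0.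
  by rewrite -[LHS](half_diff (w 0 (lshift n i))) -!/(dzco _ i w) !h !mul0r addr0.
move=> h; apply/eqP; rewrite -subr_eq0; apply/eqP; apply: E => b k.
by rewrite -scaleN1r dzcoD dzcoZ h mulN1r subrr.
Qed.

Lemma mulmx_wedge (x al be : 'rV[C]_d) :
  x *m wedge al be = (x *m al^T) 0 0 *: be - (x *m be^T) 0 0 *: al.
Proof.
rewrite /wedge mulmxBr !mulmxA; congr (_ - _).
  by rewrite {1}[x *m al^T]mx11_scalar mul_scalar_mx.
by rewrite {1}[x *m be^T]mx11_scalar mul_scalar_mx.
Qed.

Lemma zcomp_mulmx b z X k p : (vf_in z X p *m (dzb b k)^T) 0 0 = zcomp b z X k p.
Proof.
rewrite mxE /zcomp /dotz; apply: eq_bigr => j _; congr (_ * _).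
by rewrite mxE dzcE.
Qed.

Lemma zcomp_wedge b1 b2 i j z X p : vf_in z X p *m wedge (dzb b1 j) (dzb b2 i) =
  zcomp b1 z X j p *: dzb b2 i - zcomp b2 z X i p *: dzb b1 j.
Proof. by rewrite mulmx_wedge; congr (_ *: _ - _ *: _); exact: zcomp_mulmx. Qed.

Lemma sum_pick (x y : 'I_n -> C) b k :
  \sum_j (x j * ((j == k) && (false == b))%:R + y j * ((j == k) && (true == b))%:R)
  = if b then y k else x k.
Proof.
rewrite (bigD1 k) //= big1 => [|j jk].
  by rewrite eqxx addr0; case: b; rewrite /= mulr0 mulr1 ?addr0 ?add0r.
by rewrite (negbTE jk) /= !mulr0 addr0.
Qed.

Lemma vf_app_zc b z X k q : atlas z -> cdom z q -> vf_app X (zc b z k) q = zcomp b z X k q.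
Proof.
move=> az zq; have oz := @cdom_open _ _ _ z.
rewrite (vf_app_chart X az oz zq zq (csmooth_zc b k az)).
transitivity (\sum_j (zcomp false z X j q * ((j == k) && (false == b))%:R
  + zcomp true z X j q * ((j == k) && (true == b))%:R)); last by rewrite sum_pick; case: (b).
by apply: eq_bigr => j _; congr (_ * _ + _ * _); exact: Zd_zc.
Qed.

Lemma vf_app0 X q : vf_app X (fun=> 0) q = 0.
Proof. by rewrite /vf_app big1 // => j _; rewrite pd_cst mulr0. Qed.

Lemma vf_app_ext X U f g p : open U -> U p -> (forall q, U q -> f q = g q) ->
  vf_app X f p = vf_app X g p.
Proof.
move=> oU Up fg; apply: eq_bigr => j _; congr (_ * _).
exact: (pd_ext j oU Up (mem_chart_at p)).
Qed.

Opaque dzco zcomp zc vf_app.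

Lemma sum_pick_l (F : 'I_n -> 'I_n -> C) (x y : 'I_n -> C) m :
  \sum_i \sum_j F i j * (x j * ((m == i) && true)%:R - y i * ((m == j) && false)%:R)
  = \sum_j F m j * x j.
Proof.
rewrite (bigD1 m) //= [X in _ + X]big1 ?addr0 => [|i im].
  by apply: eq_bigr => j _; rewrite eqxx andbF mulr1 mulr0 subr0.
by apply: big1 => j _; rewrite eq_sym (negbTE im) andbF !mulr0 subrr mulr0.
Qed.

Lemma sum_pick_r (F : 'I_n -> 'I_n -> C) (x y : 'I_n -> C) m :
  \sum_i \sum_j F i j * (x j * ((m == i) && false)%:R - y i * ((m == j) && true)%:R)
  = - \sum_i F i m * y i.
Proof.
rewrite -sumrN; apply: eq_bigr => i _; rewrite (bigD1 m) //= big1 => [|j jm].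
  by rewrite eqxx andbF mulr0 sub0r mulr1 mulrN addr0.
by rewrite andbF mulr0 sub0r eq_sym (negbTE jm) mulr0 oppr0 mulr0.
Qed.

(** Covers [dbar_10] (b1 = true) and [del_01] (b1 = false) at once. The sign appears when the vector
    is contracted with the second factor of the wedge product. *)
Lemma dzco_wedge b m z X p (F : 'I_n -> 'I_n -> C) (b1 : bool) :
  dzco b m (vf_in z X p *m (\sum_i \sum_j F i j *: wedge (dzb b1 j) (dzb (~~ b1) i))) =
  if b == b1 then - \sum_i F i m * zcomp (~~ b1) z X i p else \sum_j F m j * zcomp b1 z X j p.
Proof.
have -> : dzco b m (vf_in z X p *m (\sum_i \sum_j F i j *: wedge (dzb b1 j) (dzb (~~ b1) i))) =
   \sum_i \sum_j F i j * (zcomp b1 z X j p * ((m == i) && (b == ~~ b1))%:R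
       - zcomp (~~ b1) z X i p * ((m == j) && (b == b1))%:R).
  rewrite mulmx_sumr dzco_sum; apply: eq_bigr => i _.
  rewrite mulmx_sumr dzco_sum; apply: eq_bigr => j _.
  rewrite -scalemxAr dzcoZ zcomp_wedge; congr (_ * _).
  rewrite -scaleN1r dzcoD !dzcoZ mulN1r.
  by congr (_ * _ - _ * _); exact: dzco_dzb.
have [bb|nb] := eqVneq b b1.
  by rewrite bb (_ : (b1 == ~~ b1) = false) ?sum_pick_r //; case: (b1).
by rewrite (_ : (b == ~~ b1) = true) ?sum_pick_l //; case: (b) (b1) nb => [] [].
Qed.

Lemma mulmx_change_frame (x : 'rV[C]_d) (w A B : 'M[C]_d) : A *m B = 1%:M ->
  x *m A *m (B *m w *m B^T) = x *m w *m B^T.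
Proof. by move=> AB; rewrite !mulmxA -(mulmxA x) AB mulmx1. Qed.

Lemma mulmxr_tr_inj (x y : 'rV[C]_d) (A B : 'M[C]_d) : A *m B = 1%:M ->
  x = y <-> x *m B^T = y *m B^T.
Proof.
move=> AB; split=> [-> //|] /(congr1 (mulmx^~ A^T)).
by rewrite -!mulmxA -trmx_mul AB trmx1 !mulmx1.
Qed.

Lemma dfun_iprod_chart X (w : M -> 'M[C]_d) z U f p : atlas z -> open U -> U p -> cdom z p ->
  csmooth_on U f ->
  dfun f p = iprod X w p <-> pdrow z f p = vf_in z X p *m form2_in z w p.
Proof.
move=> az oU Up zp sf; have chp := mem_chart_at p; have ach := atlas_chart_at p.
have V := cjacobian_mulV ach az chp zp; have V' := cjacobian_mulV az ach zp chp.
have E : vf_in z X p *m form2_in z w p = iprod X w p *m (cjacobian z (chart_at p) p)^T.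
  exact: (mulmx_change_frame _ _ V).
rewrite E (pdrow_chain oU Up zp chp az ach sf).
exact: (mulmxr_tr_inj _ _ V).
Qed.

(** The (0,1) part of i_X K is read off from dbar (-u_k dz^k) and the (1,0) part from del (v_l
    dzbar^l), so that each condition has the form required in one of the two algebras. In the first,
    the sign of -u_k cancels that of the contraction; in the second the sign stays and is absorbed
    into the components, as the opposite product demands. *)
Lemma iprod_karabegov X z U (w : M -> 'M[C]_d) (u v : 'I_n -> M -> C) f p :
  atlas z -> open U -> U p -> cdom z p -> csmooth_on U f -> (forall k, csmooth_on U (u k)) ->
  form2_in z w p = dbar_10 z (fun k q => - u k q) p -> form2_in z w p = del_01 z v p ->
  dfun f p = iprod X w p <->
  (forall l, Zd true z l f p = \sum_k zcomp false z X k p * Zd true z l (u k) p) /\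
  (forall k, Zd false z k f p = \sum_l (- zcomp true z X l p) * Zd false z k (v l) p).
Proof.
move=> az oU Up zp sf su wu wv; rewrite (dfun_iprod_chart X w az oU Up zp sf).
have Eu l : dzco true l (vf_in z X p *m form2_in z w p) =
    \sum_k zcomp false z X k p * Zd true z l (u k) p.
  rewrite wu /dbar_10 -dzb_dz -dzb_dzbar -Zd_Zbarder.
  rewrite (dzco_wedge true l z X p (fun i j => Zd true z j (fun q => - u i q) p) true) /=.
  rewrite -sumrN; apply: eq_bigr => k _.
  have -> : Zd true z l (fun q => - u k q) p = - Zd true z l (u k) p.
    rewrite -mulN1r -(Zd_cstM true l _ oU Up zp az (su k)).
    by apply: (Zd_ext true l oU Up zp) => q _; rewrite mulN1r.
  by rewrite mulNr opprK mulrC.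
have Ev k : dzco false k (vf_in z X p *m form2_in z w p) =
    \sum_l (- zcomp true z X l p) * Zd false z k (v l) p.
  rewrite wv /del_01 -dzb_dz -dzb_dzbar -Zd_Zder.
  rewrite (dzco_wedge false k z X p (fun i j => Zd false z j (v i) p) false) /=.
  by rewrite -sumrN; apply: eq_bigr => l _; rewrite mulNr mulrC.
split=> [E|[E1 E2]].
  by split=> l; rewrite -dzco_pdrow E.
by apply: dzco_inj => -[] k; rewrite dzco_pdrow ?Eu ?Ev.
Qed.

Section Iff.
Variables (star : nat -> (M -> C) -> (M -> C) -> M -> C) (K : nat -> M -> 'M[C]_d).
Hypotheses (sP : star_product star) (sW : wick_type star) (sK : is_karabegov_form star K).
Let waf := wick_algebra_star sP sW.
Let wat := wick_algebra_op sP sW.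
Let bS := fa_bidiff (wa_formal waf).

Variables (X : M -> 'rV[C]_d) (J : nat -> M -> C).
Hypotheses (hX : holomorphic_field X) (sJ : fsmooth J).

Definition quantum_hamiltonian_of :=
  forall a, fsmooth a -> feq_on setT (fnu (rho_of X a)) (ad_star star J a).

Lemma quantum_local U a r p : open U -> U p -> fsmooth_on U a -> quantum_hamiltonian_of ->
  fnu (rho_of X a) r p = ad_star star J a r p.
Proof.
move=> oU Up sa h; have [V [oV Vp VU cut]] := fcutoff oU Up.
have [a' sa' aa] := cut a sa; have sVa := fsmooth_sub VU sa.
have := h a' sa' r p I; rewrite /ad_star /fsub.
have sJV := fsmoothT V sJ; have sa'V := fsmoothT V sa'.
rewrite (fstar_ext bS r oV Vp sJV sa'V (fun _ _ _ => erefl) aa).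
rewrite (fstar_ext bS r oV Vp sa'V sJV aa (fun _ _ _ => erefl)) => <-.
case: r => [|r]; first by [].
by congr (- _); apply: (vf_app_ext _ oV Vp) => q Vq; rewrite aa.
Qed.

Let charts p : exists z (u v : 'I_n -> nat -> M -> C), [/\ atlas z, cdom z p,
  (forall k, fsmooth_on (cdom z) (u k)) /\ (forall k, fsmooth_on (cdom z) (v k)),
   (forall k a, fsmooth_on (cdom z) a -> feq_on (cdom z) (fstar star a (u k))
    (fadd (fmul a (u k)) (fnu (Defs.fmap (Zd false z k) a)))) /\
   (forall k a, fsmooth_on (cdom z) a -> feq_on (cdom z) (fstar (opstar star) a (v k))
    (fadd (fmul a (v k)) (fnu (Defs.fmap (Zd true z k) a)))) &
   forall r f q, csmooth f -> cdom z q -> dfun f q = iprod X (K r) q <->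
    (forall l, Zd true z l f q = \sum_k zcomp false z X k q * Zd true z l (u k r) q) /\
    (forall k, Zd false z k f q = \sum_l (- zcomp true z X l q) * Zd false z k (v l r) q)].
Proof.
have [z [az zp cz]] := contractible_chart p; exists z.
have [_ /(_ z az cz) [u [v [suv uP vP Ku Kv]]]] := sK.
exists u, v; split => //.
- by split=> k; have [] := suv k.
- split=> k a sa r q zq; first by rewrite Zd_Zder uP.
  by rewrite Zd_Zbarder fstar_op vP // /fadd fmulC.
move=> r f q sf zq; have oz := @cdom_open _ _ _ z.
apply: (iprod_karabegov X az oz zq zq (csmoothT (cdom z) sf) _ (Ku r q zq) (Kv r q zq)).
by move=> k; have [su _] := suv k; exact: su.
Qed.

Lemma quantum_iff : quantum_hamiltonian_of <-> forall r p, dfun (J r) p = iprod X (K r) p.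
Proof.
split=> [h r p|h a sa r p _].
  have [z [u [v [az zp [su sv] [uP vP] E]]]] := charts p.
  apply/(E r (J r) p (sJ r) zp); have oz := @cdom_open _ _ _ z.
  have sJz := fsmoothT (cdom z) sJ.
  have xP b k := hX az b k.
  have sz b k : fsmooth_on (cdom z) (emb (zc b z k)) by apply: emb_smooth; exact: csmooth_zc.
  have rhoE b k s q : cdom z q -> fnu (rho_of X (emb (zc b z k))) s q = - fnu (emb (zcomp b z X k)) s q.
    move=> zq; case: s => [|[|s]] /=; first by rewrite oppr0.
      by congr (- _); exact: vf_app_zc.
    by congr (- _); exact: vf_app0.
  have zhol b k s l q : cdom z q -> Zd (~~ b) z l (emb (zc b z k) s) q = 0.
    move=> zq; apply: emb_hol => // l' q' zq'; rewrite Zd_zc //; case: (b); by rewrite andbF.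
  split=> l.
    (* The Hamiltonian equation is tested on z^k: as J * z^k = J z^k, it says z^k * J = z^k J + nu
       X^k. *)
    apply: (Zd_of_star_coord waf az su uP (fun k => (xP false k).1) (fun k => (xP false k).2) sJz) => // k s q zq.
    have := quantum_local s oz zq (sz false k) h; rewrite /ad_star /fsub rhoE //.
    rewrite (wick_fstar_hol waf az s zq sJz (sz false k)); last by move=> s' l' q' zq'; exact: (zhol false).
    rewrite fmulC fmul_emb => Eq.
    have H (s1 s2 s3 : C) : - s1 = s2 - s3 -> s3 = s2 + s1.
      by move=> E'; rewrite -[s1]opprK E' opprB addrC subrK.
    exact: H Eq.
  have sxN k : csmooth_on (cdom z) (fun q => - zcomp true z X k q) by apply: csmoothN => //; exact: (xP true k).1.
  have hxN k l' q : cdom z q -> Zd (~~ true) z l' (fun q => - zcomp true z X k q) q = 0.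
    move=> zq; rewrite -[RHS](mulr0 (-1)) -((xP true k).2 l' q zq) -(Zd_cstM _ l' _ oz zq zq az (xP true k).1).
    by apply: (Zd_ext _ l' oz zq zq) => q' _; rewrite mulN1r.
  (* The conjugate test on zbar^k, in the opposite product. Now J * a carries the information, and
     it enters the commutator with the other sign; hence the negated components. *)
  apply: (Zd_of_star_coord wat az sv vP sxN hxN sJz) => // k s q zq.
  have := quantum_local s oz zq (sz true k) h; rewrite /ad_star /fsub rhoE // -!(fstar_op star).
  rewrite (wick_fstar_hol wat az s zq sJz (sz true k)); last by move=> s' l' q' zq'; exact: (zhol true).
  rewrite (fmulC (J)) fmul_emb => Eq.
  have -> : fnu (emb (fun q => - zcomp true z X k q)) s q = - fnu (emb (zcomp true z X k)) s q.
    by case: s {Eq} => [|[|s]] /=; rewrite ?oppr0.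
  by rewrite Eq addrC subrK.
have [z [u [v [az zp [su sv] [uP vP] E]]]] := charts p.
have oz := @cdom_open _ _ _ z.
have sJz := fsmoothT (cdom z) sJ; have saz := fsmoothT (cdom z) sa.
have xP b k := hX az b k.
have sxN k : csmooth_on (cdom z) (fun q => - zcomp true z X k q) by apply: csmoothN => //; exact: (xP true k).1.
have hxN k l' q : cdom z q -> Zd (~~ true) z l' (fun q => - zcomp true z X k q) q = 0.
  move=> zq; rewrite -[RHS](mulr0 (-1)) -((xP true k).2 l' q zq) -(Zd_cstM _ l' _ oz zq zq az (xP true k).1).
  by apply: (Zd_ext _ l' oz zq zq) => q' _; rewrite mulN1r.
(* The two halves compute a * J and J * a for arbitrary a. In the difference the products a J
   cancel, and the terms of order nu add up to - X a. *)
have Ef := fstar_of_Zd waf az su uP (fun k => (xP false k).1) (fun k => (xP false k).2) sJz.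
have Et := fstar_of_Zd wat az sv vP sxN hxN sJz.
rewrite /ad_star /fsub -(fstar_op star a J).
have hf s l q : cdom z q -> Zd (~~ false) z l (J s) q = \sum_k zcomp false z X k q * Zd (~~ false) z l (u k s) q.
  by move=> zq; have [-> _] := (E s (J s) q (sJ s) zq).1 (h s q).
have ht s l q : cdom z q -> Zd (~~ true) z l (J s) q = \sum_k (- zcomp true z X k q) * Zd (~~ true) z l (v k s) q.
  by move=> zq; have [_ ->] := (E s (J s) q (sJ s) zq).1 (h s q).
rewrite (Ef hf a r p zp saz) (Et ht a r p zp saz).
rewrite addrC opprD addrACA addNr add0r.
case: r => [|r] /=; first by rewrite oppr0 addr0.
have -> : \sum_k (- zcomp true z X k p) * Zd true z k (a r) p = - \sum_k zcomp true z X k p * Zd true z k (a r) p.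
  by rewrite -sumrN; apply: eq_bigr => k _; rewrite mulNr.
rewrite /rho_of /Defs.fmap (vf_app_chart X az oz zp zp (saz r)) big_split opprD /=.
exact: erefl.
Qed.

End Iff.
End Quantum.

(** * Holomorphy of the action *)

Opaque dzco zcomp zc vf_app.

Section LieAlgebra.
Context {R : realType} {n : nat} {M : kaehlerManifold R n}.
Local Notation C := R[i].
Local Notation d := (n + n)%N.
Implicit Types (c z : @chart R M d) (f g : M -> C) (a : nat -> M -> C) (U : set M) (p q : M).
Variables (star : nat -> (M -> C) -> (M -> C) -> M -> C) (X : M -> 'rV[C]_d).
Hypotheses (sP : star_product star) (sW : wick_type star).
Hypotheses (vX : vector_field X) (dX : derivation_of star (rho_of X)).

Lemma csmooth_vf_app U f : open U -> csmooth_on U f -> csmooth_on U (vf_app X f).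
Proof.
move=> oU sf; apply: csmooth_local => p Up.
set z := chart_at p; have az : atlas z := atlas_chart_at p.
have oW : open (cdom z `&` U) by apply: openI => //; exact: cdom_open.
exists (cdom z `&` U); split; first by split => //; exact: mem_chart_at.
have S : csmooth_on (cdom z `&` U) (fun q => \sum_j vf_in z X q 0 j * pd z j f q).
  apply: (csmooth_sum _ oW) => j _; apply: (csmoothM oW).
    by apply: (csmooth_sub _ (vX j az)) => q [].
  apply: (csmooth_pd j oW _ az); first by move=> q [].
  by apply: csmooth_sub sf => q [].
by apply: (csmooth_ext oW _ S) => q [zq Uq]; rewrite (vf_app_pd X az oU Uq zq sf).
Qed.

Lemma csmooth_zcomp b z k : atlas z -> csmooth_on (cdom z) (zcomp b z X k).
Proof.
move=> az; have oz := @cdom_open _ _ _ z.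
apply: (csmooth_ext oz _ (csmooth_vf_app oz (csmooth_zc b k az))) => q zq.
exact: vf_app_zc.
Qed.

Lemma vf_appM U f g p : open U -> U p -> csmooth_on U f -> csmooth_on U g ->
  vf_app X (fun q => f q * g q) p = f p * vf_app X g p + vf_app X f p * g p.
Proof.
move=> oU Up sf sg; set z := chart_at p; have az : atlas z := atlas_chart_at p.
have zp : cdom z p := mem_chart_at p.
rewrite !(vf_app_pd X az oU Up zp) ?(csmoothM oU sf sg) //; last exact: csmoothM.
rewrite mulr_sumr mulr_suml -big_split; apply: eq_bigr => j _ /=.
by rewrite (pdM j oU Up zp az sf sg) mulrDr; congr (_ + _); [exact: mulrCA|exact: mulrA].
Qed.

Lemma fsmooth_rho U a : open U -> fsmooth_on U a -> fsmooth_on U (rho_of X a).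
Proof. by move=> oU sa r; apply: (csmoothN oU); exact: csmooth_vf_app. Qed.

Lemma rho_ext U a a' : open U -> feq_on U a a' -> feq_on U (rho_of X a) (rho_of X a').
Proof.
move=> oU aa r q Uq; congr (- _); apply: (vf_app_ext X oU Uq) => q' Uq'; exact: aa.
Qed.

Lemma derivation_op (star' := opstar star) : derivation_of star' (rho_of X).
Proof.
move=> a b sa sb r p _; have E x y : fstar star' x y = fstar star y x.
  by apply/funext => s; apply/funext => q; exact: fstar_op.
have D : feq_on setT _ _ := dX sb sa.
by rewrite E (D r p I) /fadd !E addrC.
Qed.

End LieAlgebra.

Section LieAlgebraHolomorphic.
Context {R : realType} {n : nat} {M : kaehlerManifold R n}.
Local Notation C := R[i].
Local Notation d := (n + n)%N.
Implicit Types (c z : @chart R M d) (f g : M -> C) (a : nat -> M -> C) (U : set M) (p q : M).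

Lemma derivation_local star X U a b r p : formal_algebra star -> vector_field X ->
  derivation_of star (rho_of X) -> open U -> U p -> fsmooth_on U a -> fsmooth_on U b ->
  rho_of X (fstar star a b) r p = fstar star (rho_of X a) b r p + fstar star a (rho_of X b) r p.
Proof.
move=> fS vX dX oU Up sa sb; have bS := fa_bidiff fS.
have [V [oV Vp VU cut]] := fcutoff oU Up.
have [a' sa' aa] := cut a sa; have [b' sb' bb] := cut b sb.
have sV x : fsmooth x -> fsmooth_on V x by exact: fsmoothT.
have D : feq_on setT _ _ := dX a' b' sa' sb'; have := D r p I; rewrite /fadd.
have sr x : fsmooth x -> fsmooth_on V (rho_of X x).
  by move=> /sV; exact: (fsmooth_rho vX oV).
rewrite (fstar_ext bS r oV Vp (sr _ sa') (sV _ sb') (rho_ext X oV aa) bb).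
rewrite (fstar_ext bS r oV Vp (sV _ sa') (sr _ sb') aa (rho_ext X oV bb)) => <-.
apply: (rho_ext X oV _ r Vp) => s q Vq; apply/esym.
exact: (fstar_ext bS s oV Vq (sV _ sa') (sV _ sb') aa bb).
Qed.

(** The derivation D is applied to z^j * z^k = z^j z^k. As z^k is holomorphic, D z^j * z^k is the
    pointwise product; comparison with the Leibniz rule of X leaves z^j * D z^k = z^j D z^k for all
    j, so D z^k = - X^k is holomorphic. *)
Lemma derivation_hol bt star X : wick_algebra bt star -> vector_field X ->
  derivation_of star (rho_of X) -> forall z k l q, atlas z -> cdom z q ->
  Zd (~~ bt) z l (zcomp bt z X k) q = 0.
Proof.
move=> wa vX dX z k l q az zq; have fS := wa_formal wa.
have oz := @cdom_open _ _ _ z.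
have se j : fsmooth_on (cdom z) (emb (zc bt z j)) by apply: emb_smooth; exact: csmooth_zc.
have zhol j s l' q' : cdom z q' -> Zd (~~ bt) z l' (emb (zc bt z j) s) q' = 0.
  move=> zq'; apply: emb_hol => // l'' q'' zq''; rewrite Zd_zc //; by case: (bt); rewrite andbF.
have Ez j s q' (a : nat -> M -> C) : cdom z q' -> fsmooth_on (cdom z) a ->
    fstar star a (emb (zc bt z j)) s q' = zc bt z j q' * a s q'.
  move=> zq' sa; rewrite (wick_fstar_hol wa az s zq' sa (se j)); last first.
    by move=> s' l' q'' zq''; exact: (zhol j).
  exact: (etrans (fmulC _ _ _ _) (fmul_emb _ _ _ _)).
have sr := fsmooth_rho vX oz (se k).
have := @wick_hol _ _ _ _ _ wa z az _ sr.
move=> /(_ _ 0%N l q zq) H.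
have rE q' : cdom z q' -> rho_of X (emb (zc bt z k)) 0%N q' = - zcomp bt z X k q'.
  by move=> zq'; congr (- _); exact: vf_app_zc.
have sc : csmooth_on (cdom z) (zcomp bt z X k) by exact: csmooth_zcomp.
have -> : Zd (~~ bt) z l (zcomp bt z X k) q = - Zd (~~ bt) z l (rho_of X (emb (zc bt z k)) 0%N) q.
  rewrite -mulN1r -(Zd_cstM (~~ bt) l _ oz zq zq az (sr 0%N)).
  by apply: (Zd_ext (~~ bt) l oz zq zq) => q' zq'; rewrite rE // mulN1r opprK.
rewrite H ?oppr0 // => j s p zp.
have := derivation_local s fS vX dX oz zp (se j) (se k).
have sj := fsmooth_rho vX oz (se j).
rewrite (Ez k s p _ zp sj).
have -> : rho_of X (fstar star (emb (zc bt z j)) (emb (zc bt z k))) s p =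
    zc bt z k p * rho_of X (emb (zc bt z j)) s p + rho_of X (emb (zc bt z k)) 0%N p * emb (zc bt z j) s p.
  have -> : rho_of X (fstar star (emb (zc bt z j)) (emb (zc bt z k))) s p =
      rho_of X (fun s q => zc bt z k q * emb (zc bt z j) s q) s p.
    by apply: (rho_ext X oz _ s zp) => s' q' zq'; exact: Ez.
  rewrite /rho_of /Defs.fmap (vf_appM X oz zp (csmooth_zc bt k az) (se j s)).
  by rewrite opprD mulrN mulNr.
move/addrI => <-.
case: s => [|s] /=; first by rewrite mulrC.
by rewrite mulr0 /rho_of /Defs.fmap vf_app0 oppr0 mulr0.
Qed.

Lemma derivation_holomorphic_field star (X : M -> 'rV[C]_d) : star_product star -> wick_type star ->
  vector_field X -> derivation_of star (rho_of X) -> holomorphic_field X.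
Proof.
move=> sP sW vX dX z az b k; split; first exact: csmooth_zcomp.
move=> l q zq; case: b.
  by apply: (derivation_hol (wick_algebra_op sP sW) vX (derivation_op dX)).
exact: (derivation_hol (wick_algebra_star sP sW) vX dX).
Qed.

End LieAlgebraHolomorphic.

(** * Actions of Lie groups *)

Section LieGroup.
Context {R : realType} {d1 : nat} (G : @lieGroup R d1).

Lemma lg_mulVr : right_inverse (lg_one G) (@lg_inv _ _ G) (@lg_mul _ _ G).
Proof.
move=> x; rewrite -[LHS](lg_mul1 (_ : G)) -(lg_mulV (lg_inv x)) -lg_mulA.
by rewrite [lg_mul _ (lg_mul x _)]lg_mulA lg_mulV lg_mul1.
Qed.

Lemma lg_mulr1 : right_id (lg_one G) (@lg_mul _ _ G).
Proof. by move=> x; rewrite -(lg_mulV x) lg_mulA lg_mulVr lg_mul1. Qed.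

Lemma lg_invK : involutive (@lg_inv _ _ G).
Proof.
move=> x; rewrite -[LHS]lg_mulr1 -(lg_mulV x) lg_mulA lg_mulV lg_mul1 //.
Qed.

Lemma lg_idem (x : G) : x = lg_mul x x -> x = lg_one G.
Proof. by move=> E; rewrite -(lg_mulV x) {3}E lg_mulA lg_mulV lg_mul1. Qed.

End LieGroup.

Section Action.
Context {R : realType} {n d1 : nat} {M : @manifold R (n + n) (@holomorphic_on R n)}.
Context {G : @lieGroup R d1}.
Local Notation C := R[i].
Local Notation d := (n + n)%N.
Variable Phi : G -> M -> M.
Hypothesis act : smooth_left_action Phi.
Implicit Types (c : @chart R G d1) (z w : @chart R M d) (f : M -> R) (p q : M) (h : G).
Implicit Types (U : set M).

Lemma act_one p : Phi (lg_one G) p = p.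
Proof. by have [_ + _] := act. Qed.

Lemma act_mul h h' p : Phi (lg_mul h h') p = Phi h (Phi h' p).
Proof. by have [_ _ +] := act. Qed.

Lemma act_continuous2 : continuous (fun x : G * M => Phi x.1 x.2).
Proof. by have [[]] := act. Qed.

Lemma act_continuous h : continuous (Phi h).
Proof.
move=> p; apply: (@continuous_comp _ _ _ (fun p => (h, p)) (fun x : G * M => Phi x.1 x.2)).
  by apply: cvg_pair; [exact: cvg_cst|exact: cvg_id].
exact: act_continuous2.
Qed.

Definition actm c z w (y : 'rV[R]_d1 * 'rV[R]_d) : 'rV[R]_d :=
  cmap w (Phi (cinv c y.1) (cinv z y.2)).

Definition actd c z w : set ('rV[R]_d1 * 'rV[R]_d) :=
  [set y | [/\ (cmap c @` cdom c) y.1, (cmap z @` cdom z) y.2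
    & cdom w (Phi (cinv c y.1) (cinv z y.2))]].

Lemma actm_smooth c z w : atlas c -> atlas z -> atlas w ->
  smooth_on (actd c z w) (actm c z w).
Proof. by move=> a1 az aw; have [[_ +] _ _] := act; exact. Qed.

Lemma actd_open c z w : open (actd c z w).
Proof.
rewrite openE => -[y x] [/= [h c1h <-] [p zp <-]]; rewrite !cmapK // => wp.
have C : {for (cmap c h, cmap z p), continuous (fun y : 'rV[R]_d1 * 'rV[R]_d => Phi (cinv c y.1) (cinv z y.2))}.
  apply: (@continuous_comp _ _ _ (fun y : 'rV[R]_d1 * 'rV[R]_d => (cinv c y.1, cinv z y.2)) (fun x : G * M => Phi x.1 x.2)).
    apply: cvg_pair.
      apply: (@continuous_comp _ _ _ fst (cinv c)); first exact: cvg_fst.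
      exact: cinv_continuous.
    apply: (@continuous_comp _ _ _ snd (cinv z)); first exact: cvg_snd.
    exact: cinv_continuous.
  exact: act_continuous2.
have N1 : \forall y \near (cmap c h, cmap z p), cdom w (Phi (cinv c y.1) (cinv z y.2)).
  apply: C; rewrite /= !cmapK //; apply: open_nbhs_nbhs; split => //; exact: cdom_open.
have N2 : \forall y \near (cmap c h, cmap z p), (cmap c @` cdom c) y.1.
  have F : (fst : 'rV[R]_d1 * 'rV[R]_d -> _) @ (cmap c h, cmap z p) --> cmap c h by exact: cvg_fst.
  by apply: F; apply: open_nbhs_nbhs; split; [exact: cimg_open|exists h].
have N3 : \forall y \near (cmap c h, cmap z p), (cmap z @` cdom z) y.2.
  have F : (snd : 'rV[R]_d1 * 'rV[R]_d -> _) @ (cmap c h, cmap z p) --> cmap z p by exact: cvg_snd.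
  by apply: F; apply: open_nbhs_nbhs; split; [exact: cimg_open|exists p].
suff : nbhs (cmap c h, cmap z p) (actd c z w) by [].
by apply: filterS (filterI N1 (filterI N2 N3)) => y' [? []].
Qed.

Definition snd_incl (x : 'rV[R]_d) : 'rV[R]_d1 * 'rV[R]_d := (0, x).

Lemma snd_incl_linear : linear snd_incl.
Proof. by move=> a x y; rewrite /snd_incl -[RHS]/(a *: 0 + 0, a *: x + y) scaler0 addr0. Qed.

Lemma snd_incl_continuous : continuous snd_incl.
Proof.
move=> x; suff : (0 : 'rV[R]_d1, y) @[y --> x] --> (0 : 'rV[R]_d1, x) by [].
apply: (@cvg_pair _ _ _ (nbhs x) (nbhs (0 : 'rV[R]_d1)) (nbhs x) _ _ _ (cst (0 : 'rV[R]_d1)) id).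
  exact: cvg_cst.
exact: cvg_id.
Qed.

Lemma snd_inclE x (y : 'rV[R]_d1) : snd_incl x + (y, 0) = (y, x).
Proof. by rewrite /snd_incl -[LHS]/(0 + y, x + 0) add0r addr0. Qed.

Lemma Cr_on_fiber r (W : normedModType R) (y : 'rV[R]_d1) (U : set ('rV[R]_d1 * 'rV[R]_d)) (F : 'rV[R]_d1 * 'rV[R]_d -> W) :
  Cr_on r U F -> Cr_on r [set x | U (y, x)] (fun x => F (y, x)).
Proof.
move=> CF; have := Cr_on_affine (y, 0) snd_incl_linear snd_incl_continuous CF.
have -> : [set x | U (snd_incl x + (y, 0))] = [set x | U (y, x)].
  by apply/funext => x /=; rewrite snd_inclE.
by have -> : (fun x => F (snd_incl x + (y, 0))) = (fun x => F (y, x))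
  by apply/funext => x /=; rewrite snd_inclE.
Qed.

Lemma derive_fiber (W : normedModType R) (y : 'rV[R]_d1) (F : 'rV[R]_d1 * 'rV[R]_d -> W) x v :
  'D_v (fun x => F (y, x)) x = 'D_(0, v) F (y, x).
Proof.
have := @derive_affine R _ _ W snd_incl (y, 0) F x v snd_incl_linear.
rewrite snd_inclE => <-; congr (derive _ _ _).
by apply/funext => x' /=; rewrite snd_inclE.
Qed.

Lemma rsmooth_act h U f : open U -> rsmooth_on U f ->
  rsmooth_on (Phi h @^-1` U) (fun q => f (Phi h q)).
Proof.
move=> oU sf; apply: rsmooth_local => p Up.
set z := chart_at p; have az : atlas z := atlas_chart_at p.
set w := chart_at (Phi h p); have aw : atlas w := atlas_chart_at (Phi h p).
set c := chart_at h; have a1 : atlas c := atlas_chart_at h.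
have ow : open (cdom w `&` U) by apply: openI => //; exact: cdom_open.
pose W := cdom z `&` Phi h @^-1` (cdom w `&` U).
have oW : open W.
  apply: openI; first exact: cdom_open.
  by apply: open_comp => // q _; exact: act_continuous.
exists W; split; first by split; [exact: mem_chart_at|split => //; exact: mem_chart_at].
apply: (rsmooth_chart az oW (@subIsetl _ _ _)) => r.
have oW' : open (cmap z @` W).
  have -> : W = cdom z `&` W by rewrite /W setIA setIid.
  exact: cimg_sub_open.
have C := Cr_on_fiber (cmap c h) (actm_smooth a1 az aw r).
have C' : Cr_on r (cmap z @` W) (fun x => actm c z w (cmap c h, x)).
  apply: Cr_on_sub C => x [q [zq [wq _]] <-] /=; split => /=.
  - by exists h => //; exact: mem_chart_at.
  - by exists q.
  - by rewrite !cmapK //; exact: mem_chart_at.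
apply: (Cr_on_ext oW' _ (Cr_on_comp oW' _ C' (sf w aw r))) => x [q [zq [wq Uq]] <-] /=.
  by rewrite /actm /= !cmapK //; exact: mem_chart_at.
by rewrite /actm /= !cmapK //; [exists (Phi h q)|exact: mem_chart_at].
Qed.

Lemma csmooth_act h U (f : M -> C) : open U -> csmooth_on U f ->
  csmooth_on (Phi h @^-1` U) (fun q => f (Phi h q)).
Proof.
by move=> oU /csmoothE [s1 s2]; apply/csmoothE; split; [exact: rsmooth_act s1|exact: rsmooth_act s2].
Qed.

End Action.

Section GroupInvariant.
Context {R : realType} {n d1 : nat} {M : kaehlerManifold R n}.
Context {G : @lieGroup R d1}.
Local Notation C := R[i].
Local Notation d := (n + n)%N.
Variable Phi : G -> M -> M.
Hypothesis act : smooth_left_action Phi.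
Implicit Types (z w : @chart R M d) (p q : M) (h : G) (U : set M).

Lemma lie_group_invariant_op star :
  lie_group_invariant star Phi -> lie_group_invariant (opstar star) Phi.
Proof.
move=> inv h a b sa sb r p _; have E x y : fstar (opstar star) x y = fstar star y x.
  by apply/funext => s; apply/funext => q; exact: fstar_op.
have I1 : feq_on setT _ _ := inv h b a sb sa.
by rewrite !E; exact: I1.
Qed.

Lemma fsmooth_pullback h (a : nat -> M -> C) : fsmooth a -> fsmooth (fpullback (Phi h) a).
Proof. by move=> sa r; exact: (csmooth_act act h openT (sa r)). Qed.

(** By invariance w^j * Phi_h^* z^k is the pull-back along Phi_h of (w^j o Phi_h^-1) * z^k. The
    latter is a pointwise product as z^k is holomorphic, so the former is too, for every j, and this
    forces Phi_h^* z^k to be holomorphic. *)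
Lemma act_hol bt star z w h k l p : wick_algebra bt star -> lie_group_invariant star Phi ->
  atlas w -> atlas z -> cdom w p -> cdom z (Phi h p) ->
  Zd (~~ bt) w l (fun q => zc bt z k (Phi h q)) p = 0.
Proof.
move=> wa inv aw az wp zp; have fS := wa_formal wa; have bS := fa_bidiff fS.
have oz := @cdom_open _ _ _ z; have ow := @cdom_open _ _ _ w.
pose W := cdom w `&` Phi h @^-1` cdom z.
have oWz : open (Phi h @^-1` cdom z).
  by apply: open_comp oz => q _; exact: (act_continuous act).
have oW : open W by exact: openI.
have Ww : W `<=` cdom w by move=> q [].
pose psi q := zc bt z k (Phi h q).
have spsi : csmooth_on W psi.
  by apply: (csmooth_sub _ (csmooth_act act h oz (csmooth_zc bt k az))) => q [].
have se : fsmooth_on W (emb psi) by exact: emb_smooth.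
have sez : fsmooth_on (cdom z) (emb (zc bt z k)) by apply: emb_smooth; exact: csmooth_zc.
apply: (@wick_hol_on _ _ _ bt star w W (emb psi) wa aw oW Ww se _ 0%N l p) => //.
move=> j r q Wq; have [wq zq] := Wq.
have sw : csmooth_on W (zc bt w j) by exact: (csmooth_sub Ww (csmooth_zc bt j aw)).
(* Invariance concerns global functions: w^j is cut off near q, and z^k near Phi_h q. *)
have [V [oV Vq VW cutV]] := fcutoff oW Wq.
have [a sa aE] := cutV (emb (zc bt w j)) (emb_smooth sw).
have [V' [oV' Vq' V'z cutV']] := fcutoff oz zq.
have [b sb bE] := cutV' _ sez.
pose V2 := V `&` Phi h @^-1` V'.
have oV2 : open V2.
  by apply: openI => //; apply: open_comp oV' => q' _; exact: (act_continuous act).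
have V2q : V2 q by [].
(* Invariance is stated for pull-backs along inverses. Taken at h^-1 and for a' = a o Phi_(h^-1), it
   turns a * (b o Phi_h) into the pull-back of a' * b along Phi_h. *)
pose a' := fpullback (Phi (lg_inv h)) a.
have sa' : fsmooth a' by exact: fsmooth_pullback.
have I1 : feq_on setT _ _ := inv (lg_inv h) a' b sa' sb.
have E := I1 r q I; rewrite /fpullback lg_invK in E.
have a'E s q' : a' s (Phi h q') = a s q'.
  by rewrite /a' /fpullback -(act_mul act) lg_mulV (act_one act).
have aE' : (fun s q' => a' s (Phi h q')) = a.
  by apply/funext => s; apply/funext => q'; exact: a'E.
rewrite aE' in E.
have sV2 x : fsmooth x -> fsmooth_on V2 x by exact: fsmoothT.
have aW : feq_on V2 a (emb (zc bt w j)) by move=> s q' [Vq2 _]; exact: aE.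
have bW : feq_on V2 (fun s q' => b s (Phi h q')) (emb psi).
  by move=> s q' [_ Vq2]; rewrite bE //; case: s.
have sbh : fsmooth (fun s q' => b s (Phi h q')) by exact: (fsmooth_pullback h sb).
have <- : fstar star a (fun s q' => b s (Phi h q')) r q = fstar star (emb (zc bt w j)) (emb psi) r q.
  exact: (fstar_ext bS r oV2 V2q (sV2 _ sa) (sV2 _ sbh) aW bW).
rewrite -E (fstar_ext bS r oV' Vq' (fsmoothT V' sa') (fsmoothT V' sb) (fun _ _ _ => erefl) bE).
have sa'z := fsmoothT (cdom z) sa'.
rewrite (wick_fstar_hol wa az r zq sa'z sez); last first.
  move=> s l' q' zq'; apply: emb_hol => // l'' q'' zq''; rewrite Zd_zc //; by case: (bt); rewrite andbF.
rewrite fmulC fmul_emb a'E aE //.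
by case: r {E} => [|r] /=; rewrite ?mulr0 // mulrC.
Qed.

End GroupInvariant.

Section CauchyRiemann.
Context {R : realType} {n : nat} {M : @manifold R (n + n) (@holomorphic_on R n)}.
Local Notation C := R[i].
Local Notation d := (n + n)%N.
Implicit Types (z : @chart R M d) (p q : M).

(** The Cauchy-Riemann equations for f + i g, or their conjugates. *)
Lemma Zd_real_imag b z l (f g : M -> R) p (s := complex.Im (sgi b : C)) :
  Zd b z l (fun q => (f q) +i* (g q)) p = 0 <->
  rpd z (lshift n l) f p - s * rpd z (rshift n l) g p = 0 /\
  rpd z (lshift n l) g p + s * rpd z (rshift n l) f p = 0.
Proof.
have E : pd z (lshift n l) (fun q => (f q) +i* (g q)) p
    + sgi b * pd z (rshift n l) (fun q => (f q) +i* (g q)) p =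
   (rpd z (lshift n l) f p - s * rpd z (rshift n l) g p) +i*
   (rpd z (lshift n l) g p + s * rpd z (rshift n l) f p).
  rewrite !pdE sgiE -/s; move: (rpd _ _ _ _) (rpd _ _ _ _) (rpd _ _ _ _) (rpd _ _ _ _) => x y u v.
  by apply/eqP; rewrite eq_complex /= !mul0r sub0r add0r !eqxx.
rewrite ZdE E; split.
  by move/eqP; rewrite mulf_eq0 invr_eq0 pnatr_eq0 /= eq_complex /= => /andP[/eqP -> /eqP ->].
by move=> [-> ->]; rewrite mulr0.
Qed.

Lemma rpd_fiber (H : 'rV[R]_d -> R^o) z j p : cdom z p ->
  rpd z j (fun q => H (cmap z q)) p = 'D_(delta_mx 0 j) H (cmap z p).
Proof.
move=> zp; have oz := @cdom_open _ _ _ z.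
apply: near_eq_derive; apply: (near_eq_open (cimg_sub_open z oz)); first by exists p.
by move=> x /cimgP [_ _ _ xE]; rewrite xE.
Qed.

End CauchyRiemann.

Section Fundamental.
Context {R : realType} {n d1 : nat} {M : kaehlerManifold R n}.
Context {G : @lieGroup R d1} {g : vectType R}.
Local Notation C := R[i].
Local Notation d := (n + n)%N.
Variables (Phi : G -> M -> M) (exp : g -> G).
Hypothesis act : smooth_left_action Phi.
Hypothesis expP : is_exponential exp.
Implicit Types (z w : @chart R M d) (p q : M) (xi : g).

Let e := lg_one G.
Let c0 := chart_at e.
Let ac0 : atlas c0 := atlas_chart_at e.
Let c0e : cdom c0 e := mem_chart_at e.
Let y0 := cmap c0 e.
Let vel xi : 'rV[R]_d1 := derive1 (fun t : R => cmap c0 (exp (t *: xi))) 0.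
Let F z w := actm Phi c0 z w.
Let Om z w := actd Phi c0 z w.

Lemma exp0 : exp 0 = e.
Proof.
apply: lg_idem; have [_ E _ _] := expP.
by have := E 0 0 0; rewrite addr0 scaler0.
Qed.

Let gam xi : R^o -> 'rV[R]_d1 := fun t => cmap c0 (exp (t *: xi)).

Let gam0 xi : gam xi 0 = y0.
Proof. by rewrite /gam scale0r exp0. Qed.

Let gam_near xi : \forall t \near (0 : R^o), cdom c0 (exp (t *: xi)).
Proof.
have [S _ _ _] := expP; have [cS _] := S xi.
have := cS (0 : R); rewrite /continuous_at => C.
by apply: C; rewrite scale0r exp0; apply: open_nbhs_nbhs; split => //; exact: cdom_open.
Qed.

Let gam_diff xi : differentiable (gam xi) (0 : R^o).
Proof.
have [S _ _ _] := expP; have [_ sS] := S xi.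
have [+ _] := sS c0 ac0 1%N; apply.
by rewrite /preimage /= scale0r exp0.
Qed.

Let velE xi : vel xi = 'd (gam xi) (0 : R^o) (1 : R).
Proof. by rewrite /vel derive1E deriveE //; exact: gam_diff. Qed.

Let F_diff z w y : atlas z -> atlas w -> Om z w y -> differentiable (F z w) y.
Proof. by move=> az aw Oy; have [+ _] := actm_smooth act ac0 az aw 1%N; apply. Qed.

Let Om0 z w p : cdom z p -> cdom w p -> Om z w (y0, cmap z p).
Proof.
move=> zp wp; split => /=; [by exists e|by exists p|].
by rewrite !cmapK // (act_one act).
Qed.

(** The velocity of the orbit becomes a directional derivative of the action, a smooth map on an
    open set of a product of vector spaces; there it can be exchanged with derivatives along M. *)
Lemma derive_orbit z w p xi : atlas z -> atlas w -> cdom z p -> cdom w p ->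
  derive1 (fun t : R => cmap w (Phi (exp (t *: xi)) p)) 0 = 'D_(vel xi, 0) (F z w) (y0, cmap z p).
Proof.
move=> az aw zp wp; have dF := F_diff az aw (Om0 zp wp).
pose del : R^o -> 'rV[R]_d1 * 'rV[R]_d := fun t => (gam xi t, cmap z p).
have ddel : differentiable del (0 : R^o).
  exact: (differentiable_pair (gam_diff xi) (differentiable_cst (cmap z p) (0 : R^o))).
have del0 : del 0 = (y0, cmap z p) by rewrite /del gam0.
rewrite derive1E.
transitivity ('D_(1 : R^o) (F z w \o del) (0 : R^o)).
  apply: near_eq_derive; near=> t.
  rewrite /= /F /actm /del /gam /= !cmapK //.
  by near: t; exact: gam_near.
rewrite deriveE; last by apply: differentiable_comp => //; rewrite del0.
rewrite diff_comp //; last by rewrite del0.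
have Ed : 'd del (0 : R^o) (1 : R) = (vel xi, 0).
  rewrite (diff_pair (gam_diff xi) (differentiable_cst (cmap z p) (0 : R^o))).
  by rewrite diff_cst velE.
by rewrite [LHS]/comp Ed del0 deriveE.
Unshelve. all: by end_near. Qed.

Let X xi : M -> 'rV[C]_d := fundamental_field Phi exp xi.

Lemma fundamental_field_linear p : linear_along (real_complex R) (fun xi => X xi p).
Proof.
move=> s x y; rewrite /X /fundamental_field.
set z := chart_at p; have az : atlas z := atlas_chart_at p.
have zp : cdom z p := mem_chart_at p.
have dF := F_diff az az (Om0 zp zp).
rewrite !(derive_orbit _ az az zp zp) !(deriveE _ dF).
have [_ _ L _] := expP.
have -> : (vel (s *: x + y), 0) = s *: (vel x, 0) + (vel y, 0) :> 'rV[R]_d1 * 'rV[R]_d.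
  by rewrite -[RHS]/(s *: vel x + vel y, s *: 0 + 0) scaler0 addr0 -L.
by rewrite linearP /= map_mxD map_mxZ.
Qed.

(** Near the identity and p, the action with values read in z is the one read in the preferred chart
    followed by the transition map. *)
Lemma fundamental_field_in z p xi : atlas z -> cdom z p ->
  vf_in z (X xi) p = map_mx (real_complex R) ('D_(vel xi, 0) (F z z) (y0, cmap z p)).
Proof.
move=> az zp; set ch := chart_at p; have ach : atlas ch := atlas_chart_at p.
have chp : cdom ch p := mem_chart_at p.
rewrite /vf_in /X /fundamental_field -/ch (derive_orbit _ az ach zp chp) /cjacobian -map_mxM.
congr (map_mx _ _).
have dT : differentiable (transition ch z) (cmap ch p).
  by have [+ _] := transition_smooth ach az 1%N; apply; exists p.
have FE : F z ch (y0, cmap z p) = cmap ch p.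
  by rewrite /F /actm /= !cmapK // (act_one act).
have dF := F_diff az ach (Om0 zp chp).
rewrite -deriveEjacobian // deriveE // -FE.
rewrite -FE in dT.
rewrite (_ : 'd (transition ch z) (F z ch (y0, cmap z p)) ('D_(vel xi, 0) (F z ch) (y0, cmap z p))
   = 'D_(vel xi, 0) (transition ch z \o F z ch) (y0, cmap z p)); last first.
  rewrite [in RHS]deriveE; last exact: differentiable_comp.
  by rewrite diff_comp //= deriveE.
have oO : open (Om z z `&` Om z ch) by apply: openI; exact: (actd_open act).
apply: near_eq_derive; apply: (near_eq_open oO); first by split; exact: Om0.
move=> y [_ [_ _ chy]]; rewrite /= /F /actm /transition /= cmapK //.
Qed.

Let Cr_F z r : atlas z -> Cr_on r (Om z z) (F z z).
Proof. by move=> az; exact: (actm_smooth act ac0 az az r). Qed.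

Section Components.
Variables (z : @chart R M d) (az : atlas z) (b : bool) (k : 'I_n).
Let m : R := - complex.Im (sgi b : C).
Let V : normedModType R := ('rV[R]_d1 * 'rV[R]_d)%type.
(** A and B are the real and imaginary parts of the coordinate [zc b z k] composed with the action,
    in the charts of G and M. *)
Let A : V -> R^o := fun y => F z z y 0 (lshift n k).
Let B : V -> R^o := fun y => m * F z z y 0 (rshift n k).
Let oO : open (Om z z).
Proof. exact: (actd_open act). Qed.

Let CA r : Cr_on r (Om z z) A.
Proof. exact: (Cr_on_coord _ oO (Cr_F r az)). Qed.

Let CB r : Cr_on r (Om z z) B.
Proof. exact: (Cr_onM oO (Cr_on_cst r _ (m : R^o)) (Cr_on_coord _ oO (Cr_F r az))). Qed.

Lemma zcomp_fundamental xi p : cdom z p -> zcomp b z (X xi) k p =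
  ('D_(vel xi, 0) A (y0, cmap z p)) +i* ('D_(vel xi, 0) B (y0, cmap z p)).
Proof.
move=> zp; rewrite -zcomp_mulmx (fundamental_field_in xi az zp).
have dF := F_diff az az (Om0 zp zp).
set D := 'D_(vel xi, 0) (F z z) (y0, cmap z p).
have DA : 'D_(vel xi, 0) A (y0, cmap z p) = D 0 (lshift n k) by exact: derive_coord.
have DB : 'D_(vel xi, 0) B (y0, cmap z p) = m * D 0 (rshift n k).
  have dr : derivable (fun y => F z z y 0 (rshift n k) : R^o) (y0, cmap z p) (vel xi, 0).
    apply: diff_derivable.
    by apply: (@differentiable_comp _ _ _ _ (F z z) (fun N : 'rV[R]_d => N 0 (rshift n k) : R^o)) => //; exact: differentiable_coord.
  have E := deriveZ m dr; rewrite (derive_coord _ _ dF) in E.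
  exact: E.
rewrite DA DB; move: D {DA DB} => D.
rewrite mxE big_split_ord /=.
have -> : \sum_(i < n) map_mx (real_complex R) D 0 (lshift n i) * (dzb b k)^T (lshift n i) 0 =
   real_complex R (D 0 (lshift n k)).
  transitivity (\sum_(i < n) real_complex R (D 0 (lshift n i)) * (i == k)%:R).
    apply: eq_bigr => i _; congr (_ * _); first by rewrite mxE.
    by rewrite mxE dzb_lshift.
  rewrite (bigD1 k) //= eqxx mulr1 big1 ?addr0 // => i ik.
  by rewrite (negbTE ik) mulr0.
have -> : \sum_(i < n) map_mx (real_complex R) D 0 (rshift n i) * (dzb b k)^T (rshift n i) 0 =
   real_complex R (D 0 (rshift n k)) * - sgi b.
  transitivity (\sum_(i < n) real_complex R (D 0 (rshift n i)) * - sgi b * (i == k)%:R).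
    apply: eq_bigr => i _; rewrite -mulrA; congr (_ * _); first by rewrite mxE.
    by rewrite mxE dzb_rshift mulNr.
  rewrite (bigD1 k) //= eqxx mulr1 big1 ?addr0 // => i ik.
  by rewrite (negbTE ik) mulr0.
rewrite /m sgiE; move: (complex.Im _) => s.
by apply/eqP; rewrite eq_complex /=; apply/andP; split; apply/eqP; ring.
Qed.

Let fiber_smooth xi (H : V -> R^o) : (forall r, Cr_on r (Om z z) H) ->
  rsmooth_on (cdom z) (fun q => 'D_(vel xi, 0) H (y0, cmap z q)).
Proof.
move=> CH; have oz := @cdom_open _ _ _ z.
apply: (rsmooth_chart az oz (@subset_refl _ _)) => r.
have [_ /(_ (vel xi, 0)) D] := CH r.+1.
have C1 := Cr_on_fiber y0 D.
have C2 : Cr_on r (cmap z @` cdom z) (fun x => 'D_(vel xi, 0) H (y0, x) : R^o).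
  by apply: Cr_on_sub C1 => _ [p zp <-]; exact: Om0.
have E x : (cmap z @` cdom z) x -> 'D_(vel xi, 0) H (y0, x) = 'D_(vel xi, 0) H (y0, cmap z (cinv z x)).
  by move=> [p zp <-]; rewrite cmapK.
exact: (Cr_on_ext (@cimg_open _ _ _ z) E C2).
Qed.

Lemma csmooth_zcomp_fundamental xi : csmooth_on (cdom z) (zcomp b z (X xi) k).
Proof.
have oz := @cdom_open _ _ _ z.
have S : csmooth_on (cdom z) (fun q => ('D_(vel xi, 0) A (y0, cmap z q)) +i* ('D_(vel xi, 0) B (y0, cmap z q))).
  by apply/csmoothE; split; [exact: (fiber_smooth xi CA)|exact: (fiber_smooth xi CB)].
by apply: (csmooth_ext oz _ S) => q zq; rewrite zcomp_fundamental.
Qed.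

Let rpd_H (H : V -> R^o) y j p : cdom z p ->
  rpd z j (fun q => H (y, cmap z q)) p = 'D_(0, delta_mx 0 j) H (y, cmap z p).
Proof.
move=> zp; rewrite (rpd_fiber (fun x => H (y, x)) j zp).
exact: derive_fiber.
Qed.

Variable star : nat -> (M -> C) -> (M -> C) -> M -> C.
Hypothesis wa : wick_algebra b star.
Hypothesis inv : lie_group_invariant star Phi.

Let s : R := complex.Im (sgi (~~ b) : C).
Let el (l : 'I_n) : V := (0, delta_mx 0 (lshift n l)).
Let er (l : 'I_n) : V := (0, delta_mx 0 (rshift n l)).

(** Holomorphy of Phi_h^* z^k is used for all h in the chart and not only at the identity: being
    valid on an open set of the product, the equations can be differentiated along G. *)
Let CR l (y : V) : Om z z y ->
  'D_(el l) A y - s * 'D_(er l) B y = 0 /\ 'D_(el l) B y + s * 'D_(er l) A y = 0.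
Proof.
case: y => y x [/= [h ch yh] [p zp xp]]; rewrite -yh -xp !cmapK // => zhp.
have := act_hol act (h := h) k l wa inv az az zp zhp.
have oW : open (cdom z `&` Phi h @^-1` cdom z).
  apply: openI; first exact: cdom_open.
  by apply: open_comp; [move=> q _; exact: (act_continuous act)|exact: cdom_open].
rewrite (@Zd_ext _ _ M (~~ b) _ _ (fun q => (A (cmap c0 h, cmap z q)) +i* (B (cmap c0 h, cmap z q))) z l p oW) //.
  by move=> /Zd_real_imag; rewrite !rpd_H.
move=> q [zq _]; rewrite zcE; congr (_ +i* _); rewrite /A /B /F /actm /= !cmapK //.
Qed.

Let D_comm (H : V -> R^o) (v w y : V) : (forall r, Cr_on r (Om z z) H) -> Om z z y ->
  'D_v (fun y => 'D_w H y : R^o) y = 'D_w (fun y => 'D_v H y : R^o) y.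
Proof. by move=> CH Oy; exact: (@derive_comm R V H (Om z z) w v y oO Oy (CH 2%N)). Qed.

(** The equation is differentiated along W, and W is exchanged with v and w. *)
Let D_lin (H H' : V -> R^o) (v w y W : V) (t : R) : (forall r, Cr_on r (Om z z) H) ->
  (forall r, Cr_on r (Om z z) H') -> Om z z y ->
  (forall y, Om z z y -> 'D_v H y + t * 'D_w H' y = 0) ->
  'D_v (fun y => 'D_W H y : R^o) y + t * 'D_w (fun y => 'D_W H' y : R^o) y = 0.
Proof.
move=> CH CH' Oy h; rewrite (D_comm v W CH Oy) (D_comm w W CH' Oy).
have d1' : derivable (fun y => 'D_v H y : R^o) y W.
  by apply: diff_derivable; have [_ /(_ v) [+ _]] := CH 2%N; apply.
have d2' : derivable (fun y => 'D_w H' y : R^o) y W.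
  by apply: diff_derivable; have [_ /(_ w) [+ _]] := CH' 2%N; apply.
have E : 'D_W (fun y => 'D_v H y + t *: 'D_w H' y : R^o) y = 0.
  rewrite -[RHS](@derive_cst R V R^o 0 y W); apply: near_eq_derive.
  by apply: (near_eq_open oO Oy) => y' Oy'; exact: h.
have E3 := deriveD d1' (derivableZ (k := t) d2').
rewrite (deriveZ t d2') in E3.
exact: (etrans (esym E3) E).
Qed.

(** The components of X_xi are the derivatives of A and B along (vel xi, 0) at the identity, and the
    equations [CR] may be differentiated in that direction. *)
Lemma zcomp_fundamental_hol xi l p : cdom z p -> Zd (~~ b) z l (zcomp b z (X xi) k) p = 0.
Proof.
move=> zp; have oz := @cdom_open _ _ _ z; have Op := Om0 zp zp.
rewrite (@Zd_ext _ _ M (~~ b) _ _ (fun q => ('D_(vel xi, 0) A (y0, cmap z q)) +i* ('D_(vel xi, 0) B (y0, cmap z q))) z l p oz zp zp);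
  last by move=> q zq; exact: zcomp_fundamental.
apply/Zd_real_imag.
rewrite !(rpd_H (fun y => 'D_(vel xi, 0) A y)) // !(rpd_H (fun y => 'D_(vel xi, 0) B y)) //.
split.
  rewrite -mulNr; apply: (D_lin (vel xi, 0) CA CB Op) => y /(CR l) [+ _].
  by rewrite mulNr.
by apply: (D_lin (vel xi, 0) CB CA Op) => y /(CR l) [].
Qed.

End Components.

Lemma fundamental_holomorphic_field star xi : star_product star -> wick_type star ->
  lie_group_invariant star Phi -> holomorphic_field (X xi).
Proof.
move=> sP sW inv z az b k; split; first exact: csmooth_zcomp_fundamental.
move=> l q zq; case: b.
  exact: (zcomp_fundamental_hol az k (wick_algebra_op sP sW) (lie_group_invariant_op inv)).
exact: (zcomp_fundamental_hol az k (wick_algebra_star sP sW) inv).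
Qed.

End Fundamental.

(** * Closed and exact one-forms *)

Section Differential.
Context {R : realType} {n : nat} {M : kaehlerManifold R n}.
Local Notation C := R[i].
Local Notation d := (n + n)%N.
Implicit Types (c : @chart R M d) (f g : M -> C) (U : set M) (p q : M).

Lemma pd_sum U (T : Type) (s : seq T) (a : T -> M -> C) c j p : open U ->
  U p -> cdom c p -> atlas c -> (forall i, csmooth_on U (a i)) ->
  pd c j (fun q => \sum_(i <- s) a i q) p = \sum_(i <- s) pd c j (a i) p.
Proof.
move=> oU Up cp ac sa; elim: s => [|i s IH].
  rewrite big_nil -[RHS](pd_cst c j p 0); apply: (pd_ext j oU Up cp) => q _.
  by rewrite big_nil.
have ss : csmooth_on U (fun q => \sum_(i <- s) a i q) by exact: csmooth_sum.
rewrite big_cons -IH -(pdD j Up cp ac (sa i) ss).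
by apply: (pd_ext j oU Up cp) => q _; rewrite big_cons.
Qed.

Lemma dfun_comb (T : Type) (s : seq T) (x : T -> C) (f : T -> M -> C) p :
  (forall i, csmooth (f i)) ->
  dfun (fun q => \sum_(i <- s) x i * f i q) p = \sum_(i <- s) x i *: dfun (f i) p.
Proof.
move=> sf; have chp := mem_chart_at p; have ach := atlas_chart_at p.
apply/rowP => j; rewrite [LHS]mxE summxE.
rewrite (pd_sum _ j openT I chp ach) => [|i]; last first.
  by apply: (csmoothM openT (csmooth_cst _ _)); exact: sf.
apply: eq_bigr => i _; rewrite (pd_cstM j _ openT I chp ach (sf i)).
by rewrite [RHS]mxE; congr (_ * _); rewrite mxE.
Qed.

Lemma dfunD f g p : csmooth f -> csmooth g ->
  dfun (fun q => f q + g q) p = dfun f p + dfun g p.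
Proof.
move=> sf sg; apply/rowP => j; rewrite [LHS]mxE.
rewrite (pdD j I (mem_chart_at p) (atlas_chart_at p) sf sg).
by rewrite [RHS]mxE; congr (_ + _); rewrite mxE.
Qed.

Lemma dfun_cst (x : C) p : dfun (fun=> x) p = 0 :> 'rV_d.
Proof. by apply/rowP => j; rewrite [LHS]mxE pd_cst mxE. Qed.

Lemma form1_in_dfun c f q j : csmooth f -> atlas c -> cdom c q ->
  form1_in c (dfun f) q 0 j = pd c j f q.
Proof.
move=> sf ac cq.
have E := pdrow_chain openT I cq (mem_chart_at q) ac (atlas_chart_at q) sf.
rewrite -[LHS]/((pdrow (chart_at q) f q *m (cjacobian c (chart_at q) q)^T) 0 j) -E.
by rewrite mxE.
Qed.

Lemma closed1_dfun f (al : M -> 'rV[C]_d) : csmooth f -> (forall p, dfun f p = al p) -> closed1 al.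
Proof.
move=> sf E c p i j ac cp; have oc := @cdom_open _ _ _ c.
have -> : al = dfun f by apply/funext => q; rewrite E.
have P k l : pd c k (fun q => form1_in c (dfun f) q 0 l) p = pd c k (pd c l f) p.
  by apply: (pd_ext k oc cp cp) => q cq; exact: form1_in_dfun.
by rewrite !P (pd_comm i j oc cp cp ac (csmoothT (cdom c) sf)) subrr.
Qed.

Lemma rsmooth_locally_cst (f : M -> R) p : rsmooth_on setT f ->
  (forall c q j, atlas c -> cdom c q -> rpd c j f q = 0) ->
  exists2 V, open V /\ V p & forall q, V q -> f q = f p.
Proof.
move=> sf D0; set c := chart_at p; have cp : cdom c p := mem_chart_at p.
have ac : atlas c := atlas_chart_at p.
have : nbhs (cmap c p) (cmap c @` cdom c).
  by apply: open_nbhs_nbhs; split; [exact: cimg_open|exists p].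
move=> /nbhs_ballP [e e0 eB].
exists (cdom c `&` cmap c @^-1` ball (cmap c p) e).
  split; first by apply: preimg_chart_open; exact: ball_open.
  by split => //=; exact: ballxx.
move=> q [cq Bq].
have := @cst_of_derive_eq0 R d (fun x => f (cinv c x)) (cmap c p) e (cmap c q) e0 Bq.
rewrite !cmapK //; apply=> [x /eB [q' cq' <-]|x j /eB [q' cq' <-]].
  exact: (rsmooth_differentiable sf).
exact: D0.
Qed.

Lemma csmooth_locally_cst f p : csmooth f -> (forall q, dfun f q = 0) ->
  exists2 V, open V /\ V p & forall q, V q -> f q = f p.
Proof.
move=> sf D0; have /csmoothE [s1 s2] := sf.
have P c q j : atlas c -> cdom c q -> pd c j f q = 0.
  move=> ac cq; rewrite -form1_in_dfun // /form1_in D0 mul0mx mxE.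
  by [].
have [|V1 [oV1 V1p] E1] := rsmooth_locally_cst p s1.
  by move=> c q j ac cq; have := P c q j ac cq; rewrite pdE => /eqP; rewrite eq_complex => /andP[/eqP].
have [|V2 [oV2 V2p] E2] := rsmooth_locally_cst p s2.
  by move=> c q j ac cq; have := P c q j ac cq; rewrite pdE => /eqP; rewrite eq_complex => /andP[_ /eqP].
exists (V1 `&` V2); first by split; [exact: openI|].
by move=> q [Vq1 Vq2]; apply/eqP; rewrite eq_complex E1 // E2 // !eqxx.
Qed.

Lemma cst_of_dfun0 f p q : connected [set: M] -> csmooth f -> (forall q, dfun f q = 0) ->
  f q = f p.
Proof.
move=> cM sf D0; pose B := [set q | f q = f p].
have oB : open B.
  rewrite openE => q' Bq'; have [V [oV Vq'] E] := csmooth_locally_cst q' sf D0.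
  have N : nbhs q' V by apply: open_nbhs_nbhs.
  by apply: filterS N => x Vx; rewrite /B /= E.
have oB' : open (~` B).
  rewrite openE => q' Bq'; have [V [oV Vq'] E] := csmooth_locally_cst q' sf D0.
  have N : nbhs q' V by apply: open_nbhs_nbhs.
  by apply: filterS N => x Vx; rewrite /B /= E.
have BT : B = setT.
  apply: cM; first by exists p.
    by exists B => //; rewrite setTI.
  by exists B; [rewrite -[B]setCK; exact: open_closedC|rewrite setTI].
by have : B q by rewrite BT.
Qed.

End Differential.

(** * Linearity in g, the equivalences and uniqueness *)

Section Main.
Context {R : realType} {n : nat} {M : kaehlerManifold R n}.
Local Notation C := R[i].
Local Notation d := (n + n)%N.
Variable star : nat -> (M -> C) -> (M -> C) -> M -> C.

(** What the three kinds of action have in common; the rest of the argument relies on this alone.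
    The ground field being abstract, the properties of iota are recorded as well. *)
Lemma invariant_action_field (k : fieldType) (iota : k -> C) (g : vectType k)
    (X : g -> M -> 'rV[C]_d) : star_product star -> wick_type star ->
  invariant_action star iota X ->
  [/\ forall xi, holomorphic_field (X xi), forall p, linear_along iota (X^~ p),
      iota 1 = 1, {morph iota : x y / x + y} & {morph iota : x y / x * y}].
Proof.
move=> sP sW act; case: act => {k iota g X}.
- move=> g br X [_ vX lX _] inv; split => //.
  + by move=> xi; exact: (derivation_holomorphic_field sP sW (vX xi) (inv xi)).
  + by move=> x y; exact: rmorphD.
  + by move=> x y; exact: rmorphM.
- move=> g br X [_ vX lX _] inv; split => //.
  by move=> xi; exact: (derivation_holomorphic_field sP sW (vX xi) (inv xi)).
- move=> d' G g exp Phi expP act inv; split => //.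
  + by move=> xi; exact: (fundamental_holomorphic_field act expP xi sP sW inv).
  + by move=> p; exact: (fundamental_field_linear act expP).
  + by move=> x y; exact: rmorphD.
  + by move=> x y; exact: rmorphM.
Qed.

(** Primitives chosen for each xi separately need not depend linearly on xi. Those of a basis of the
    finite dimensional g are kept and extended linearly; linearity of X ensures that the extension
    still solves the equation. *)
Lemma deRham_linear (k : fieldType) (iota : k -> C) (g : vectType k)
    (X : g -> M -> 'rV[C]_d) (K : nat -> M -> 'M[C]_d) :
  (forall p, linear_along iota (X^~ p)) -> iota 1 = 1 ->
  {morph iota : x y / x + y} -> {morph iota : x y / x * y} ->
  (forall xi, deRham_class_vanishes (fun r => iprod (X xi) (K r))) ->
  exists J, cochain1_fun iota J /\
    forall xi r p, dfun (J xi r) p = iprod (X xi) (K r) p.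
Proof.
move=> lX i1 iD iM h.
have /choice [f fP] : forall xi, exists f : nat -> M -> C,
    fsmooth f /\ forall r p, dfun (f r) p = iprod (X xi) (K r) p.
  by move=> xi; have [_ [f sf E]] := h xi; exists f.
pose b := vbasis (@fullv _ g).
exists (fun xi r p => \sum_i iota (coord b i xi) * f b`_i r p); split; first split.
- move=> xi r; apply: (csmooth_sum _ openT) => i _.
  by apply: (csmoothM openT (csmooth_cst _ _)); have [+ _] := fP b`_i; apply.
- move=> r p s x y /=; rewrite scaler_sumr -big_split; apply: eq_bigr => i _ /=.
  by rewrite linearP /= iD iM mulrDl -mulrA.
move=> xi r p; rewrite dfun_comb; last by move=> i; have [+ _] := fP b`_i; apply.
have X0 : X 0 p = 0.
  have := lX p 1 0 0; rewrite i1 scaler0 addr0 scale1r => E.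
  by apply: (@addrI _ (X 0 p)); rewrite -E addr0.
have XS (s : seq 'I_(\dim {:g})) (x : 'I_(\dim {:g}) -> k) (v : 'I_(\dim {:g}) -> g) :
    X (\sum_(i <- s) x i *: v i) p = \sum_(i <- s) iota (x i) *: X (v i) p.
  elim: s => [|i s IH]; first by rewrite !big_nil.
  by rewrite !big_cons lX IH.
rewrite /iprod {2}(coord_vbasis (memvf xi)) XS mulmx_suml; apply: eq_bigr => i _.
by have [_ ->] := fP b`_i; rewrite /iprod scalemxAl.
Qed.

End Main.

Theorem mainTheorem5 (R : realType) (n : nat) (M : kaehlerManifold R n)
    (star : nat -> (M -> R[i]) -> (M -> R[i]) -> M -> R[i])
    (K : nat -> M -> 'M[R[i]]_(n + n))
    (k : fieldType) (iota : k -> R[i]) (g : vectType k)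
    (X : g -> M -> 'rV[R[i]]_(n + n))
    (star_prod : star_product star) (star_wick : wick_type star)
    (star_K : is_karabegov_form star K)
    (act : invariant_action star iota X) :
  let solution (J : g -> nat -> M -> R[i]) :=
    cochain1_fun iota J /\
    forall xi r p, dfun (J xi r) p = iprod (X xi) (K r) p in
  [/\ (exists J, quantum_hamiltonian iota star X J) <-> (exists J, solution J),
      (exists J, solution J) <->
        (forall xi, deRham_class_vanishes (fun r => iprod (X xi) (K r)))
    & connected [set: M] ->
      forall J, solution J ->
      forall J', solution J' <->
        exists2 s : g -> nat -> R[i], cochain1_scalar iota s
          & forall xi r p, J' xi r p = J xi r p + s xi r].
Proof.
move=> solution.
have [hX lX i1 iD iM] := invariant_action_field star_prod star_wick act.
(* More than the first equivalence: the same J serves on both sides. *)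
have QS J : quantum_hamiltonian iota star X J <-> solution J.
  split=> -[cJ h]; split => // xi; have [sJ _] := cJ.
    by apply/(quantum_iff star_prod star_wick star_K (hX xi) (sJ xi)); exact: h.
  have := (quantum_iff star_prod star_wick star_K (hX xi) (sJ xi)).2 (h xi).
  by [].
split.
- by split=> -[J /QS hJ]; exists J.
- split=> [[J [[sJ lJ] E]] xi|]; last exact: deRham_linear.
  split; last by exists (J xi).
  by move=> r; apply: (closed1_dfun (sJ xi r)) => p; exact: E.
move=> cM J [[sJ lJ] E] J'; split=> [[[sJ' lJ'] E']|[s sP sE]]; last first.
  have JE xi r : J' xi r = fun p => J xi r p + s xi r by apply/funext => p; exact: sE.
  split; first split.
  - by move=> xi r; rewrite JE; apply: (csmoothD openT (sJ xi r)); exact: csmooth_cst.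
  - move=> r p t x y; rewrite !sE (lJ r p) sP scalerDr addrACA.
    by [].
  - move=> xi r p; by rewrite JE (dfunD p (sJ xi r) (csmooth_cst setT (s xi r))) dfun_cst addr0.
(* The constants are the values of J' - J at a base point. The empty manifold passes the
   connectedness test, and there s = 0 will do. *)
have [[p0 _]|noM] := pselect (exists p : M, True); last first.
  exists (fun _ _ => 0) => [r t x y|xi r p]; first by rewrite scaler0 addr0.
  by exfalso; apply: noM; exists p.
exists (fun xi r => J' xi r p0 - J xi r p0).
  move=> r t x y; rewrite (lJ r p0) (lJ' r p0) scalerBr opprD addrACA.
  by [].
move=> xi r p.
have sD : csmooth (fun q => J' xi r q + -1 * J xi r q).
  by apply: (csmoothD openT (sJ' xi r)); exact: (csmoothM openT (csmooth_cst _ _) (sJ xi r)).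
have D0 q : dfun (fun q => J' xi r q + -1 * J xi r q) q = 0.
  have := dfun_comb [:: true; false] (fun b : bool => if b then 1 else -1)
    (f := fun b : bool => if b then J' xi r else J xi r) q.
  rewrite big_cons big_seq1 /= E E' scale1r scaleN1r subrr => <-; last first.
    by case; [exact: sJ'|exact: sJ].
  by congr (dfun _ q); apply/funext => q'; rewrite big_cons big_seq1 mul1r.
have := cst_of_dfun0 p0 p cM sD D0; rewrite !mulN1r => <-.
by rewrite addrC subrK.
Qed.
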